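(* For each $n \in \mathbb{N}$, the following hold. (a) There exists $a \in \mathrm{CompStr}$ such that $\mathrm{ACL}^a_n$ is a $\Sigma^0_{n+2}$-complete set. (b) There exists $b \in \mathrm{CompStr}$ such that $\mathrm{DCL}^b_n \equiv_{\mathrm{T}} \mathbf{0}^{(n+1)}$. (c) There is a computable set $\Phi$ of first-order $\mathcal{L}_a$-formulas, all of quantifier rank at most $n$, such that $\mathrm{acl}_{\Phi, a}$ is a $\Sigma^0_{n+2}$-complete set, where $a\in\mathrm{CompStr}$ is as in (a) (i.e., a single $a$ witnesses both (a) and (c)). (d) There exist $d \in \mathrm{CompStr}$ and a computable set $\Theta$ of first-order $\mathcal{L}_d$-formulas, all of quantifier rank at most $n$, such that $\mathrm{dcl}_{\Theta, d}$ is a $\Sigma^0_{n+2}$-complete set.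
   Context: Computable structures. Languages are relational and may be many-sorted: $\mathcal{L} = ((X_j)_{j\in J}, (R_i)_{i\in I})$ with sorts $X_j$ and relation symbols $R_i$, where $I,J\in\mathbb{N}\cup\{\mathbb{N}\}$ (a natural number is identified with the set of its predecessors). The type of a tuple of elements or variables is the product of the sorts of its entries, in order; the type of a relation symbol is a finite product of sorts. $\mathcal{L}$ is computable when the function sending $i\in I$ to $(j_0,\dots,j_{m-1})$, where $R_i$ has type $\prod_{k<m}X_{j_k}$, is computable; for each computable language a computable encoding of its first-order formulas is fixed. A computable $\mathcal{L}$-structure $\mathcal{N}$ has a computable underlying set, and $\{(a,j) : a\in (X_j)^{\mathcal{N}}\}$ and $\{(\overline{b},i) : \overline{b}\in (R_i)^{\mathcal{N}}\}$ are computable. Writing $\{e\}$ for the $e$th Turing machine, $c\in\mathbb{N}$ is a code for a structure if $\{c\}(0)$ is a code for a computable language, denoted $\mathcal{L}_c$, and $\{c\}(1)$ is a code for a computable $\mathcal{L}_c$-structure, denoted $\mathcal{M}_c$. $\mathrm{CompStr}$ is the set of all codes for structures. Formulas $\varphi(\overline{x};\overline{y})$ come with a specified partition of their free variables. A ''set of formulas'' is a set of formulas with specified variable partitions. $\mathrm{ACL}^c_n$ is the set of pairs $(\varphi(\overline{x};\overline{y}),\overline{a})$ such that $\varphi$ is a first-order $\mathcal{L}_c$-formula that is a Boolean combination of $\Sigma_n$-formulas, $\overline{a}\in\mathcal{M}_c$ has the same type as $\overline{x}$, and $\{\overline{b}\in\mathcal{M}_c : \mathcal{M}_c\models\varphi(\overline{a};\overline{b})\}$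 is finite (possibly empty). $\mathrm{DCL}^c_n$ is defined in the same way, with ''finite'' replaced by ''a singleton''. Closure operators. For a set $\Phi$ of first-order $\mathcal{L}$-formulas, an $\mathcal{L}$-structure $\mathcal{N}$, $B\subseteq\mathcal{N}$ and $S\subseteq\mathbb{N}\cup\{\infty\}$: $\mathrm{cl}^0_{\Phi,\mathcal{N}}(B,S):=B$; $\mathrm{cl}^1_{\Phi,\mathcal{N}}(B,S)$ is $B$ together with all $b\in\mathcal{N}$ for which there are $\varphi\in\Phi$ and a tuple $\overline{a}$ from $B$ with $|\{\overline{d} : \mathcal{N}\models\varphi(\overline{a};\overline{d})\}|\in S$ and a tuple $\overline{b}\in\mathcal{N}$ having $b$ as an entry with $\mathcal{N}\models\varphi(\overline{a};\overline{b})$; $\mathrm{cl}^{m+1}_{\Phi,\mathcal{N}}(B,S):=\mathrm{cl}^1_{\Phi,\mathcal{N}}(\mathrm{cl}^m_{\Phi,\mathcal{N}}(B,S),S)$; and $\mathrm{cl}_{\Phi,\mathcal{N}}(B,S):=\bigcup_m \mathrm{cl}^m_{\Phi,\mathcal{N}}(B,S)$. Put $\mathrm{acl}_{\Phi,\mathcal{N}}(B):=\mathrm{cl}_{\Phi,\mathcal{N}}(B,\mathbb{N})$ and $\mathrm{dcl}_{\Phi,\mathcal{N}}(B):=\mathrm{cl}_{\Phi,\mathcal{N}}(B,\{1\})$. As sets, $\mathrm{acl}_{\Phi,\mathcal{N}}:=\{(a,A) : A\subseteq\mathcal{N}\text{ finite},\ a\in\mathrm{acl}_{\Phi,\mathcal{N}}(A)\}$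 and $\mathrm{dcl}_{\Phi,\mathcal{N}}:=\{(a,A) : A\subseteq\mathcal{N}\text{ finite},\ a\in\mathrm{dcl}_{\Phi,\mathcal{N}}(A)\}$; write $\mathrm{acl}_{\Phi,c}$, $\mathrm{dcl}_{\Phi,c}$ when $\mathcal{N}=\mathcal{M}_c$. $\mathbf{0}^{(m)}$ denotes the $m$th Turing jump of the empty set. *)

(* Defs.v *)
From mathcomp Require Import all_boot finmap.
From mathcomp Require Import boolp classical_sets cardinality.
From Stdlib Require Import Arith.Cantor.

Set Implicit Arguments.
Unset Strict Implicit.
Unset Printing Implicit Defensive.

Local Open Scope nat_scope.
Local Open Scope classical_set_scope.
Local Open Scope card_scope.

Definition cpair (x y : nat) : nat := Cantor.to_nat (x, y).
Definition cfst (z : nat) : nat := (Cantor.of_nat z).1.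
Definition csnd (z : nat) : nat := (Cantor.of_nat z).2.

(* A bijection between finite sequences of numbers and numbers. *)
Fixpoint seq_num (s : seq nat) : nat :=
  if s is x :: s' then (cpair x (seq_num s')).+1 else 0.

(* Programs for the partial recursive functions relative to an oracle, as
   unary functions with several arguments packed by the Cantor pairing. *)
Inductive prog : Type :=
| PZero
| PSucc
| PFst
| PSnd
| POracle
| PPair of prog & prog
| PComp of prog & prog
| PRec of prog & prog
| PMu of prog.

(* [eval A p x y]: program [p] with oracle [A] halts on input [x] with output
   [y].  [PRec p q] maps <a, 0> to p(a) and <a, k+1> to q<a, <k, r>>, where r is
   its value at <a, k>; [PMu p] maps [x] to the least [y] with p<x, y> = 0,
   and is undefined if p<x, z> diverges for some smaller [z]. *)
Fixpoint eval (A : set nat) (p : prog) (x y : nat) {struct p} : Prop :=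
  match p with
  | PZero => y = 0
  | PSucc => y = x.+1
  | PFst => y = cfst x
  | PSnd => y = csnd x
  | POracle => (A x /\ y = 1) \/ (~ A x /\ y = 0)
  | PPair p q => exists u v, [/\ eval A p x u, eval A q x v & y = cpair u v]
  | PComp p q => exists2 u, eval A q x u & eval A p u y
  | PRec p q =>
      let a := cfst x in
      (fix iter (k : nat) (z : nat) {struct k} : Prop :=
         match k with
         | 0 => eval A p a z
         | k'.+1 => exists2 r, iter k' r & eval A q (cpair a (cpair k' r)) z
         end) (csnd x) y
  | PMu p =>
      eval A p (cpair x y) 0 /\
      forall z, z < y -> exists v, eval A p (cpair x z) v.+1
  end.

Fixpoint prog_num (p : prog) : nat :=
  match p with
  | PZero => cpair 0 0
  | PSucc => cpair 1 0
  | PFst => cpair 2 0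
  | PSnd => cpair 3 0
  | POracle => cpair 4 0
  | PPair p q => cpair 5 (cpair (prog_num p) (prog_num q))
  | PComp p q => cpair 6 (cpair (prog_num p) (prog_num q))
  | PRec p q => cpair 7 (cpair (prog_num p) (prog_num q))
  | PMu p => cpair 8 (prog_num p)
  end.

(* [phi A e x y]: {e}^A(x) is defined and equal to [y].  A number that is not
   the number of a program indexes the nowhere defined function. *)
Definition phi (A : set nat) (e x y : nat) : Prop :=
  exists2 p, prog_num p = e & eval A p x y.

Definition halts (A : set nat) (e x : nat) : Prop := exists y, phi A e x y.

(* {e}(x), with junk value 0 where it is undefined. *)
Definition run (e x : nat) : nat := xget 0 [set y | phi set0 e x y].

Definition turing_le (A B : set nat) : Prop :=
  exists e, forall x, (A x -> phi B e x 1) /\ (~ A x -> phi B e x 0).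

Definition turing_equiv (A B : set nat) : Prop :=
  turing_le A B /\ turing_le B A.

Definition computable_set (A : set nat) : Prop := turing_le A set0.

Definition computable_fun (f : nat -> nat) : Prop :=
  exists e, forall x, phi set0 e x (f x).

Definition jump (A : set nat) : set nat := [set e | halts A e e].

Definition zero_jump (m : nat) : set nat := iter m jump set0.

(* Sigma^0_k sets; Pi^0_k sets are the complements of Sigma^0_k sets. *)
Fixpoint arith_Sigma (k : nat) (A : set nat) : Prop :=
  match k with
  | 0 => computable_set A
  | k'.+1 => exists2 B : set nat, arith_Sigma k' (~` B) &
               A = [set x | exists y, B (cpair x y)]
  end.

Definition many_one_le (A B : set nat) : Prop :=
  exists2 f : nat -> nat, computable_fun f & forall x, A x <-> B (f x).

Definition Sigma_complete (k : nat) (A : set nat) : Prop :=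
  arith_Sigma k A /\ forall B, arith_Sigma k B -> many_one_le B A.

(* Elements of |N \cup {|N}, with [None] for |N itself, as sets of numbers. *)
Definition initseg (k : option nat) : set nat :=
  [set i | if k is Some m then i < m else True].

(* Only the values of [rel_type] on [initseg num_rels] are relevant. *)
Record language := Language {
  num_sorts : option nat;
  num_rels : option nat;
  rel_type : nat -> seq nat
}.

(* Structures whose underlying set is a set of natural numbers. *)
Record structure := Structure {
  univ : set nat;
  in_sort : nat -> set nat;
  in_rel : nat -> set (seq nat)
}.

(* [has_type N js a]: the sorts of the entries of [a] are, in order, [js]. *)
Fixpoint has_type (N : structure) (js a : seq nat) : Prop :=
  match js, a with
  | [::], [::] => True
  | j :: js', b :: a' => in_sort N j b /\ has_type N js' a'
  | _, _ => False
  end.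

Definition is_language (L : language) : Prop :=
  forall i, initseg (num_rels L) i ->
  forall j, j \in rel_type L i -> initseg (num_sorts L) j.

(* The sorts partition the underlying set (some of them may be empty). *)
Definition is_structure (L : language) (N : structure) : Prop :=
  [/\ forall j b, in_sort N j b -> initseg (num_sorts L) j /\ univ N b,
      forall b, univ N b -> exists j, in_sort N j b,
      forall j k b, in_sort N j b -> in_sort N k b -> j = k &
      forall i a, in_rel N i a ->
        initseg (num_rels L) i /\ has_type N (rel_type L i) a].

(* The variable (j, k) is the k-th variable of sort j. *)
Definition var : Type := (nat * nat)%type.

Inductive form : Type :=
| FEq of var & var
| FRel of nat & seq var
| FNot of form
| FAnd of form & form
| FOr of form & form
| FEx of var & form
| FAll of var & form.

Fixpoint wf_form (L : language) (f : form) : Prop :=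
  match f with
  | FEq u v => u.1 = v.1 /\ initseg (num_sorts L) u.1
  | FRel i vs => initseg (num_rels L) i /\ [seq v.1 | v <- vs] = rel_type L i
  | FNot g => wf_form L g
  | FAnd g h | FOr g h => wf_form L g /\ wf_form L h
  | FEx v g | FAll v g => initseg (num_sorts L) v.1 /\ wf_form L g
  end.

Fixpoint free_vars (f : form) : seq var :=
  match f with
  | FEq u v => [:: u; v]
  | FRel _ vs => vs
  | FNot g => free_vars g
  | FAnd g h | FOr g h => free_vars g ++ free_vars h
  | FEx v g | FAll v g => [seq u <- free_vars g | u != v]
  end.

Definition upd (s : var -> nat) (v : var) (b : nat) : var -> nat :=
  fun u => if u == v then b else s u.

Fixpoint sat (N : structure) (s : var -> nat) (f : form) : Prop :=
  match f with
  | FEq u v => s u = s v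
  | FRel i vs => in_rel N i [seq s v | v <- vs]
  | FNot g => ~ sat N s g
  | FAnd g h => sat N s g /\ sat N s h
  | FOr g h => sat N s g \/ sat N s h
  | FEx v g => exists2 b, in_sort N v.1 b & sat N (upd s v b) g
  | FAll v g => forall b, in_sort N v.1 b -> sat N (upd s v b) g
  end.

Fixpoint quantifier_rank (f : form) : nat :=
  match f with
  | FEq _ _ | FRel _ _ => 0
  | FNot g => quantifier_rank g
  | FAnd g h | FOr g h => maxn (quantifier_rank g) (quantifier_rank h)
  | FEx _ g | FAll _ g => (quantifier_rank g).+1
  end.

(* Prenex classes, with possibly empty quantifier blocks; at level 0 both
   consist of the quantifier-free formulas. *)
Inductive Sigma_form : nat -> form -> Prop :=
| Sigma_form0 f : quantifier_rank f = 0 -> Sigma_form 0 f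
| Sigma_formS n f : Pi_form n f -> Sigma_form n.+1 f
| Sigma_formEx n v f : Sigma_form n.+1 f -> Sigma_form n.+1 (FEx v f)
with Pi_form : nat -> form -> Prop :=
| Pi_form0 f : quantifier_rank f = 0 -> Pi_form 0 f
| Pi_formS n f : Sigma_form n f -> Pi_form n.+1 f
| Pi_formAll n v f : Pi_form n.+1 f -> Pi_form n.+1 (FAll v f).

Inductive bool_comb (P : form -> Prop) : form -> Prop :=
| bool_comb_base f : P f -> bool_comb P f
| bool_comb_not f : bool_comb P f -> bool_comb P (FNot f)
| bool_comb_and f g : bool_comb P f -> bool_comb P g -> bool_comb P (FAnd f g)
| bool_comb_or f g : bool_comb P f -> bool_comb P g -> bool_comb P (FOr f g).

(* Formulas phi(x; y) with a partition of their free variables. *)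
Record pform := PForm {
  body : form;
  left_vars : seq var;
  right_vars : seq var
}.

Definition is_pform (L : language) (f : pform) : Prop :=
  [/\ wf_form L (body f),
      uniq (left_vars f ++ right_vars f) &
      left_vars f ++ right_vars f =i free_vars (body f)].

Definition left_type (f : pform) : seq nat := [seq v.1 | v <- left_vars f].
Definition right_type (f : pform) : seq nat := [seq v.1 | v <- right_vars f].

Definition assign (vs : seq var) (bs : seq nat) : var -> nat :=
  fun v => nth 0 bs (index v vs).

(* { b in N : N |= phi(a; b) } *)
Definition solutions (N : structure) (f : pform) (a : seq nat) : set (seq nat) :=
  [set b | has_type N (right_type f) b /\
           sat N (assign (left_vars f ++ right_vars f) (a ++ b)) (body f)].

Definition var_num (v : var) : nat := cpair v.1 v.2.

Fixpoint form_num (f : form) : nat :=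
  match f with
  | FEq u v => cpair 0 (cpair (var_num u) (var_num v))
  | FRel i vs => cpair 1 (cpair i (seq_num [seq var_num v | v <- vs]))
  | FNot g => cpair 2 (form_num g)
  | FAnd g h => cpair 3 (cpair (form_num g) (form_num h))
  | FOr g h => cpair 4 (cpair (form_num g) (form_num h))
  | FEx v g => cpair 5 (cpair (var_num v) (form_num g))
  | FAll v g => cpair 6 (cpair (var_num v) (form_num g))
  end.

Definition pform_num (f : pform) : nat :=
  cpair (form_num (body f))
    (cpair (seq_num [seq var_num v | v <- left_vars f])
           (seq_num [seq var_num v | v <- right_vars f])).

(* [0] stands for |N and [m.+1] for the natural number [m]. *)
Definition decode_size (k : nat) : option nat :=
  if k is m.+1 then Some m else None.

(* A code of a computable language is <J, <I, e>>, where [e] is an index of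
   the function sending i in I to the type of the i-th relation symbol. *)
Definition language_of (l : nat) : language :=
  {| num_sorts := decode_size (cfst l);
     num_rels := decode_size (cfst (csnd l));
     rel_type := fun i => xget [::]
       [set js | phi set0 (csnd (csnd l)) i (seq_num js)] |}.

Definition language_code (l : nat) : Prop :=
  is_language (language_of l) /\
  forall i, initseg (num_rels (language_of l)) i -> halts set0 (csnd (csnd l)) i.

(* A code of a computable structure is <u, <v, w>>, where u, v and w are
   indices of the characteristic functions of the underlying set, of the set
   of pairs (a, j) with a of sort j, and of the set of pairs (b, i) with the
   tuple b in the i-th relation. *)
Definition structure_of (s : nat) : structure :=
  {| univ := [set a | phi set0 (cfst s) a 1];
     in_sort := fun j => [set a | phi set0 (cfst (csnd s)) (cpair a j) 1];
     in_rel := fun i =>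
       [set b | phi set0 (csnd (csnd s)) (cpair (seq_num b) i) 1] |}.

Definition is_char_index (e : nat) : Prop :=
  forall x, phi set0 e x 0 \/ phi set0 e x 1.

Definition structure_code (L : language) (s : nat) : Prop :=
  [/\ is_char_index (cfst s), is_char_index (cfst (csnd s)),
      is_char_index (csnd (csnd s)) & is_structure L (structure_of s)].

(* The language and structure coded by [c], relevant for c in CompStr. *)
Definition Lang (c : nat) : language := language_of (run c 0).
Definition Mod (c : nat) : structure := structure_of (run c 1).

Definition CompStr : set nat :=
  [set c | [/\ halts set0 c 0, halts set0 c 1, language_code (run c 0) &
               structure_code (Lang c) (run c 1)]].

Definition ACL (c n : nat) : set (pform * seq nat) :=
  [set p | [/\ is_pform (Lang c) p.1,
               bool_comb (Sigma_form n) (body p.1),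
               has_type (Mod c) (left_type p.1) p.2 &
               finite_set (solutions (Mod c) p.1 p.2)]].

Definition DCL (c n : nat) : set (pform * seq nat) :=
  [set p | [/\ is_pform (Lang c) p.1,
               bool_comb (Sigma_form n) (body p.1),
               has_type (Mod c) (left_type p.1) p.2 &
               exists b, solutions (Mod c) p.1 p.2 = [set b]]].

Definition CL_num (p : pform * seq nat) : nat :=
  cpair (pform_num p.1) (seq_num p.2).

(* Cardinalities in |N \cup {oo}, with [None] for oo. *)
Definition has_card (T : Type) (X : set T) (k : option nat) : Prop :=
  if k is Some m then X #= `I_m else infinite_set X.

Definition cl1 (Phi : set pform) (N : structure) (B : set nat)
    (S : set (option nat)) : set nat :=
  B `|` [set b | exists f a,
    [/\ Phi f,
        [set` a] `<=` B /\ has_type N (left_type f) a,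
        exists2 k, S k & has_card (solutions N f a) k &
        exists2 bs, solutions N f a bs & b \in bs]].

Definition cln (m : nat) (Phi : set pform) (N : structure) (B : set nat)
    (S : set (option nat)) : set nat :=
  iter m (fun C => cl1 Phi N C S) B.

Definition cl (Phi : set pform) (N : structure) (B : set nat)
    (S : set (option nat)) : set nat :=
  \bigcup_m cln m Phi N B S.

Definition acl_of (Phi : set pform) (N : structure) (B : set nat) : set nat :=
  cl Phi N B (range Some).

Definition dcl_of (Phi : set pform) (N : structure) (B : set nat) : set nat :=
  cl Phi N B [set Some 1].

Definition acl (Phi : set pform) (N : structure) : set (nat * {fset nat}) :=
  [set p | [set` p.2] `<=` univ N /\ acl_of Phi N [set` p.2] p.1].

Definition dcl (Phi : set pform) (N : structure) : set (nat * {fset nat}) :=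
  [set p | [set` p.2] `<=` univ N /\ dcl_of Phi N [set` p.2] p.1].

(* Finite sets of numbers are coded by their canonical index. *)
Definition fset_num (A : {fset nat}) : nat := \sum_(i <- A) 2 ^ i.

Definition cl_num (p : nat * {fset nat}) : nat := cpair p.1 (fset_num p.2).

Definition computable_formulas (L : language) (n : nat) (Phi : set pform) : Prop :=
  [/\ forall f, Phi f -> is_pform L f,
      computable_set (pform_num @` Phi) &
      forall f, Phi f -> quantifier_rank (body f) <= n].

(* Main.v *)
Require Import Defs.
From mathcomp Require Import all_boot finmap zify.
From mathcomp Require Import boolp classical_sets cardinality.
From Stdlib Require Import Arith.Cantor.

Set Implicit Arguments.
Unset Strict Implicit.
Unset Printing Implicit Defensive.

Local Open Scope nat_scope.
Local Open Scope classical_set_scope.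

(** The upper bounds rest on one observation: a formula with at most [n]
    alternations of quantifiers is evaluated by the oracle [zero_jump n],
    uniformly in its number ([Dec_sat_bounded]).  Indeed a block of equal
    quantifiers asks whether some finite assignment of values to the variables
    of the block satisfies a formula with fewer alternations, which costs one
    jump.  Hence to have exactly one solution is decidable in
    [zero_jump n.+1] ([Dec_singleton_solutions]); to have finitely many is to
    have a bound on the solutions, and is enumerable in [zero_jump n.+1]
    ([ce_finite_solutions]).  By Post's theorem ([arith_SigmaP]) the sets
    enumerable in [zero_jump k] are the [Sigma_(k+1)] sets.

    Post's theorem needs two facts about programs.  The jump is enumerable in
    its oracle ([ce_jump]), which is shown with a universal machine working on
    the numbers of programs; and a computation with the oracle [jump A] is
    certified by its list of oracle answers, of which the positive ones come
    with witnesses, so that only the negative ones need a universal quantifier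
    over [A]-computable facts ([ce_jump_unfold]).

    For the lower bounds it suffices to reduce [zero_jump n.+2] (in the second
    part, [zero_jump n.+1]).  A [Sigma_n] set of pairs is by definition
    expressed by [n] alternating quantifiers in front of a computable relation,
    so any two such sets [P] and [Q] are defined by prenex formulas with [n]
    quantifiers in a suitable computable structure on the natural numbers, with
    one sort and two relation symbols ([exists_structure2]).  Boolean
    combinations of these two formulas with two free variables do the rest.

    - Membership of [x] in [zero_jump n.+2] reads: for some [u], no [v]
      satisfies [M(x, u, v)], where [M] is [Pi_n].  The solutions for [x] are
      the lists of least witnesses [v_0, v_1, ...] with [M(x, i, v_i)].  There
      is one list of each length as long as witnesses exist, hence finitely
      many lists exactly when [x] is in [zero_jump n.+2].  Minimality is a
      [Sigma_n] condition and being a witness a [Pi_n] one, so one formula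
      serves for ACL and for the closure operator acl.

    - Membership of [x] in [zero_jump n.+1] reads: [B(x, u)] for some [u],
      where [B] is [Pi_n].  The formula whose solutions are [0] and the
      [u + 1] with [B(x, u)] has one solution exactly when [x] is not a member.

    - For dcl one formula leads from the element [<x, u>] to [<x, u + 1>], and
      another one has for [<x, u>] the solution [1] and one further solution for
      each [v] with [M(x, u, v)].  So [1] is in the closure of [<x, 0>] exactly
      when for some [u] there is no such [v]. *)

(** * Pairing and lists of numbers *)

Lemma cfstK x y : cfst (cpair x y) = x.
Proof. by rewrite /cfst /cpair cancel_of_to. Qed.

Lemma csndK x y : csnd (cpair x y) = y.
Proof. by rewrite /csnd /cpair cancel_of_to. Qed.

Lemma cpairK z : cpair (cfst z) (csnd z) = z.
Proof. by rewrite /cpair /cfst /csnd -surjective_pairing cancel_to_of. Qed.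

Lemma cpair_inj x y x' y' : cpair x y = cpair x' y' -> x = x' /\ y = y'.
Proof. by move=> e; rewrite -(cfstK x y) -{2}(csndK x y) e cfstK csndK. Qed.

Lemma cpair_ge x y : x + y <= cpair x y.
Proof. by have /leP := to_nat_non_decreasing x y; rewrite /cpair; lia. Qed.

Lemma ltn_cpair x y : 0 < x -> y < cpair x y.
Proof.
have := to_nat_spec x y; rewrite /cpair -[Nat.mul]/muln -[Nat.add]/addn => e x0.
by move: e; move: (to_nat _) => m; nia.
Qed.

Lemma cpair00 : cpair 0 0 = 0. Proof. by []. Qed.

(* Numbers of programs and of formulas are astronomically large: unification
   must not compute with them. *)
#[local] Opaque cpair cfst csnd.
Arguments cpair : simpl never.
Arguments cfst : simpl never.
Arguments csnd : simpl never.

Lemma cfst0 : cfst 0 = 0. Proof. by rewrite -cpair00 cfstK. Qed.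

Lemma csnd0 : csnd 0 = 0. Proof. by rewrite -cpair00 csndK. Qed.

Lemma cfst_le z : cfst z <= z.
Proof. by rewrite -{2}(cpairK z); have := cpair_ge (cfst z) (csnd z); lia. Qed.

Lemma csnd_le z : csnd z <= z.
Proof. by rewrite -{2}(cpairK z); have := cpair_ge (cfst z) (csnd z); lia. Qed.

Lemma csnd_lt z : 0 < cfst z -> csnd z < z.
Proof. by move=> h; rewrite -{2}(cpairK z) ltn_cpair. Qed.

Definition cpairE := (cfstK, csndK).

(** Head and tail on the codes of lists; a nonempty list has the code [c] with
    [c.-1] the pair of its head and of the code of its tail. *)
Definition ctl (c : nat) : nat := csnd c.-1.
Definition chd (c : nat) : nat := cfst c.-1.

Fixpoint unseq_rec (fuel c : nat) : seq nat :=
  if fuel is k.+1 then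
    if c is 0 then [::] else chd c :: unseq_rec k (ctl c)
  else [::].

Definition unseq (c : nat) : seq nat := unseq_rec c c.

Lemma ctl_lt c : 0 < c -> ctl c < c.
Proof. by case: c => // c _; rewrite /ctl /= ltnS csnd_le. Qed.

Lemma unseq_recE k c : c <= k -> unseq_rec k c = unseq c.
Proof.
rewrite /unseq; elim/ltn_ind: c k => -[|c] IH [|k] //= le.
have lt := ctl_lt (ltn0Sn c).
congr cons.
by rewrite (IH _ lt) ?(IH _ lt c) //; lia.
Qed.

Lemma unseqS c : 0 < c -> unseq c = chd c :: unseq (ctl c).
Proof.
case: c => // c _; rewrite {1}/unseq /= unseq_recE //.
by have := ctl_lt (ltn0Sn c); lia.
Qed.

Lemma seq_numK : cancel seq_num unseq.
Proof.
by elim=> //= x s IH; rewrite unseqS // /chd /ctl /= !cpairE IH.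
Qed.

Lemma unseqK : cancel unseq seq_num.
Proof.
elim/ltn_ind => -[|c] IH //; rewrite unseqS //= IH ?ctl_lt //.
by rewrite /chd /ctl cpairK.
Qed.

Lemma seq_num_inj : injective seq_num. Proof. exact: can_inj seq_numK. Qed.

Lemma mem_seq_num x (s : seq nat) : x \in s -> x < seq_num s.
Proof.
elim: s => //= y s IH; rewrite in_cons ltnS => /orP[/eqP->|/IH].
  by have := cpair_ge y (seq_num s); lia.
by have := cpair_ge y (seq_num s); lia.
Qed.

(** * Functions computed with an oracle *)

(** Total functions suffice: an enumerable set will be presented by a decidable
    relation rather than by a partial function. *)
Definition Rec (A : set nat) (f : nat -> nat) : Prop :=
  exists p, forall x, eval A p x (f x).

(** The local fixpoint in the definition of [eval], named so that inductions
    can mention it; the argument [a] stays outside the fixpoint to keep both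
    convertible. *)
Definition rec_graph (P Q : nat -> nat -> Prop) (a : nat) :=
  fix iter (k z : nat) {struct k} : Prop :=
    match k with
    | 0 => P a z
    | k'.+1 => exists2 r, iter k' r & Q (cpair a (cpair k' r)) z
    end.

Lemma eval_PRec A p q x y :
  eval A (PRec p q) x y = rec_graph (eval A p) (eval A q) (cfst x) (csnd x) y.
Proof. by []. Qed.

Lemma eval_det A p x y y' : eval A p x y -> eval A p x y' -> y = y'.
Proof.
elim: p x y y' => [||||| p IHp q IHq| p IHp q IHq| p IHp q IHq| p IHp] x y y'.
- by move=> -> ->.
- by move=> -> ->.
- by move=> -> ->.
- by move=> -> ->.
- by move=> [[? ->]|[? ->]] [[? ->]|[? ->]].
- move=> /= [u [v [hu hv ->]]] [u' [v' [hu' hv' ->]]].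
  by rewrite (IHp _ _ _ hu hu') (IHq _ _ _ hv hv').
- by move=> /= [u hu h] [u' /(IHq _ _ _ hu)<- h']; apply: IHp h h'.
- rewrite !eval_PRec; move: (csnd x) => k.
  elim: k y y' => [|k IH] y y' /=; first exact: IHp.
  by move=> [r hr h] [r' /(IH _ _ hr)<- h']; apply: IHq h h'.
- move=> /= [h lt] [h' lt'].
  case: (ltngtP y y') => // [/lt'|/lt] [v hv].
    by have := IHp _ _ _ h hv.
  by have := IHp _ _ _ h' hv.
Qed.

Lemma Rec_ext A f g : f =1 g -> Rec A f -> Rec A g.
Proof. by move=> /funext ->. Qed.

Lemma Rec_id A : Rec A id.
Proof.
exists (PPair PFst PSnd) => x /=.
by exists (cfst x), (csnd x); rewrite cpairK.
Qed.

Lemma Rec_const A c : Rec A (fun _ => c).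
Proof.
elim: c => [|c [p hp]]; first by exists PZero.
by exists (PComp PSucc p) => x /=; exists c.
Qed.

Lemma Rec_comp1 A g f : Rec A g -> Rec A f -> Rec A (fun x => g (f x)).
Proof.
by move=> [p hp] [q hq]; exists (PComp p q) => x /=; exists (f x).
Qed.

Lemma Rec_S A f : Rec A f -> Rec A (fun x => (f x).+1).
Proof. by apply: (@Rec_comp1 _ S); exists PSucc. Qed.

Lemma Rec_fst A f : Rec A f -> Rec A (fun x => cfst (f x)).
Proof. by apply: (@Rec_comp1 _ cfst); exists PFst. Qed.

Lemma Rec_snd A f : Rec A f -> Rec A (fun x => csnd (f x)).
Proof. by apply: (@Rec_comp1 _ csnd); exists PSnd. Qed.

Lemma Rec_pair A f g : Rec A f -> Rec A g -> Rec A (fun x => cpair (f x) (g x)).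
Proof.
by move=> [p hp] [q hq]; exists (PPair p q) => x /=; exists (f x), (g x).
Qed.

(** A function of several arguments is computable if it is so after packing its
    arguments by the pairing. *)
Lemma Rec_comp2 A F f g :
  Rec A (fun z => F (cfst z) (csnd z)) -> Rec A f -> Rec A g ->
  Rec A (fun x => F (f x) (g x)).
Proof.
move=> hF hf hg.
apply: Rec_ext (Rec_comp1 hF (Rec_pair hf hg)) => x /=; by rewrite !cpairE.
Qed.

Lemma Rec_comp3 A F f g h :
  Rec A (fun z => F (cfst z) (cfst (csnd z)) (csnd (csnd z))) ->
  Rec A f -> Rec A g -> Rec A h -> Rec A (fun x => F (f x) (g x) (h x)).
Proof.
move=> hF hf hg hh.
apply: Rec_ext (Rec_comp1 hF (Rec_pair hf (Rec_pair hg hh))) => x /=.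
by rewrite !cpairE.
Qed.

Lemma Rec_iteri A n g h :
  Rec A n -> Rec A g ->
  Rec A (fun z => h (cfst z) (cfst (csnd z)) (csnd (csnd z))) ->
  Rec A (fun x => iteri (n x) (fun i r => h x i r) (g x)).
Proof.
move=> hn [p hp] [q hq].
suff hr : Rec A (fun z => iteri (csnd z) (h (cfst z)) (g (cfst z))).
  by apply: Rec_ext (Rec_comp1 hr (Rec_pair (Rec_id A) hn)) => x /=; rewrite !cpairE.
exists (PRec p q) => x; rewrite eval_PRec.
elim: (csnd x) => [|k IH] //=; exists (iteri k (h (cfst x)) (g (cfst x))) => //.
by have := hq (cpair (cfst x) (cpair k (iteri k (h (cfst x)) (g (cfst x)))));
   rewrite !cpairE.
Qed.

Lemma Rec_iter A n g h :
  Rec A n -> Rec A g -> Rec A (fun z => h (cfst z) (csnd z)) ->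
  Rec A (fun x => iter (n x) (fun r => h x r) (g x)).
Proof.
move=> hn hg hh.
apply: (@Rec_ext _ (fun x => iteri (n x) (fun i r => h x r) (g x))).
  by move=> x; elim: (n x) => //= k ->.
apply: Rec_iteri => //.
by apply: (Rec_comp2 hh); [exact/Rec_fst/Rec_id | exact/Rec_snd/Rec_snd/Rec_id].
Qed.

Lemma Rec_pred A f : Rec A f -> Rec A (fun x => (f x).-1).
Proof.
apply: (@Rec_comp1 _ predn).
apply: (@Rec_ext _ (fun x => iteri x (fun i r => i) 0)); first by case.
by apply: Rec_iteri; [exact: Rec_id|exact: Rec_const|exact/Rec_fst/Rec_snd/Rec_id].
Qed.

Lemma Rec_add A f g : Rec A f -> Rec A g -> Rec A (fun x => f x + g x).
Proof.
move=> hf hg; apply: (@Rec_ext _ (fun x => iter (f x) (fun r => r.+1) (g x))).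
  by move=> x; elim: (f x) => //= k ->.
by apply: (@Rec_iter _ f g (fun _ r => r.+1)) => //; exact/Rec_S/Rec_snd/Rec_id.
Qed.

Lemma Rec_sub A f g : Rec A f -> Rec A g -> Rec A (fun x => f x - g x).
Proof.
move=> hf hg; apply: (@Rec_ext _ (fun x => iter (g x) (fun r => r.-1) (f x))).
  by move=> x; elim: (g x) => [|k /= ->]; rewrite ?subn0 ?subnS.
by apply: (@Rec_iter _ g f (fun _ r => r.-1)) => //; exact/Rec_pred/Rec_snd/Rec_id.
Qed.

Lemma Rec_mul A f g : Rec A f -> Rec A g -> Rec A (fun x => f x * g x).
Proof.
move=> hf hg; apply: (@Rec_ext _ (fun x => iter (f x) (fun r => g x + r) 0)).
  by move=> x; elim: (f x) => //= k ->; rewrite mulSn.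
apply: (@Rec_iter _ f _ (fun x r => g x + r)) => //; first exact: Rec_const.
apply: Rec_add; last exact/Rec_snd/Rec_id.
by apply: (@Rec_comp1 _ g) => //; exact/Rec_fst/Rec_id.
Qed.

Lemma Rec_if A b f g :
  Rec A (fun x => nat_of_bool (b x)) -> Rec A f -> Rec A g ->
  Rec A (fun x => if b x then f x else g x).
Proof.
move=> hb hf hg.
apply: (@Rec_ext _ (fun x => b x * f x + (1 - b x) * g x)).
  by move=> x; case: (b x); rewrite /= ?mul0n ?mul1n ?addn0.
by apply: Rec_add; apply: Rec_mul => //; apply: Rec_sub => //; exact: Rec_const.
Qed.

Notation Dec A P := (Rec A (fun x => nat_of_bool (P x))).

Lemma Dec_ext A (P Q : nat -> bool) : P =1 Q -> Dec A P -> Dec A Q.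
Proof. by move=> /funext ->. Qed.

Lemma Dec_if A b c d :
  Dec A b -> Dec A c -> Dec A d -> Dec A (fun x => if b x then c x else d x).
Proof.
move=> hb hc hd.
apply: (@Rec_ext _ (fun x => if b x then nat_of_bool (c x) else d x)).
  by move=> x; case: (b x).
exact: Rec_if.
Qed.

Lemma Dec_neg A b : Dec A b -> Dec A (fun x => ~~ b x).
Proof.
move=> hb; apply: (@Rec_ext _ (fun x => 1 - b x)); first by move=> x; case: (b x).
by apply: Rec_sub => //; exact: Rec_const.
Qed.

Lemma Dec_and A b c : Dec A b -> Dec A c -> Dec A (fun x => b x && c x).
Proof.
move=> hb hc; apply: (@Rec_ext _ (fun x => b x * c x)).
  by move=> x; case: (b x); case: (c x).
exact: Rec_mul.
Qed.

Lemma Dec_or A b c : Dec A b -> Dec A c -> Dec A (fun x => b x || c x).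
Proof.
move=> hb hc; apply: (@Dec_ext _ (fun x => ~~ (~~ b x && ~~ c x))).
  by move=> x; rewrite negb_and !negbK.
exact/Dec_neg/Dec_and/Dec_neg/hc/Dec_neg.
Qed.

Lemma Dec_imply A b c : Dec A b -> Dec A c -> Dec A (fun x => b x ==> c x).
Proof.
move=> hb hc; apply: (@Dec_ext _ (fun x => ~~ b x || c x)).
  by move=> x; rewrite implybE.
exact/Dec_or/hc/Dec_neg.
Qed.

Lemma Dec_eq0 A f : Rec A f -> Dec A (fun x => f x == 0).
Proof.
move=> hf; apply: (@Rec_ext _ (fun x => 1 - f x)); first by move=> x; case: (f x).
by apply: Rec_sub => //; exact: Rec_const.
Qed.

Lemma Dec_leq A f g : Rec A f -> Rec A g -> Dec A (fun x => f x <= g x).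
Proof. by move=> hf hg; apply: Dec_eq0; apply: Rec_sub. Qed.

Lemma Dec_eqn A f g : Rec A f -> Rec A g -> Dec A (fun x => f x == g x).
Proof.
move=> hf hg; apply: (@Dec_ext _ (fun x => (f x <= g x) && (g x <= f x))).
  by move=> x; rewrite eqn_leq.
by apply: Dec_and; apply: Dec_leq.
Qed.

Lemma Dec_odd A f : Rec A f -> Dec A (fun x => odd (f x)).
Proof.
move=> hf.
apply: (@Rec_ext _ (fun x => iter (f x) (fun r => 1 - r) 0)).
  by move=> x; elim: (f x) => //= k ->; case: (odd k).
apply: (@Rec_iter _ f _ (fun _ r => 1 - r)) => //; first exact: Rec_const.
by apply: Rec_sub; [exact: Rec_const|exact/Rec_snd/Rec_id].
Qed.

Lemma Rec_half A f : Rec A f -> Rec A (fun x => (f x)./2).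
Proof.
move=> hf.
apply: (@Rec_ext _ (fun x => iteri (f x) (fun i r => odd i + r) 0)).
  by move=> x; elim: (f x) => //= k ->; rewrite uphalf_half.
apply: (@Rec_iteri _ f _ (fun _ i r => odd i + r)) => //; first exact: Rec_const.
apply: Rec_add; last exact/Rec_snd/Rec_snd/Rec_id.
exact/Dec_odd/Rec_fst/Rec_snd/Rec_id.
Qed.

Lemma Rec_double A f : Rec A f -> Rec A (fun x => (f x).*2).
Proof.
by move=> hf; apply: (@Rec_ext _ (fun x => f x + f x)) => [x|];
  [rewrite addnn | exact: Rec_add].
Qed.

Lemma Rec_exp A f g : Rec A f -> Rec A g -> Rec A (fun x => f x ^ g x).
Proof.
move=> hf hg; apply: (@Rec_ext _ (fun x => iter (g x) (fun r => f x * r) 1)).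
  by move=> x; elim: (g x) => //= k ->; rewrite expnS.
apply: (@Rec_iter _ g _ (fun x r => f x * r)) => //; first exact: Rec_const.
apply: Rec_mul; last exact/Rec_snd/Rec_id.
by apply: (@Rec_comp1 _ f) => //; exact/Rec_fst/Rec_id.
Qed.

Definition ball (n : nat) (P : nat -> bool) : bool := all P (iota 0 n).
Definition bex (n : nat) (P : nat -> bool) : bool := has P (iota 0 n).

Lemma ballP n (P : nat -> bool) : reflect (forall i, i < n -> P i) (ball n P).
Proof.
by apply: (iffP allP) => h i; [move=> lt; apply: h | move: (h i)];
  rewrite mem_iota ?add0n //= => + hi; apply.
Qed.

Lemma bexP n (P : nat -> bool) : reflect (exists2 i, i < n & P i) (bex n P).
Proof.
by apply: (iffP hasP) => -[i lt hi]; exists i => //; move: lt; rewrite mem_iota.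
Qed.

Lemma Dec_ball A n P :
  Rec A n -> Dec A (fun z => P (cfst z) (csnd z)) ->
  Dec A (fun x => ball (n x) (fun i => P x i)).
Proof.
move=> hn hP.
apply: (@Rec_ext _ (fun x => iteri (n x) (fun i r => P x i * r) 1)).
  move=> x; rewrite /ball; elim: (n x) => // k IH.
  rewrite -[in RHS]addn1 iotaD all_cat [LHS]/= IH /= andbT.
  by case: all; case: (P x _).
apply: (@Rec_iteri _ n _ (fun x i r => P x i * r)) => //; first exact: Rec_const.
apply: Rec_mul; last exact/Rec_snd/Rec_snd/Rec_id.
by apply: (@Rec_comp2 _ (fun x i => P x i)) => //; [exact/Rec_fst/Rec_id|exact/Rec_fst/Rec_snd/Rec_id].
Qed.

Lemma Dec_bex A n P :
  Rec A n -> Dec A (fun z => P (cfst z) (csnd z)) ->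
  Dec A (fun x => bex (n x) (fun i => P x i)).
Proof.
move=> hn hP; apply: (@Dec_ext _ (fun x => ~~ ball (n x) (fun i => ~~ P x i))).
  by move=> x; rewrite /bex /ball -has_predC; apply: eq_has => i /=; rewrite negbK.
by apply/Dec_neg/Dec_ball => //; apply: Dec_neg.
Qed.

(** [rec_tac] decomposes a goal [Rec A (fun x => body)] along the syntax of
    [body].  The matching is syntactic because [apply] alone would unfold
    constants: [nat_of_bool] into a conditional, bounded quantifiers into
    conjunctions.  Hypotheses on function variables of up to three arguments
    are used under the packing convention of [Rec_comp2] and [Rec_comp3];
    [rec_ext] is the hook for the operations introduced later. *)
Ltac rec_ext := fail.
Ltac rec_step :=
  first [ exact: Rec_id | apply: Rec_const | assumption
        | match goal with
          | |- Rec _ cfst => exact: (Rec_fst (Rec_id _))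
          | |- Rec _ csnd => exact: (Rec_snd (Rec_id _))
          | |- Rec _ S => exact: (Rec_S (Rec_id _))
          | |- Rec _ half => exact: (Rec_half (Rec_id _))
          | |- Rec _ double => exact: (Rec_double (Rec_id _))
          end
        | match goal with
          | |- Rec _ (fun x => cfst _) => apply: Rec_fst
          | |- Rec _ (fun x => csnd _) => apply: Rec_snd
          | |- Rec _ (fun x => cpair _ _) => apply: Rec_pair
          | |- Rec _ (fun x => S _) => apply: Rec_S
          | |- Rec _ (fun x => predn _) => apply: Rec_pred
          | |- Rec _ (fun x => addn _ _) => apply: Rec_add
          | |- Rec _ (fun x => subn _ _) => apply: Rec_sub
          | |- Rec _ (fun x => muln _ _) => apply: Rec_mul
          | |- Rec _ (fun x => expn _ _) => apply: Rec_exp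
          | |- Rec _ (fun x => half _) => apply: Rec_half
          | |- Rec _ (fun x => double _) => apply: Rec_double
          | |- Rec _ (fun x => nat_of_bool (~~ _)) => apply: Dec_neg
          | |- Rec _ (fun x => nat_of_bool (_ && _)) => apply: Dec_and
          | |- Rec _ (fun x => nat_of_bool (_ || _)) => apply: Dec_or
          | |- Rec _ (fun x => nat_of_bool (_ ==> _)) => apply: Dec_imply
          | |- Rec _ (fun x => nat_of_bool (_ == _)) => apply: Dec_eqn
          | |- Rec _ (fun x => nat_of_bool (_ <= _)) => apply: Dec_leq
          | |- Rec _ (fun x => nat_of_bool (odd _)) => apply: Dec_odd
          | |- Rec _ (fun x => nat_of_bool (ball _ _)) => apply: Dec_ball
          | |- Rec _ (fun x => nat_of_bool (bex _ _)) => apply: Dec_bex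
          | |- Rec _ (fun x => if _ then _ else _) => apply: Rec_if
          | |- Rec _ (fun x => nat_of_bool (if _ then _ else _)) => apply: Dec_if
          | |- Rec _ (fun x => iter _ _ _) => apply: Rec_iter
          | |- Rec _ (fun x => iteri _ _ _) => apply: Rec_iteri
          | h : Rec ?A ?F |- Rec ?A (fun x => ?F _) => is_var F; apply: (Rec_comp1 h)
          | h : Rec ?A (fun z => nat_of_bool (?F z))
            |- Rec ?A (fun x => nat_of_bool (?F _)) =>
              is_var F; apply: (Rec_comp1 h)
          | h : Rec ?A (fun z => ?F (cfst z) (csnd z))
            |- Rec ?A (fun x => ?F _ _) => is_var F; apply: (Rec_comp2 h)
          | h : Rec ?A (fun z => nat_of_bool (?F (cfst z) (csnd z)))
            |- Rec ?A (fun x => nat_of_bool (?F _ _)) =>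
              is_var F; apply: (Rec_comp2 (F := fun a b => nat_of_bool (F a b)) h)
          | h : Rec ?A (fun z => ?F (cfst z) (cfst (csnd z)) (csnd (csnd z)))
            |- Rec ?A (fun x => ?F _ _ _) => is_var F; apply: (Rec_comp3 h)
          end
        | rec_ext ].
Ltac rec_tac :=
  repeat match goal with h : Rec _ _ |- _ => progress cbv beta in h end;
  repeat (cbv beta zeta; rec_step).

(** * Lists *)

Lemma Rec_hd A f : Rec A f -> Rec A (fun x => chd (f x)).
Proof. by move=> hf; rewrite /chd; rec_tac. Qed.

Lemma Rec_tl A f : Rec A f -> Rec A (fun x => ctl (f x)).
Proof. by move=> hf; rewrite /ctl; rec_tac. Qed.

Ltac rec_ext ::=
  match goal with
  | |- Rec _ (fun x => chd _) => apply: Rec_hd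
  | |- Rec _ (fun x => ctl _) => apply: Rec_tl
  end.

Lemma unseq_iter_tl k c : unseq (iter k ctl c) = drop k (unseq c).
Proof.
elim: k c => [|k IH] c; first by rewrite drop0.
rewrite iterSr IH; case: (posnP c) => [->|c0]; last by rewrite (unseqS c0).
by rewrite /ctl csnd0.
Qed.

Lemma chdE c : chd c = nth 0 (unseq c) 0.
Proof.
by case: (posnP c) => [->|c0]; [rewrite /chd cfst0 | rewrite unseqS].
Qed.

Lemma Rec_nth A f g :
  Rec A f -> Rec A g -> Rec A (fun x => nth 0 (unseq (f x)) (g x)).
Proof.
move=> hf hg.
apply: (@Rec_ext _ (fun x => chd (iter (g x) (fun r => ctl r) (f x)))).
  by move=> x; rewrite chdE unseq_iter_tl nth_drop addn0.
apply/Rec_hd/Rec_iter => //; exact/Rec_tl/Rec_snd/Rec_id.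
Qed.

(** Iterates on the pair of the accumulator and the rest of the list; the code
    of a list bounds its length, so that it may serve as number of steps. *)
Lemma Rec_foldl A f g h :
  Rec A f -> Rec A g ->
  Rec A (fun z => h (cfst z) (cfst (csnd z)) (csnd (csnd z))) ->
  Rec A (fun x => foldl (fun r y => h x r y) (g x) (unseq (f x))).
Proof.
move=> hf hg hh.
pose st x r := if csnd r == 0 then r
  else cpair (h x (cfst r) (chd (csnd r))) (ctl (csnd r)).
apply: (@Rec_ext _ (fun x => cfst (iter (f x) (fun r => st x r) (cpair (g x) (f x))))).
  move=> x; suff H k c r : c <= k ->
      cfst (iter k (st x) (cpair r c)) = foldl (h x) r (unseq c) by exact: H.
  elim: k c r => [|k IH] c r; first by rewrite leqn0 => /eqP->; rewrite cfstK.
  move=> lt; rewrite iterSr {2}/st !cpairE.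
  case: eqP => [->|/eqP]; first by rewrite IH.
  rewrite -lt0n => c0; rewrite IH; last by have := ctl_lt c0; lia.
  by rewrite (unseqS c0).
apply: Rec_fst; apply: Rec_iter => //; first by rec_tac.
by rewrite /st; rec_tac.
Qed.

Lemma Rec_size A f : Rec A f -> Rec A (fun x => size (unseq (f x))).
Proof.
move=> hf; apply: (@Rec_ext _ (fun x => foldl (fun r y => r.+1) 0 (unseq (f x)))).
  move=> x; rewrite -[RHS]addn0; elim: (unseq _) 0 => //= y s IH r.
  by rewrite IH; lia.
by apply: (@Rec_foldl _ f _ (fun _ r _ => r.+1)); rec_tac.
Qed.

Lemma Dec_all A f P :
  Rec A f -> Dec A (fun z => P (cfst z) (csnd z)) ->
  Dec A (fun x => all (fun i => P x i) (unseq (f x))).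
Proof.
move=> hf hP.
apply: (@Rec_ext _ (fun x => foldl (fun r y => r * P x y) 1 (unseq (f x)))).
  move=> x; rewrite -[RHS]mul1n; elim: (unseq _) 1 => //= [|y s IH] r.
    by rewrite muln1.
  by rewrite IH -mulnA; congr muln; case: (P x y); rewrite ?mul1n ?mul0n.
by apply: (@Rec_foldl _ f _ (fun x r y => r * P x y)); rec_tac.
Qed.

Lemma Dec_has A f P :
  Rec A f -> Dec A (fun z => P (cfst z) (csnd z)) ->
  Dec A (fun x => has (fun i => P x i) (unseq (f x))).
Proof.
move=> hf hP.
apply: (@Dec_ext _ (fun x => ~~ all (fun i => ~~ P x i) (unseq (f x)))).
  by move=> x; rewrite -has_predC; apply: eq_has => i /=; rewrite negbK.
by apply/Dec_neg/Dec_all => //; rec_tac.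
Qed.

Lemma Dec_mem A f g : Rec A f -> Rec A g -> Dec A (fun x => g x \in unseq (f x)).
Proof.
move=> hf hg; apply: (@Dec_ext _ (fun x => has (fun y => g x == y) (unseq (f x)))).
  by move=> x; rewrite -has_pred1; apply: eq_has => y; rewrite /= eq_sym.
by apply: Dec_has => //; rec_tac.
Qed.

Lemma Rec_foldr A f g h :
  Rec A f -> Rec A g ->
  Rec A (fun z => h (cfst z) (cfst (csnd z)) (csnd (csnd z))) ->
  Rec A (fun x => foldr (fun y r => h x y r) (g x) (unseq (f x))).
Proof.
move=> hf hg hh.
pose rv c := seq_num (rev (unseq c)).
have hrv : Rec A rv.
  apply: (@Rec_ext _ (fun c => foldl (fun r y => (cpair y r).+1) 0 (unseq c))).
    move=> c; rewrite /rv /rev -[0]/(seq_num [::]); elim: (unseq _) [::] => //= y s IH t.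
    by rewrite -IH.
  by apply: (@Rec_foldl _ id _ (fun _ r y => (cpair y r).+1)); rec_tac.
apply: (@Rec_ext _ (fun x => foldl (fun r y => h x y r) (g x) (unseq (rv (f x))))).
  by move=> x; rewrite seq_numK foldl_rev.
apply: (@Rec_foldl _ _ _ (fun x r y => h x y r)) => //; first by rec_tac.
by apply: (Rec_comp3 hh); rec_tac.
Qed.

Lemma Rec_cat A f g :
  Rec A f -> Rec A g -> Rec A (fun x => seq_num (unseq (f x) ++ unseq (g x))).
Proof.
move=> hf hg.
apply: (@Rec_ext _ (fun x => foldr (fun y r => (cpair y r).+1) (g x) (unseq (f x)))).
  by move=> x; elim: (unseq _) => //= [|y s ->] //; rewrite unseqK.
by apply: (@Rec_foldr _ f g (fun _ y r => (cpair y r).+1)); rec_tac.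
Qed.

Lemma Rec_map A f h :
  Rec A f -> Rec A (fun z => h (cfst z) (csnd z)) ->
  Rec A (fun x => seq_num [seq h x y | y <- unseq (f x)]).
Proof.
move=> hf hh.
apply: (@Rec_ext _ (fun x => foldr (fun y r => (cpair (h x y) r).+1) 0 (unseq (f x)))).
  by move=> x; elim: (unseq _) => //= y s ->.
by apply: (@Rec_foldr _ f _ (fun x y r => (cpair (h x y) r).+1)); rec_tac.
Qed.

Lemma Dec_uniq A f : Rec A f -> Dec A (fun x => uniq (unseq (f x))).
Proof.
move=> hf.
apply: (@Dec_ext _ (fun x => ball (size (unseq (f x))) (fun i =>
   nth 0 (unseq (f x)) i \notin unseq (iter i.+1 (fun r => ctl r) (f x))))).
  move=> x; rewrite -[fun r => ctl r]/ctl.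
  under [X in ball _ X]funext => i do rewrite unseq_iter_tl.
  elim: (unseq _) => //= y s IH.
  rewrite /ball /= drop0; congr andb.
  by rewrite (iotaDl 1 0) all_map -IH.
apply: Dec_ball; first exact: Rec_size.
apply: Dec_neg; apply: Dec_mem; last by apply: Rec_nth; rec_tac.
by apply: Rec_iter; rec_tac; apply: Rec_tl; rec_tac.
Qed.

(** Tables list values in decreasing order of the argument, since extending a
    table is consing: [t] holds the values at [n - 1, ..., 0]. *)
Definition lk (t n m : nat) : nat := nth 0 (unseq t) (n.-1 - m).

Lemma Rec_lk A t n m :
  Rec A t -> Rec A n -> Rec A m -> Rec A (fun x => lk (t x) (n x) (m x)).
Proof. by move=> *; rewrite /lk; apply: Rec_nth; rec_tac. Qed.

Ltac rec_ext ::=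
  match goal with
  | |- Rec _ (fun x => chd _) => apply: Rec_hd
  | |- Rec _ (fun x => ctl _) => apply: Rec_tl
  | |- Rec _ (fun x => nth _ _ _) => apply: Rec_nth
  | |- Rec _ (fun x => lk _ _ _) => apply: Rec_lk
  | |- Rec _ (fun x => size _) => apply: Rec_size
  | |- Rec _ (fun x => nat_of_bool (_ \in _)) => apply: Dec_mem
  | |- Rec _ (fun x => nat_of_bool (all _ _)) => apply: Dec_all
  | |- Rec _ (fun x => nat_of_bool (has _ _)) => apply: Dec_has
  | |- Rec _ (fun x => nat_of_bool (uniq _)) => apply: Dec_uniq
  | |- Rec _ (fun x => seq_num (_ ++ _)) => apply: Rec_cat
  | |- Rec _ (fun x => seq_num (map _ _)) => apply: Rec_map
  | |- Rec _ (fun x => foldl _ _ _) => apply: Rec_foldl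
  | |- Rec _ (fun x => foldr _ _ _) => apply: Rec_foldr
  end.

(** * Course-of-values recursion *)

Definition cov_tbl (G : nat -> nat -> (nat -> nat) -> nat) (a n : nat) : nat :=
  iteri n (fun i t => (cpair (G a i (lk t i)) t).+1) 0.

(** The functional [G] receives the argument and the function to call on smaller
    arguments. *)
Definition cov (G : nat -> nat -> (nat -> nat) -> nat) (a n : nat) : nat :=
  G a n (lk (cov_tbl G a n) n).

Lemma lk_cov_tbl G a n m : m < n -> lk (cov_tbl G a n) n m = cov G a m.
Proof.
elim: n => // n IH lt; rewrite /lk [cov_tbl _ _ _]/= unseqS // /chd /ctl /= !cpairE.
move: lt; rewrite ltnS leq_eqVlt => /orP[/eqP->|lt]; first by rewrite subnn.
by rewrite -IH // /lk; have -> : n - m = (n.-1 - m).+1 by lia.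
Qed.

Lemma Rec_cov A G f g :
  Rec A (fun z => G (cfst z) (cfst (csnd z))
                    (fun m => lk (csnd (csnd z)) (cfst (csnd z)) m)) ->
  Rec A f -> Rec A g -> Rec A (fun x => cov G (f x) (g x)).
Proof.
move=> hG hf hg.
rewrite /cov; apply: (Rec_comp3 (F := fun a i t => G a i (lk t i)) hG) => //.
rewrite /cov_tbl; apply: Rec_iteri; rec_tac.
by apply: (Rec_comp3 (F := fun a i t => G a i (lk t i)) hG); rec_tac.
Qed.

(** * Programs and their numbers *)

Lemma prog_num_inj : injective prog_num.
Proof.
elim=> [||||| p IHp q IHq| p IHp q IHq| p IHp q IHq| p IHp]
  [||||| p' q'| p' q'| p' q'| p'] //= /cpair_inj[] // _.
- by move=> /cpair_inj[/IHp-> /IHq->].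
- by move=> /cpair_inj[/IHp-> /IHq->].
- by move=> /cpair_inj[/IHp-> /IHq->].
- by move=> /IHp->.
Qed.

Lemma phiE A p x y : phi A (prog_num p) x y <-> eval A p x y.
Proof.
by split=> [[q /prog_num_inj<-] // | h]; exists p.
Qed.

Lemma phi_det A e x y y' : phi A e x y -> phi A e x y' -> y = y'.
Proof.
by move=> [p <- h] [q /prog_num_inj -> h']; apply: eval_det h h'.
Qed.

Lemma turing_leP A B : turing_le A B <-> Dec B (fun x => `[< A x >]).
Proof.
split=> [[e he]|[p hp]].
  have [p pe] : exists p, prog_num p = e.
    by case: (pselect (A 0)) => [/(proj1 (he 0))|/(proj2 (he 0))] [p]; exists p.
  exists p => x; apply/phiE; rewrite pe.
  by case: asboolP => [/(proj1 (he x))|/(proj2 (he x))].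
exists (prog_num p) => x; have := hp x.
by case: asboolP => h hpx; split=> // _; apply/phiE.
Qed.

Lemma computable_setP A : computable_set A <-> Dec set0 (fun x => `[< A x >]).
Proof. exact: turing_leP. Qed.

Lemma computable_funP f : computable_fun f <-> Rec set0 f.
Proof.
split=> [[e he]|[p hp]]; last by exists (prog_num p) => x; apply/phiE.
have [p pe _] := he 0; exists p => x; apply/phiE; rewrite pe; exact: he.
Qed.

Fixpoint oracle_subst (q p : prog) : prog :=
  match p with
  | POracle => q
  | PPair p1 p2 => PPair (oracle_subst q p1) (oracle_subst q p2)
  | PComp p1 p2 => PComp (oracle_subst q p1) (oracle_subst q p2)
  | PRec p1 p2 => PRec (oracle_subst q p1) (oracle_subst q p2)
  | PMu p1 => PMu (oracle_subst q p1)
  | _ => p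
  end.

(** Replacing the oracle by a program that decides it: the source of
    transitivity of Turing reducibility. *)
Lemma eval_oracle_subst A B q p x y :
  (forall z, eval B q z `[< A z >]) -> eval A p x y -> eval B (oracle_subst q p) x y.
Proof.
move=> hq; elim: p x y => [||||| p1 IH1 p2 IH2| p1 IH1 p2 IH2| p1 IH1 p2 IH2| p1 IH1] x y //.
- by move: (hq x) => /=; case: asboolP => h + [[h' ->]|[h' ->]].
- move=> /= [u [v [hu hv ->]]]; exists u, v; split=> //; [exact: IH1|exact: IH2].
- by move=> /= [u hu hv]; exists u; [exact: IH2|exact: IH1].
- rewrite [oracle_subst _ _]/= !eval_PRec; elim: (csnd x) y => [|k IH] y /=; first exact: IH1.
  by move=> [r hr h]; exists r; [exact: IH|exact: IH2].
- move=> /= [h lt]; split; first exact: IH1.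
  by move=> z /lt[v hv]; exists v; apply: IH1.
Qed.

Lemma Rec_trans A B f : turing_le A B -> Rec A f -> Rec B f.
Proof.
move=> /turing_leP[q hq] [p hp]; exists (oracle_subst q p) => x.
exact: eval_oracle_subst (hp x).
Qed.

Lemma turing_le_set0 A : turing_le set0 A.
Proof.
apply/turing_leP; apply: (@Rec_ext _ (fun=> 0)); last exact: Rec_const.
by move=> x; case: asboolP.
Qed.

Lemma Rec_set0 A f : Rec set0 f -> Rec A f.
Proof. exact/Rec_trans/turing_le_set0. Qed.

Lemma Rec_oracle A f : Rec A f -> Dec A (fun x => `[< A (f x) >]).
Proof.
move=> hf; apply: (Rec_comp1 (g := fun x => `[< A x >])) => //.
by exists POracle => x /=; case: asboolP; [left|right].
Qed.

(** Numbers that are no program must be recognised, since [phi] makes them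
    indices of the nowhere defined function even if their junk part would
    never be reached by the machine below. *)
Definition is_prog_step (_ n : nat) (f : nat -> nat) : nat :=
  let t := cfst n in let r := csnd n in
  if t <= 4 then r == 0
  else if t <= 7 then (f (cfst r) != 0) && (f (csnd r) != 0)
  else (t == 8) && (f r != 0).

Definition is_prog (n : nat) : bool := cov is_prog_step 0 n != 0.

Lemma is_progE n :
  is_prog n = let t := cfst n in let r := csnd n in
    if t <= 4 then r == 0
    else if t <= 7 then is_prog (cfst r) && is_prog (csnd r)
    else (t == 8) && is_prog r.
Proof.
rewrite {1}/is_prog /cov; set g := lk _ _; rewrite /is_prog_step /=.
case: leqP => h4; first by case: (csnd n == 0).
have lt := csnd_lt (leq_trans (ltn0Sn _) h4).
have lt1 := leq_ltn_trans (cfst_le (csnd n)) lt.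
have lt2 := leq_ltn_trans (csnd_le (csnd n)) lt.
rewrite /g !lk_cov_tbl // -!/(is_prog _).
by case: (cfst n <= 7); case: (_ && _).
Qed.

Lemma is_progP n : reflect (exists p, prog_num p = n) (is_prog n).
Proof.
apply: (iffP idP) => [|[p <-]]; last first.
  elim: p => [||||| p IHp q IHq| p IHp q IHq| p IHp q IHq| p IHp];
    by rewrite is_progE /= !cpairE ?IHp ?IHq.
elim/ltn_ind: n => n IH; rewrite is_progE /=.
have lt : 4 < cfst n -> csnd n < n by move=> h; apply: csnd_lt; lia.
rewrite -(cpairK n) cfstK csndK; move: lt IH; move: (cfst n) (csnd n) => t r.
case: leqP => h4 lt IH.
  by move=> /eqP->; case: t h4 {lt IH} => [|[|[|[|[|]]]]] // _;
   [exists PZero | exists PSucc | exists PFst | exists PSnd | exists POracle].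
have {lt} := lt isT => lt.
have IH1 := IH _ (leq_ltn_trans (cfst_le r) lt).
have IH2 := IH _ (leq_ltn_trans (csnd_le r) lt).
case: leqP => h7.
  move=> /andP[/IH1[p hp] /IH2[q hq]]; rewrite -(cpairK r) -hp -hq.
  by case: t h4 h7 {lt IH IH1 IH2} => [|[|[|[|[|[|[|[|]]]]]]]] // _ _;
   [exists (PPair p q) | exists (PComp p q) | exists (PRec p q)].
by move=> /andP[/eqP-> /IH[] // p <-]; exists (PMu p).
Qed.

Lemma Dec_is_prog A f : Rec A f -> Dec A (fun x => is_prog (f x)).
Proof.
move=> hf; rewrite /is_prog; rec_tac; apply: Rec_cov; rec_tac.
by rewrite /is_prog_step; rec_tac.
Qed.

(** * A universal machine *)

(** A configuration either evaluates the program with number [p] at [x], or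
    returns the value [v]; in both cases [K] is the stack of the pending
    computations.  The step function is given the answer [b] of the oracle
    on the question [query c], so that it is itself computable. *)
Definition Ev (p x K : nat) : nat := cpair 0 (cpair p (cpair x K)).
Definition Rt (v K : nat) : nat := cpair 1 (cpair v K).
Definition push (F K : nat) : nat := (cpair F K).+1.
Definition query (c : nat) : nat := cfst (csnd (csnd c)).

Definition step_ev (b p x K : nat) : nat :=
  let t := cfst p in let q := csnd p in
  if t == 0 then Rt 0 K
  else if t == 1 then Rt x.+1 K
  else if t == 2 then Rt (cfst x) K
  else if t == 3 then Rt (csnd x) K
  else if t == 4 then Rt b K
  else if t == 5 then Ev (cfst q) x (push (cpair 0 (cpair (csnd q) x)) K)
  else if t == 6 then Ev (csnd q) x (push (cpair 2 (cfst q)) K)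
  else if t == 7 then Ev (cfst q) (cfst x)
    (push (cpair 3 (cpair (csnd q) (cpair (cfst x) (cpair 0 (csnd x))))) K)
  else Ev q (cpair x 0) (push (cpair 4 (cpair q (cpair x 0))) K).

(** Frames: 0 and 1 wait for the first and the second component of a pair, 2
    for the inner value of a composition, 3 for the value of a recursion at [j]
    with [r] steps to go, 4 for the test of the minimisation at [y]. *)
Definition step_rt (v F K : nat) : nat :=
  let t := cfst F in let d := csnd F in
  if t == 0 then Ev (cfst d) (csnd d) (push (cpair 1 v) K)
  else if t == 1 then Rt (cpair d v) K
  else if t == 2 then Ev d v K
  else if t == 3 then
    let q := cfst d in let a := cfst (csnd d) in
    let j := cfst (csnd (csnd d)) in let r := csnd (csnd (csnd d)) in
    if r == 0 then Rt v K
    else Ev q (cpair a (cpair j v))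
           (push (cpair 3 (cpair q (cpair a (cpair j.+1 r.-1)))) K)
  else
    let p := cfst d in let x := cfst (csnd d) in let y := csnd (csnd d) in
    if v == 0 then Rt y K
    else Ev p (cpair x y.+1) (push (cpair 4 (cpair p (cpair x y.+1))) K).

Definition step (b : nat) (c : nat) : nat :=
  if cfst c == 0 then
    step_ev b (cfst (csnd c)) (cfst (csnd (csnd c))) (csnd (csnd (csnd c)))
  else let K := csnd (csnd c) in
    if K == 0 then c else step_rt (cfst (csnd c)) (chd K) (ctl K).

Lemma Rec_step A b c : Rec A b -> Rec A c -> Rec A (fun x => step (b x) (c x)).
Proof.
move=> hb hc; rewrite /step /step_ev /step_rt /Rt /Ev /push; rec_tac.
Qed.

Lemma step_Ev b p x K : step b (Ev p x K) = step_ev b p x K.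
Proof. by rewrite /step /Ev !cpairE. Qed.

Lemma step_Rt b v F K : step b (Rt v (push F K)) = step_rt v F K.
Proof. by rewrite /step /Rt /push /chd /ctl /= !cpairE. Qed.

Lemma step_final b v : step b (Rt v 0) = Rt v 0.
Proof. by rewrite /step /Rt !cpairE. Qed.

Lemma iter_final (f : nat -> nat) v t : f (Rt v 0) = Rt v 0 -> iter t f (Rt v 0) = Rt v 0.
Proof. by move=> h; elim: t => //= t ->. Qed.

Lemma Ev_neq_Rt p x K v K' : Ev p x K <> Rt v K'.
Proof. by move=> /cpair_inj[]. Qed.

Definition ostep (A : set nat) (c : nat) : nat := step `[< A (query c) >] c.

Lemma ostep_Ev A p x K : ostep A (Ev p x K) = step_ev `[< A x >] p x K.
Proof. by rewrite /ostep step_Ev /query /Ev !cpairE. Qed.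

Lemma ostep_Rt A v F K : ostep A (Rt v (push F K)) = step_rt v F K.
Proof. by rewrite /ostep step_Rt. Qed.

(** Quantifying over the stack makes the induction on the program go through. *)
Lemma run_complete A p x y K :
  eval A p x y -> exists t, iter t (ostep A) (Ev (prog_num p) x K) = Rt y K.
Proof.
have E F v c : ostep A c = F -> (exists t, iter t (ostep A) F = v) ->
    exists t, iter t (ostep A) c = v.
  by move=> <- [t ht]; exists t.+1; rewrite iterSr.
have T c c' v : (exists t, iter t (ostep A) c = c') ->
    (exists t, iter t (ostep A) c' = v) -> exists t, iter t (ostep A) c = v.
  by move=> [t <-] [t' <-]; exists (t' + t); rewrite iterD.
have Z c : exists t, iter t (ostep A) c = c by exists 0.
elim: p x y K => [||||| p IHp q IHq| p IHp q IHq| p IHp q IHq| p IHp] x y K.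
- by move=> ->; apply: (E) (Z _); rewrite ostep_Ev /step_ev /= !cpairE.
- by move=> ->; apply: (E) (Z _); rewrite ostep_Ev /step_ev /= !cpairE.
- by move=> ->; apply: (E) (Z _); rewrite ostep_Ev /step_ev /= !cpairE.
- by move=> ->; apply: (E) (Z _); rewrite ostep_Ev /step_ev /= !cpairE.
- move=> h; apply: (E) (Z _); rewrite ostep_Ev /step_ev /= !cpairE /=.
  by case: h => -[h ->]; case: asboolP.
- move=> /= [u [v [hu hv ->]]].
  apply: (E); first by rewrite ostep_Ev /step_ev /= !cpairE.
  apply: (T); first exact: IHp hu.
  apply: (E); first by rewrite ostep_Rt /step_rt /= !cpairE.
  apply: (T); first exact: IHq hv.
  by apply: (E) (Z _); rewrite ostep_Rt /step_rt /= !cpairE.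
- move=> /= [u hu hv].
  apply: (E); first by rewrite ostep_Ev /step_ev /= !cpairE.
  apply: (T); first exact: IHq hu.
  apply: (E); first by rewrite ostep_Rt /step_rt /= !cpairE.
  exact: IHp hv.
- rewrite eval_PRec [prog_num _]/= => h.
  apply: (E); first by rewrite ostep_Ev /step_ev /= !cpairE /=.
  suff H k r z : rec_graph (eval A p) (eval A q) (cfst x) k z ->
     exists t, iter t (ostep A) (Ev (prog_num p) (cfst x) (push (cpair 3
        (cpair (prog_num q) (cpair (cfst x) (cpair 0 (k + r))))) K)) =
       Rt z (push (cpair 3
        (cpair (prog_num q) (cpair (cfst x) (cpair k r)))) K).
    have := H _ 0 _ h; rewrite addn0 => {}H; apply: (T) H _.
    by apply: (E) (Z _); rewrite ostep_Rt /step_rt /= !cpairE /=.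
  elim: k r z {h} => [|k IH] r z /=; first exact: IHp.
  move=> [w /(IH r.+1) h1 h2]; rewrite addSnnS; apply: (T) h1 _.
  apply: (E); first by rewrite ostep_Rt /step_rt /= !cpairE /=.
  exact: IHq.
- move=> /= [h lt].
  apply: (E); first by rewrite ostep_Ev /step_ev /= !cpairE /=.
  suff H k : k <= y ->
     exists t, iter t (ostep A) (Ev (prog_num p) (cpair x 0) (push (cpair 4
        (cpair (prog_num p) (cpair x 0))) K)) =
       Ev (prog_num p) (cpair x k) (push (cpair 4 (cpair (prog_num p) (cpair x k))) K).
    apply: (T) (H _ (leqnn _)) _; apply: (T); first exact: IHp h.
    by apply: (E) (Z _); rewrite ostep_Rt /step_rt /= !cpairE /=.
  elim: k => // k IH ky; apply: (T) (IH (ltnW ky)) _.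
  have [v hv] := lt _ ky; apply: (T); first exact: IHp hv.
  by apply: (E) (Z _); rewrite ostep_Rt /step_rt /= !cpairE /=.
Qed.

(** Conversely, a run that ends with an empty stack must have returned a value
    of the current program on the way.  The strict decrease of the length of
    the run feeds the induction for the unbounded search of [PMu]. *)
Lemma run_sound_stack A p x K t v :
  iter t (ostep A) (Ev (prog_num p) x K) = Rt v 0 ->
  exists y t', [/\ t' < t, eval A p x y & iter t' (ostep A) (Rt y K) = Rt v 0].
Proof.
elim: p x K t => [||||| p IHp q IHq| p IHp q IHq| p IHp q IHq| p IHp] x K [|t];
  try by move=> /Ev_neq_Rt.
- by rewrite iterSr ostep_Ev /step_ev /= ?cpairE /= => h; exists 0, t; split.
- by rewrite iterSr ostep_Ev /step_ev /= ?cpairE /= => h; exists x.+1, t; split.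
- by rewrite iterSr ostep_Ev /step_ev /= ?cpairE /= => h; exists (cfst x), t; split.
- by rewrite iterSr ostep_Ev /step_ev /= ?cpairE /= => h; exists (csnd x), t; split.
- rewrite iterSr ostep_Ev /step_ev /= ?cpairE /= => h; exists `[< A x >], t; split=> //.
  by case: asboolP; [left|right].
- rewrite iterSr ostep_Ev /step_ev /= ?cpairE /= => /IHp[u [[|t1] [lt1 hu]]].
    by move=> /cpair_inj[_ /cpair_inj[]].
  rewrite iterSr ostep_Rt /step_rt /= ?cpairE /= => /IHq[w [[|t2] [lt2 hw]]].
    by move=> /cpair_inj[_ /cpair_inj[]].
  rewrite iterSr ostep_Rt /step_rt /= ?cpairE /= => h.
  exists (cpair u w), t2; split=> //; first by lia.
  by exists u, w.
- rewrite iterSr ostep_Ev /step_ev /= ?cpairE /= => /IHq[u [[|t1] [lt1 hu]]].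
    by move=> /cpair_inj[_ /cpair_inj[]].
  rewrite iterSr ostep_Rt /step_rt /= ?cpairE /= => /IHp[w [t2 [lt2 hw h]]].
  exists w, t2; split=> //; first by lia.
  by exists u.
- rewrite iterSr ostep_Ev /step_ev [cfst _]/= ?cpairE /= ?cpairE => /IHp[z [t1 [lt1 hz h1]]].
  suff H r j z1 s : s <= t -> rec_graph (eval A p) (eval A q) (cfst x) j z1 ->
      iter s (ostep A) (Rt z1 (push (cpair 3
        (cpair (prog_num q) (cpair (cfst x) (cpair j r)))) K)) = Rt v 0 ->
      exists y t', [/\ t' < t.+1, rec_graph (eval A p) (eval A q) (cfst x) (j + r) y
                   & iter t' (ostep A) (Rt y K) = Rt v 0].
    by have [] := H _ 0 z t1 (ltnW lt1) hz h1 => y; rewrite add0n => -[t' ?]; exists y, t'.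
  elim: r j z1 s => [|r IH] j z1 [|s] lt hz1;
    try by move=> /cpair_inj[_ /cpair_inj[]].
    rewrite iterSr ostep_Rt /step_rt /= ?cpairE /= => h.
    by exists z1, s; split=> //; rewrite ?addn0 //; lia.
  rewrite iterSr ostep_Rt /step_rt /= ?cpairE /= => /IHq[z2 [s' [lt' hz2]]].
  rewrite addnS -addSn; apply: IH; first by lia.
  by exists z1.
- rewrite iterSr ostep_Ev /step_ev /= ?cpairE /=.
  suff H k s : s <= t -> (forall z, z < k -> exists w, eval A p (cpair x z) w.+1) ->
      iter s (ostep A) (Ev (prog_num p) (cpair x k) (push (cpair 4
        (cpair (prog_num p) (cpair x k))) K)) = Rt v 0 ->
      exists y t', [/\ t' < t.+1, eval A (PMu p) x y
                   & iter t' (ostep A) (Rt y K) = Rt v 0].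
    exact: H.
  elim/ltn_ind: s k => s IH k lt hk /IHp[w [[|t2] [lt2 hw]]].
    by move=> /cpair_inj[_ /cpair_inj[]].
  rewrite iterSr ostep_Rt /step_rt /= ?cpairE /=.
  case: w hw => [|w] hw /=; first by move=> h; exists k, t2; split=> //; lia.
  apply: IH; try lia.
  move=> z; rewrite ltnS leq_eqVlt => /orP[/eqP->|/hk//]; by exists w.
Qed.

Lemma run_spec A p x y :
  eval A p x y <-> exists t, iter t (ostep A) (Ev (prog_num p) x 0) = Rt y 0.
Proof.
split=> [|[t /run_sound_stack[z [t' [_ hz]]]]]; first exact: run_complete.
by rewrite iter_final => [/cpair_inj[_ /cpair_inj[<-]]|]; last exact: step_final.
Qed.

#[local] Opaque step.

(** * Relatively computably enumerable sets *)

Definition ce (A : set nat) (P : nat -> Prop) : Prop :=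
  exists2 R : nat -> nat -> bool, Dec A (fun z => R (cfst z) (csnd z)) &
    forall x, P x <-> exists y, R x y.

Lemma ce_ext A (P Q : nat -> Prop) : (forall x, P x <-> Q x) -> ce A P -> ce A Q.
Proof. by move=> e [R hR h]; exists R => // x; rewrite -e. Qed.

Lemma ce_dec A (b : nat -> bool) : Dec A b -> ce A (fun x => b x).
Proof.
move=> hb; exists (fun x _ => b x); first by rec_tac.
by move=> x; split=> [|[]]; first by exists 0.
Qed.

Lemma ce_comp1 A P f : ce A P -> Rec A f -> ce A (fun x => P (f x)).
Proof. by move=> [R hR h] hf; exists (fun x y => R (f x) y) => //; rec_tac. Qed.

Lemma ce_and A P Q : ce A P -> ce A Q -> ce A (fun x => P x /\ Q x).
Proof.
move=> [R hR h] [S hS h']; exists (fun x y => R x (cfst y) && S x (csnd y)); first by rec_tac.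
move=> x; rewrite h h'; split=> [[[y hy] [z hz]]|[y /andP[hy hz]]].
  by exists (cpair y z); rewrite !cpairE hy.
by split; [exists (cfst y)|exists (csnd y)].
Qed.

Lemma ce_or A P Q : ce A P -> ce A Q -> ce A (fun x => P x \/ Q x).
Proof.
move=> [R hR h] [S hS h']; exists (fun x y => R x y || S x y); first by rec_tac.
move=> x; rewrite h h'; split=> [[[y hy]|[y hy]]|[y /orP[hy|hy]]].
- by exists y; rewrite hy.
- by exists y; rewrite hy orbT.
- by left; exists y.
- by right; exists y.
Qed.

Lemma ce_ex A P :
  ce A (fun z => P (cfst z) (csnd z)) -> ce A (fun x => exists y, P x y).
Proof.
move=> [R hR h]; exists (fun x y => R (cpair x (cfst y)) (csnd y)); first by rec_tac.
move=> x; split=> [[y hy]|[y hy]].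
  have := h (cpair x y); rewrite !cpairE => -[/(_ hy)[z hz] _].
  by exists (cpair y z); rewrite !cpairE.
by exists (cfst y); have := h (cpair x (cfst y)); rewrite !cpairE => -[_]; apply; exists (csnd y).
Qed.

Lemma ce_bex A n P :
  Rec A n -> ce A (fun z => P (cfst z) (csnd z)) ->
  ce A (fun x => exists2 i, i < n x & P x i).
Proof.
move=> hn hP.
apply: (@ce_ext _ (fun x => exists i, i < n x /\ P x i)).
  by move=> x; split=> [[i []]|[i]]; exists i.
by apply/ce_ex/ce_and => //; apply: ce_dec; rec_tac.
Qed.

(** Collecting the witnesses into one list moves an unbounded existential
    quantifier in front of a bounded universal one. *)
Lemma ce_ball A n P :
  Rec A n -> ce A (fun z => P (cfst z) (csnd z)) ->
  ce A (fun x => forall i, i < n x -> P x i).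
Proof.
move=> hn [R hR h].
exists (fun x y => ball (n x) (fun i => R (cpair x i) (nth 0 (unseq y) i))).
  by rec_tac.
move=> x; split=> [H|[y /ballP H] i lt]; last first.
  by have := h (cpair x i); rewrite !cpairE => ->; exists (nth 0 (unseq y) i); apply: H.
have /choice[g hg] : forall i, exists y, i < n x -> R (cpair x i) y.
  move=> i; case: (ltnP i (n x)) => [lt|]; last by exists 0.
  by have := h (cpair x i); rewrite !cpairE => -[/(_ (H _ lt))[y hy] _]; exists y.
exists (seq_num (mkseq g (n x))); apply/ballP => i lt.
by rewrite seq_numK nth_mkseq // hg.
Qed.

(** * The jump *)

Lemma jumpP A e :
  jump A e <-> is_prog e /\ exists t y, iter t (ostep A) (Ev e e 0) = Rt y 0.
Proof.
split=> [[y [p <- h]]|[/is_progP[p <-] [t [y h]]]].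
  split; first by apply/is_progP; exists p.
  by have /run_spec[t ht] := h; exists t, y.
by exists y; apply/phiE/run_spec; exists t.
Qed.

Lemma Rec_ostep A f : Rec A f -> Rec A (fun x => ostep A (f x)).
Proof.
move=> hf; rewrite /ostep; apply: Rec_step => //.
by apply: Rec_oracle; rewrite /query; rec_tac.
Qed.

(** The search for a halting time of the machine, started on the argument as its
    own program. *)
Lemma ce_jump A : ce A (jump A).
Proof.
apply: (@ce_ext _ (fun e => is_prog e /\ exists t y,
  iter t (fun c => ostep A c) (Ev e e 0) == Rt y 0)).
  move=> e; rewrite jumpP.
  by split=> -[h [t [y]]] /eqP ht; split=> //; exists t, y.
apply: ce_and; first by apply/ce_dec/Dec_is_prog/Rec_id.
apply/ce_ex/ce_ex/ce_dec; rewrite /Ev /Rt; rec_tac.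
by apply: Rec_ostep; rec_tac.
Qed.

Fixpoint const_prog (x : nat) : prog :=
  if x is y.+1 then PComp PSucc (const_prog y) else PZero.

Lemma eval_const_prog A x z : eval A (const_prog x) z x.
Proof. by elim: x => //= x IH; exists x. Qed.

(** The program searching a witness for [x], with the number [x] built in so
    that its own input is ignored, halts exactly when [x] belongs to the set. *)
Lemma ce_le_jump A P :
  ce A P -> exists2 f, Rec set0 f & forall x, P x <-> jump A (f x).
Proof.
move=> [R [p hp] h].
have [q hq] : Rec A (fun z => ~~ R (cfst z) (csnd z)).
  by have : Dec A (fun z => R (cfst z) (csnd z)) by [exists p]; move=> ?; rec_tac.
exists (fun x => prog_num (PComp (PMu q) (const_prog x))).
  apply: (@Rec_ext _ (fun x => cpair 6 (cpair (prog_num (PMu q))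
    (iter x (fun r => cpair 6 (cpair (prog_num PSucc) r)) (prog_num PZero))))).
    by move=> x /=; congr (cpair _ (cpair _ _)); elim: x => //= x ->.
  by rec_tac.
move=> x; rewrite h; split=> [hx|[y [r /prog_num_inj->]]]; last first.
  move=> /= [u hu [hy _]]; exists y; have := hq (cpair u y).
  rewrite (eval_det hu (eval_const_prog _ _ _)) in hy *.
  by move=> /(eval_det hy); rewrite !cpairE; case: (R x y).
have [y hy min] := ex_minnP hx.
exists y; exists (PComp (PMu q) (const_prog x)) => //=.
exists x; first exact: eval_const_prog.
split; first by have := hq (cpair x y); rewrite !cpairE hy.
move=> z lt; exists 0; have := hq (cpair x z); rewrite !cpairE.
by case: (boolP (R x z)) => // /min; lia.
Qed.

Lemma Dec_jump_ce A P : ce A P -> Dec (jump A) (fun x => `[< P x >]).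
Proof.
move=> /ce_le_jump[f hf h].
apply: (@Dec_ext _ (fun x => `[< jump A (f x) >])).
  by move=> x; apply: asbool_equiv_eq; rewrite h.
exact/Rec_oracle/Rec_set0.
Qed.

Lemma turing_le_jump A : turing_le A (jump A).
Proof.
apply/turing_leP.
suff /Dec_jump_ce : ce A A by [].
apply: (@ce_ext _ (fun x => `[< A x >])); first by move=> x; split=> /asboolP.
exact/ce_dec/Rec_oracle/Rec_id.
Qed.

Lemma Rec_jump A f : Rec A f -> Rec (jump A) f.
Proof. exact/Rec_trans/turing_le_jump. Qed.

(** * The arithmetical hierarchy and the iterated jump *)

(** Each quantifier of the arithmetical hierarchy costs one jump. *)
Lemma arith_Sigma_dec k P :
  arith_Sigma k P -> Dec (zero_jump k) (fun x => `[< P x >]).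
Proof.
elim: k P => [|k IH] P; first by move=> /computable_setP.
move=> [B /IH hB ->]; apply: Dec_jump_ce.
apply: (@ce_ext _ (fun x => exists y, `[< B (cpair x y) >])).
  by move=> x; split=> -[y /asboolP h]; exists y.
apply/ce_ex/ce_dec.
apply: (@Dec_ext _ (fun z => ~~ `[< (~` B) (cpair (cfst z) (csnd z)) >])).
  by move=> z; rewrite asbool_neg negbK.
by apply: Dec_neg; apply: (Rec_comp1 hB); rec_tac.
Qed.

Lemma arith_Sigma_ce k P : arith_Sigma k.+1 P -> ce (zero_jump k) P.
Proof.
move=> [B /arith_Sigma_dec hB ->].
apply: (@ce_ext _ (fun x => exists y, ~~ `[< (~` B) (cpair x y) >])).
  by move=> x; split=> -[y h]; exists y; move: h; rewrite asbool_neg negbK => /asboolP.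
by apply/ce_ex/ce_dec/Dec_neg; apply: (Rec_comp1 hB); rec_tac.
Qed.

(** The configuration after [j] steps from [c] when the oracle is replaced
    by the list of answers [r], any nonzero answer standing for yes. *)
Definition cert_run (r c j : nat) : nat :=
  iteri j (fun i s => step (nth 0 (unseq r) i != 0) s) c.

(** Correct answers, up to the time considered, give the run with the oracle. *)
Lemma cert_runE A r c t j :
  (forall i, i < t ->
     (nth 0 (unseq r) i != 0) = `[< A (query (cert_run r c i)) >]) ->
  j <= t -> cert_run r c j = iter j (ostep A) c.
Proof.
move=> h; elim: j => [//|j IH] lt.
rewrite /cert_run iteriS -/(cert_run r c j) (h j lt) (IH (ltnW lt)).
by rewrite iterS.
Qed.

(** A computation with the oracle [jump A] is certified by the list of the
    answers received: a positive answer is recorded as the successor of a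
    witness of the enumeration of [jump A], so that only the negative answers
    need a universal quantifier. *)
Lemma ce_jump_unfold A P :
  ce (jump A) P ->
  exists2 B : set nat, ce A (~` B) & P = [set x | exists y, B (cpair x y)].
Proof.
move=> [R [p hp] hR]; have [RJ hRJ hJ] := ce_jump A.
(* The certificate [w] is a candidate witness, a running time [t w] and a list
   [r w] of answers; [neg] collects the refutations of negative answers. *)
pose c0 x w := Ev (prog_num p) (cpair x (cfst w)) 0.
pose t w := cfst (csnd w); pose r w := csnd (csnd w).
pose st x w j := cert_run (r w) (c0 x w) j.
pose pos x w := (st x w (t w) == Rt 1 0) &&
  ball (t w) (fun i => let a := nth 0 (unseq (r w)) i in
    (a != 0) ==> RJ (query (st x w i)) a.-1).
pose neg x w := exists2 i, i < t w &
  nth 0 (unseq (r w)) i == 0 /\ jump A (query (st x w i)).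
have hst : Rec A (fun z => st (cfst z) (cfst (csnd z)) (csnd (csnd z))).
  rewrite /st /cert_run /c0 /r /Ev; rec_tac.
  by apply: Rec_step; rec_tac.
exists (fun z => pos (cfst z) (csnd z) /\ ~ neg (cfst z) (csnd z)).
  apply: (@ce_ext _ (fun z => ~~ pos (cfst z) (csnd z) \/ neg (cfst z) (csnd z))).
    move=> z /=; split=> [h [h1 h2]|/not_andP[/negP|/contrapT]]; try by [left|right].
    by case: h => // /negP.
  apply: ce_or.
    apply: ce_dec; rewrite /pos /t /r /query /Rt; rec_tac.
  rewrite /neg; apply: ce_bex; first by rewrite /t; rec_tac.
  apply: ce_and; first by apply: ce_dec; rewrite /r; rec_tac.
  by apply: (ce_comp1 (ce_jump A)); rewrite /query; rec_tac.
apply/funext => x; apply/propext; rewrite hR; split=> [[y hy]|[w]]; last first.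
  rewrite /= !cpairE => -[/andP[/eqP fin /ballP hpos] hneg].
  exists (cfst w).
  suff e : st x w (t w) = iter (t w) (ostep (jump A)) (c0 x w).
    have /run_spec h : exists s, iter s (ostep (jump A)) (c0 x w) = Rt 1 0.
      by exists (t w); rewrite -e.
    by have := eval_det (hp _) h; rewrite !cpairE; case: (R x (cfst w)).
  apply: (cert_runE (t := t w)) => // i lt; apply/idP/asboolP => [h|h].
    by apply/hJ; exists (nth 0 (unseq (r w)) i).-1; have /implyP := hpos _ lt; apply.
  by apply/negP => h0; apply: hneg; exists i.
have /run_spec[s hs] := hp (cpair x y); rewrite !cpairE hy in hs.
have /choice[g hg] : forall q, exists a, jump A q -> RJ q a.
  move=> q; case: (pselect (jump A q)) => [/hJ[a ha]|]; first by exists a.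
  by exists 0.
(* The certificate of the actual run answers every question truthfully. *)
pose q i := query (iter i (ostep (jump A)) (Ev (prog_num p) (cpair x y) 0)).
pose ans i := if `[< jump A (q i) >] then (g (q i)).+1 else 0.
pose w := cpair y (cpair s (seq_num (mkseq ans s))).
have nthE i : i < s -> nth 0 (unseq (r w)) i = ans i.
  by move=> lt; rewrite /r /w !cpairE seq_numK nth_mkseq.
have c0E : c0 x w = Ev (prog_num p) (cpair x y) 0 by rewrite /c0 /w !cpairE.
have tE : t w = s by rewrite /t /w !cpairE.
have stE j : j <= s -> st x w j = iter j (ostep (jump A)) (Ev (prog_num p) (cpair x y) 0).
  rewrite -c0E; elim: j => [//|j IH] lt.
  rewrite /st /cert_run iteriS -/(cert_run _ _ j) -/(st x w j) (IH (ltnW lt)) iterS.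
  by rewrite nthE // /ostep c0E -/(q j) /ans; case: asboolP.
have qE i : i < s -> query (st x w i) = q i by move=> lt; rewrite (stE i (ltnW lt)).
exists w; rewrite /= !cpairE; split.
  rewrite /pos tE (stE s (leqnn s)) hs eqxx andTb; apply/ballP => i lt.
  rewrite (nthE i lt) (qE i lt) /ans.
  by case: asboolP => h //=; apply: hg.
move=> [i]; rewrite tE => lt; rewrite (nthE i lt) (qE i lt) /ans => -[].
by case: asboolP.
Qed.

Lemma ce_arith_Sigma k P : ce (zero_jump k) P -> arith_Sigma k.+1 P.
Proof.
elim: k P => [|k IH] P.
  move=> [R hR h]; exists (fun z => R (cfst z) (csnd z)).
    apply/computable_setP.
    apply: (@Dec_ext _ (fun z => ~~ R (cfst z) (csnd z))); last by rec_tac.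
    by move=> z; apply/negP/asboolP.
  by apply/funext => x; apply/propext; rewrite h; split=> -[y hy]; exists y;
    rewrite ?cpairE in hy *.
by move=> /ce_jump_unfold[B /IH hB ->]; exists B.
Qed.

Lemma arith_SigmaP k P : arith_Sigma k.+1 P <-> ce (zero_jump k) P.
Proof. by split=> [/arith_Sigma_ce|/ce_arith_Sigma]. Qed.

Lemma Sigma_complete_zero_jump k : Sigma_complete k.+1 (zero_jump k.+1).
Proof.
split; first exact/ce_arith_Sigma/ce_jump.
by move=> B /arith_Sigma_ce/ce_le_jump[f /computable_funP hf h]; exists f.
Qed.

Lemma many_one_trans A B C : many_one_le A B -> many_one_le B C -> many_one_le A C.
Proof.
move=> [f /computable_funP hf h] [g /computable_funP hg h'].
exists (fun x => g (f x)); last by move=> x; rewrite h h'.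
exact/computable_funP/Rec_comp1/hf.
Qed.

Lemma Sigma_completeI k A :
  ce (zero_jump k) A -> many_one_le (zero_jump k.+1) A -> Sigma_complete k.+1 A.
Proof.
move=> /ce_arith_Sigma hA le; split=> // B hB.
apply: many_one_trans le; exact: (proj2 (Sigma_complete_zero_jump k)).
Qed.

(** * Recursion on the numbers of formulas *)

Definition unvar (c : nat) : var := (cfst c, csnd c).

Lemma var_numK : cancel var_num unvar.
Proof. by move=> [j k]; rewrite /unvar /var_num /= !cpairE. Qed.

Lemma unvarK : cancel unvar var_num.
Proof. by move=> c; rewrite /unvar /var_num /= cpairK. Qed.

Lemma var_num_inj : injective var_num. Proof. exact: can_inj var_numK. Qed.

Lemma unvar_eq c v : (unvar c == v) = (c == var_num v).
Proof. by rewrite -(inj_eq var_num_inj) unvarK. Qed.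

Definition unvars (c : nat) : seq var := [seq unvar v | v <- unseq c].

Lemma unvarsK vs : unvars (seq_num [seq var_num v | v <- vs]) = vs.
Proof. by rewrite /unvars seq_numK -map_comp map_id_in // => v _ /=; rewrite var_numK. Qed.

Lemma var_num_unvars c : seq_num [seq var_num v | v <- unvars c] = c.
Proof.
rewrite /unvars -map_comp map_id_in ?unseqK // => v _ /=; exact: unvarK.
Qed.

Fixpoint unform_rec (k c : nat) : form :=
  let r := csnd c in
  if k is k'.+1 then
    match cfst c with
    | 0 => FEq (unvar (cfst r)) (unvar (csnd r))
    | 1 => FRel (cfst r) (unvars (csnd r))
    | 2 => FNot (unform_rec k' r)
    | 3 => FAnd (unform_rec k' (cfst r)) (unform_rec k' (csnd r))
    | 4 => FOr (unform_rec k' (cfst r)) (unform_rec k' (csnd r))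
    | 5 => FEx (unvar (cfst r)) (unform_rec k' (csnd r))
    | 6 => FAll (unvar (cfst r)) (unform_rec k' (csnd r))
    | _ => FEq (0, 0) (0, 0)
    end
  else FEq (0, 0) (0, 0).

(** Junk parts of [c] decode to [FEq (0, 0) (0, 0)], so that [c] is the number
    of a formula exactly when [form_num (unform c) = c].  The argument itself
    bounds the depth of the recursion. *)
Definition unform (c : nat) : form := unform_rec c.+1 c.

Lemma unform_recE k k' c : c < k -> c < k' -> unform_rec k c = unform_rec k' c.
Proof.
elim/ltn_ind: c k k' => c IH [|k] [|k'] //; rewrite !ltnS => le le' /=.
have := @csnd_lt c; case: (cfst c) => // t /(_ isT) lt.
have lt1 := leq_ltn_trans (cfst_le (csnd c)) lt.
have lt2 := leq_ltn_trans (csnd_le (csnd c)) lt.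
have E x : x < c -> unform_rec k x = unform_rec k' x by move=> h; apply: IH; lia.
by rewrite !E.
Qed.

Lemma unformE c :
  unform c = let r := csnd c in
    match cfst c with
    | 0 => FEq (unvar (cfst r)) (unvar (csnd r))
    | 1 => FRel (cfst r) (unvars (csnd r))
    | 2 => FNot (unform r)
    | 3 => FAnd (unform (cfst r)) (unform (csnd r))
    | 4 => FOr (unform (cfst r)) (unform (csnd r))
    | 5 => FEx (unvar (cfst r)) (unform (csnd r))
    | 6 => FAll (unvar (cfst r)) (unform (csnd r))
    | _ => FEq (0, 0) (0, 0)
    end.
Proof.
rewrite {1}/unform /=.
have := @csnd_lt c; case: (cfst c) => // t /(_ isT) lt.
have lt1 := leq_ltn_trans (cfst_le (csnd c)) lt.
have lt2 := leq_ltn_trans (csnd_le (csnd c)) lt.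
have E x : x < c -> unform_rec c x = unform x by move=> h; apply: unform_recE; lia.
by rewrite !E.
Qed.

Lemma form_numK : cancel form_num unform.
Proof.
elim=> [u v|i vs|f IH|f IHf g IHg|f IHf g IHg|v f IH|v f IH];
  rewrite unformE /= !cpairE ?unvarsK ?IHf ?IHg ?IH //.
- by rewrite !var_numK.
- by rewrite var_numK.
- by rewrite var_numK.
Qed.

Definition kid1 (f : form) : option form :=
  match f with FNot g | FAnd g _ | FOr g _ => Some g | _ => None end.

Definition kid2 (f : form) : option form :=
  match f with FAnd _ g | FOr _ g | FEx _ g | FAll _ g => Some g | _ => None end.

(** One step of a recursion on formulas: [G] is given the parameter [a], the
    number of the formula, which [nrm] restores when [c] contains junk, and the
    values at the two immediate subformulas (the body of a quantified formula
    counting as the second one), with [0] for a missing one. *)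
Definition form_step (G : nat -> nat -> nat -> nat -> nat) (nrm : nat -> nat)
    (a c : nat) (l : nat -> nat) : nat :=
  let t := cfst c in let r := csnd c in
  if t == 2 then G a (nrm c) (l r) 0
  else if (t == 3) || (t == 4) then G a (nrm c) (l (cfst r)) (l (csnd r))
  else if (t == 5) || (t == 6) then G a (nrm c) 0 (l (csnd r))
  else G a (nrm c) 0 0.

Lemma form_stepE F G nrm :
  (forall a f, F a f = G a (form_num f) (oapp (F a) 0 (kid1 f)) (oapp (F a) 0 (kid2 f))) ->
  (forall c, G^~ (nrm c) = G^~ (form_num (unform c))) ->
  forall a c, cov (form_step G nrm) a c = F a (unform c).
Proof.
move=> hF hG a; elim/ltn_ind => c IH; rewrite hF.
have e x y : G a (nrm c) x y = G a (form_num (unform c)) x y.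
  by have := congr1 (fun g => g a x y) (hG c).
rewrite /cov; set l := lk _ _; rewrite /form_step !e /l {l}.
set N := form_num _; rewrite (unformE c) /=.
have lt := @csnd_lt c.
have E x : x < c -> lk (cov_tbl (form_step G nrm) a c) c x = F a (unform x).
  by move=> h; rewrite lk_cov_tbl ?IH.
move: lt {e}; case: (cfst c) => [|t] //= lt.
have {lt} lt := lt isT.
have lt1 := leq_ltn_trans (cfst_le (csnd c)) lt.
have lt2 := leq_ltn_trans (csnd_le (csnd c)) lt.
by move: t => [|[|[|[|[|[|t]]]]]] //=; rewrite !E.
Qed.

Lemma Rec_form_step A G nrm f g :
  Rec A (fun z => G (cfst z) (cfst (csnd z)) (cfst (csnd (csnd z))) (csnd (csnd (csnd z)))) ->
  Rec A nrm -> Rec A f -> Rec A g ->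
  Rec A (fun x => cov (form_step G nrm) (f x) (g x)).
Proof.
move=> hG hn hf hg.
have E f1 f2 f3 f4 : Rec A f1 -> Rec A f2 -> Rec A f3 -> Rec A f4 ->
    Rec A (fun x => G (f1 x) (f2 x) (f3 x) (f4 x)).
  move=> h1 h2 h3 h4.
  apply: Rec_ext (Rec_comp1 hG (Rec_pair h1 (Rec_pair h2 (Rec_pair h3 h4)))) => x.
  by rewrite !cpairE.
apply: Rec_cov => //; rewrite /form_step; rec_tac; apply: E; rec_tac.
Qed.

Definition form_norm (c : nat) : nat := form_num (unform c).

(** The same recursion without parameter and without normalisation, as its step
    copies only the parts that are free of junk. *)
Lemma Rec_form_norm A f : Rec A f -> Rec A (fun x => form_norm (f x)).
Proof.
pose G (a c r1 r2 : nat) : nat :=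
  let t := cfst c in let r := csnd c in
  if t <= 1 then c else if t == 2 then cpair t r1
  else if t <= 4 then cpair t (cpair r1 r2)
  else if t <= 6 then cpair t (cpair (cfst r) r2) else 0.
have E a c : cov (form_step G id) a c = form_norm c.
  elim/ltn_ind: c => c IH; rewrite /form_norm.
  rewrite /cov; set l := lk _ _; rewrite /form_step (unformE c) /G /l {l} /=.
  have h x : x < c -> lk (cov_tbl (form_step G id) a c) c x = form_norm x.
    by move=> h; rewrite lk_cov_tbl ?IH.
  have := @csnd_lt c; have := cpairK c.
  case: (cfst c) => [|[|t]] /=.
  - by rewrite !unvarK cpairK => ->.
  - by rewrite var_num_unvars cpairK => ->.
  move=> _ /(_ isT) lt.
  have lt1 := leq_ltn_trans (cfst_le (csnd c)) lt.
  have lt2 := leq_ltn_trans (csnd_le (csnd c)) lt.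
  by move: t => [|[|[|[|[|t]]]]] //=; rewrite !h // !unvarK.
move=> hf; apply: (@Rec_ext _ (fun x => cov (form_step G id) 0 (f x))) => [x|] //.
by apply: Rec_form_step; rewrite /G; rec_tac.
Qed.

(** A function given by recursion on formulas is computable on their numbers
    as soon as its recursion step is. *)
Lemma Rec_form A (F : nat -> form -> nat) G f g :
  (forall a f, F a f = G a (form_num f) (oapp (F a) 0 (kid1 f)) (oapp (F a) 0 (kid2 f))) ->
  Rec A (fun z => G (cfst z) (cfst (csnd z)) (cfst (csnd (csnd z))) (csnd (csnd (csnd z)))) ->
  Rec A f -> Rec A g -> Rec A (fun x => F (f x) (unform (g x))).
Proof.
move=> hF hG hf hg.
apply: (@Rec_ext _ (fun x => cov (form_step G form_norm) (f x) (g x))).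
  by move=> x; apply: form_stepE.
apply: Rec_form_step => //; exact/Rec_form_norm/Rec_id.
Qed.

Lemma Rec_form0 A (F : form -> nat) G g :
  (forall f, F f = G (form_num f) (oapp F 0 (kid1 f)) (oapp F 0 (kid2 f))) ->
  Rec A (fun z => G (cfst z) (cfst (csnd z)) (csnd (csnd z))) ->
  Rec A g -> Rec A (fun x => F (unform (g x))).
Proof.
move=> hF hG hg.
apply: (@Rec_form A (fun _ => F) (fun _ => G) (fun=> 0)) => //; last exact: Rec_const.
by apply: (Rec_comp3 hG); rec_tac.
Qed.

(** * Syntactic classes of formulas *)

(** [q] is [true] for [Sigma_k] and [false] for [Pi_k]. *)
Fixpoint prenexb (k : nat) : bool -> form -> bool :=
  if k is k'.+1 then fun q =>
    fix go f := prenexb k' (~~ q) f ||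
      match f with FEx _ g => q && go g | FAll _ g => ~~ q && go g | _ => false end
  else fun _ f => quantifier_rank f == 0.

Lemma prenexbP k f :
  (prenexb k true f <-> Sigma_form k f) /\ (prenexb k false f <-> Pi_form k f).
Proof.
elim: k f => [|k IH] f.
  by split; split=> [/eqP h|]; try constructor=> //; move=> h; inversion h; apply/eqP.
have invS f0 : Sigma_form k.+1 f0 -> Pi_form k f0 \/
    exists v g, f0 = FEx v g /\ Sigma_form k.+1 g.
  by move=> h; inversion h; subst; [left|right; exists v, f1].
have invP f0 : Pi_form k.+1 f0 -> Sigma_form k f0 \/
    exists v g, f0 = FAll v g /\ Pi_form k.+1 g.
  by move=> h; inversion h; subst; [left|right; exists v, f1].
split; split.
- elim: f => [u v|i vs|g _|g _ h _|g _ h _|v g IHg|v g _];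
    move=> /orP[/(proj2 (IH _))|] //; try by constructor.
  by move=> /IHg; apply: Sigma_formEx.
- elim: f => [u v|i vs|g _|g _ h _|g _ h _|v g IHg|v g _] /invS[/(proj2 (IH _))|[w [g' [e hg]]]] //;
    try by move=> /= ->.
  by case: e hg => _ <- /IHg /= ->; rewrite orbT.
- elim: f => [u v|i vs|g _|g _ h _|g _ h _|v g _|v g IHg];
    move=> /orP[/(proj1 (IH _))|] //; try by constructor.
  by move=> /IHg; apply: Pi_formAll.
- elim: f => [u v|i vs|g _|g _ h _|g _ h _|v g _|v g IHg] /invP[/(proj1 (IH _))|[w [g' [e hg]]]] //;
    try by move=> /= ->.
  by case: e hg => _ <- /IHg /= ->; rewrite orbT.
Qed.

Lemma Sigma_formP k f : reflect (Sigma_form k f) (prenexb k true f).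
Proof. by apply: (iffP idP) => /(proj1 (prenexbP k f)). Qed.

Lemma Dec_prenexb A k q f : Rec A f -> Dec A (fun x => prenexb k q (unform (f x))).
Proof.
elim: k q f => [|k IH] q f hf.
  apply: (@Rec_form0 A (fun g => prenexb 0 q g) (fun c r1 r2 =>
    let t := cfst c in
    (t <= 1) || ((t == 2) && (r1 != 0)) ||
      (((t == 3) || (t == 4)) && (r1 != 0) && (r2 != 0)))) => //; last by rec_tac.
  case=> [u v|i vs|g|g h|g h|v g|v g] /=; rewrite !cpairE //=.
  - by rewrite orbF eqb0 negbK.
  - by rewrite -leqn0 geq_max !leqn0 !eqb0 !negbK.
  - by rewrite -leqn0 geq_max !leqn0 !eqb0 !negbK.
apply: (@Rec_form0 A (fun g => prenexb k.+1 q g) (fun c r1 r2 =>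
    let t := cfst c in
    prenexb k (~~ q) (unform c) || ((t == 5) && q && (r2 != 0))
      || ((t == 6) && ~~ q && (r2 != 0)))) => //.
  case=> [u v|i vs|g|g h|g h|v g|v g]; cbv beta zeta;
    rewrite form_numK /= !cpairE /= ?andbF ?orbF ?eqb0 ?negbK ?andbT //.
by rec_tac; apply: IH; rec_tac.
Qed.

Fixpoint bool_combb (n : nat) (f : form) : bool :=
  prenexb n true f ||
  match f with
  | FNot g => bool_combb n g
  | FAnd g h | FOr g h => bool_combb n g && bool_combb n h
  | _ => false
  end.

Lemma bool_combP n f : reflect (bool_comb (Sigma_form n) f) (bool_combb n f).
Proof.
apply: (iffP idP) => [|h].
  elim: f => [u v|i vs|g IHg|g IHg h IHh|g IHg h IHh|v g IHg|v g IHg];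
   move=> /orP[/Sigma_formP|] //; try (by constructor).
  - by move=> /IHg; constructor.
  - by move=> /andP[/IHg ? /IHh ?]; constructor.
  - by move=> /andP[/IHg ? /IHh ?]; constructor.
elim: h => [g /Sigma_formP hg|g _ hg|g h _ hg _ hh|g h _ hg _ hh].
- by case: g hg => * /=; apply/orP; left.
- by rewrite /= hg orbT.
- by rewrite /= hg hh orbT.
- by rewrite /= hg hh orbT.
Qed.

Lemma Dec_bool_combb A n f : Rec A f -> Dec A (fun x => bool_combb n (unform (f x))).
Proof.
move=> hf; apply: (@Rec_form0 A (fun g => bool_combb n g) (fun c r1 r2 =>
    let t := cfst c in
    prenexb n true (unform c) || ((t == 2) && (r1 != 0))
      || (((t == 3) || (t == 4)) && (r1 != 0) && (r2 != 0)))) => //.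
  case=> [u v|i vs|g|g h|g h|v g|v g]; cbv beta zeta;
    rewrite form_numK /= !cpairE /= ?orbF ?eqb0 ?negbK //.
by rec_tac; apply: Dec_prenexb; rec_tac.
Qed.

(** Two arguments for the free variables of a formula and [n] for its
    quantifiers. *)
Definition rel_sorts (n : nat) : seq nat := nseq n.+2 0.
Lemma size_rel_sorts n : size (rel_sorts n) = n.+2.
Proof. by rewrite /rel_sorts size_nseq. Qed.

Lemma mem_rel_sorts n j : j \in rel_sorts n -> j = 0.
Proof. by rewrite /rel_sorts => /nseqP[]. Qed.

Lemma map_rel_sorts n (T : Type) (s : seq T) g :
  size s = n.+2 -> (forall x, g x = 0) -> [seq g x | x <- s] = rel_sorts n.
Proof. by rewrite /rel_sorts => <- h; elim: s => //= x s ->; rewrite h. Qed.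

#[local] Opaque rel_sorts.

(** [wf_form] for the languages with one sort and two relation symbols, both of
    type [rel_sorts n]. *)
Fixpoint wfb (n : nat) (f : form) : bool :=
  match f with
  | FEq u v => (u.1 == 0) && (v.1 == 0)
  | FRel i vs => (i < 2) && ([seq v.1 | v <- vs] == rel_sorts n)
  | FNot g => wfb n g
  | FAnd g h | FOr g h => wfb n g && wfb n h
  | FEx v g | FAll v g => (v.1 == 0) && wfb n g
  end.

Lemma Dec_wfb A n f : Rec A f -> Dec A (fun x => wfb n (unform (f x))).
Proof.
move=> hf; apply: (@Rec_form0 A (fun g => wfb n g) (fun c r1 r2 =>
    let t := cfst c in let r := csnd c in
    if t == 0 then (cfst (cfst r) == 0) && (cfst (csnd r) == 0)
    else if t == 1 then (cfst r <= 1) &&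
      (seq_num [seq cfst v | v <- unseq (csnd r)] == seq_num (rel_sorts n))
    else if t == 2 then r1 != 0
    else if t <= 4 then (r1 != 0) && (r2 != 0)
    else (cfst (cfst r) == 0) && (r2 != 0))) => //; last by rec_tac.
case=> [u v|i vs|g|g h|g h|v g|v g]; rewrite [wfb _ _]/= [form_num _]/=
    !cpairE /= ?eqb0 ?negbK ?cpairE /var_num ?cpairE //.
by rewrite (inj_eq seq_num_inj) seq_numK -map_comp; congr (nat_of_bool (_ && (_ == _)));
   apply: eq_map => v; rewrite /= cfstK.
Qed.

Definition occurs (v : nat) (f : form) : bool := unvar v \in free_vars f.

Lemma Dec_occurs A f g :
  Rec A f -> Rec A g -> Dec A (fun x => occurs (f x) (unform (g x))).
Proof.
move=> hf hg; apply: (@Rec_form A (fun v g => occurs v g) (fun a c r1 r2 =>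
    let t := cfst c in let r := csnd c in
    if t == 0 then (a == cfst r) || (a == csnd r)
    else if t == 1 then a \in unseq (csnd r)
    else if t == 2 then r1 != 0
    else if t <= 4 then (r1 != 0) || (r2 != 0)
    else (a != cfst r) && (r2 != 0))) => //; last by rec_tac.
move=> a [u v|i vs|g0|g0 h|g0 h|v g0|v g0]; rewrite [form_num _]/= !cpairE /=
    ?cpairE ?eqb0 ?negbK /occurs /= ?mem_cat ?mem_filter ?in_cons ?in_nil ?orbF
    ?unvar_eq //.
by rewrite seq_numK -(mem_map var_num_inj) unvarK.
Qed.

(** Bounds the search for the free variables of a formula. *)
Lemma free_var_le f v : v \in free_vars f -> var_num v <= form_num f.
Proof.
have P := cpair_ge.
elim: f => [u w|i vs|g IHg|g IHg h IHh|g IHg h IHh|w g IHg|w g IHg] /=.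
- rewrite !inE => /orP[]/eqP->; have := P 0 (cpair (var_num u) (var_num w));
    have := P (var_num u) (var_num w); lia.
- move=> /(map_f var_num)/mem_seq_num; move: (seq_num _) => s lt.
  by have := P 1 (cpair i s); have := P i s; lia.
- by move=> /IHg; have := P 2 (form_num g); lia.
- by rewrite mem_cat => /orP[/IHg|/IHh]; have := P 3 (cpair (form_num g) (form_num h));
   have := P (form_num g) (form_num h); lia.
- by rewrite mem_cat => /orP[/IHg|/IHh]; have := P 4 (cpair (form_num g) (form_num h));
   have := P (form_num g) (form_num h); lia.
- by rewrite mem_filter => /andP[_ /IHg]; have := P 5 (cpair (var_num w) (form_num g));
   have := P (var_num w) (form_num g); lia.
- by rewrite mem_filter => /andP[_ /IHg]; have := P 6 (cpair (var_num w) (form_num g));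
   have := P (var_num w) (form_num g); lia.
Qed.

(** * Deciding satisfaction with iterated jumps *)

(** Replacing every sort by the whole of the natural numbers does not change
    the truth of the formulas of a one-sorted language, and frees the
    evaluation of a formula from checking that the formula is well-formed. *)
Definition full_structure (R : nat -> seq nat -> bool) : structure :=
  {| univ := setT; in_sort := fun=> setT; in_rel := fun i => [set a | R i a] |}.

Lemma sat_full N (R : nat -> seq nat -> bool) s n f :
  in_sort N 0 = setT -> (forall i a, i < 2 -> in_rel N i a <-> R i a) ->
  wfb n f -> sat N s f <-> sat (full_structure R) s f.
Proof.
move=> hS hR.
elim: f s => [u v|i vs|g IHg|g IHg h IHh|g IHg h IHh|v g IHg|v g IHg] s //=.
- by move=> /andP[lt _]; exact: hR.
- by move=> /IHg ->.
- by move=> /andP[/IHg -> /IHh ->].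
- by move=> /andP[/IHg -> /IHh ->].
- move=> /andP[/eqP v0 /IHg h]; rewrite v0 hS.
  by split=> -[b _ hb]; exists b => //; apply/h.
- move=> /andP[/eqP v0 /IHg h]; rewrite v0 hS.
  by split=> hb b _; apply/h/hb.
Qed.

Lemma sat_ext N f s s' :
  (forall v, v \in free_vars f -> s v = s' v) -> sat N s f <-> sat N s' f.
Proof.
elim: f s s' => [u v|i vs|g IHg|g IHg h IHh|g IHg h IHh|v g IHg|v g IHg] s s' /= e.
- by rewrite !e ?inE ?eqxx ?orbT.
- by have -> : [seq s v | v <- vs] = [seq s' v | v <- vs] by apply/eq_in_map.
- by rewrite (IHg s s').
- by rewrite (IHg s s') ?(IHh s s') // => v hv; apply: e; rewrite mem_cat hv ?orbT.
- by rewrite (IHg s s') ?(IHh s s') // => v hv; apply: e; rewrite mem_cat hv ?orbT.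
- have E b : sat N (upd s v b) g <-> sat N (upd s' v b) g.
    apply: IHg => u hu; rewrite /upd; case: eqP => // /eqP uv.
    by apply: e; rewrite mem_filter uv.
  by split=> -[b hb /E]; exists b.
- have E b : sat N (upd s v b) g <-> sat N (upd s' v b) g.
    apply: IHg => u hu; rewrite /upd; case: eqP => // /eqP uv.
    by apply: e; rewrite mem_filter uv.
  by split=> h b hb; apply/E/h.
Qed.

(** The number of alternations of quantifiers, a block of quantifiers of one
    kind counting once. *)
Fixpoint alternation (f : form) : nat :=
  match f with
  | FEq _ _ | FRel _ _ => 0
  | FNot g => alternation g
  | FAnd g h | FOr g h => maxn (alternation g) (alternation h)
  | FEx _ g => if g is FEx _ _ then alternation g else (alternation g).+1
  | FAll _ g => if g is FAll _ _ then alternation g else (alternation g).+1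
  end.

Lemma alternation0 f : quantifier_rank f = 0 -> alternation f = 0.
Proof.
elim: f => //= g IHg h IHh /eqP; rewrite -leqn0 geq_max !leqn0 => /andP[/eqP/IHg-> /eqP/IHh->] //.
Qed.

(** A [Sigma_(n+1)] formula that does not start with an existential quantifier
    is [Pi_n]; this second bound is what keeps the count constant when one more
    existential quantifier is put in front. *)
Lemma alternation_prenex n f :
  (Sigma_form n f ->
     alternation f <= n /\ (~ (exists v g, f = FEx v g) -> alternation f <= n.-1)) /\
  (Pi_form n f ->
     alternation f <= n /\ (~ (exists v g, f = FAll v g) -> alternation f <= n.-1)).
Proof.
elim: n f => [|n IH] f.
  by split=> h; inversion h; subst; rewrite alternation0.
have invS f0 : Sigma_form n.+1 f0 -> Pi_form n f0 \/
    exists v g, f0 = FEx v g /\ Sigma_form n.+1 g.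
  by move=> h; inversion h; subst; [left|right; do 2 eexists; split; first reflexivity].
have invP f0 : Pi_form n.+1 f0 -> Sigma_form n f0 \/
    exists v g, f0 = FAll v g /\ Pi_form n.+1 g.
  by move=> h; inversion h; subst; [left|right; do 2 eexists; split; first reflexivity].
split.
- elim: f => [u v|i vs|g _|g _ h _|g _ h _|v g IHg|v g _] /invS[/(proj2 (IH _))[le _]|[w [g' [e hg]]]] //;
    try by split=> //; apply: leqW.
  case: e hg => _ <- /IHg [le lt]; split; last by case; exists v, g.
  case: (pselect (exists v' h, g = FEx v' h)) => [[v' [h gE]]|/lt h].
    by rewrite gE in le *.
  by case: g {IHg le lt} h => // *; apply: leqW.
- elim: f => [u v|i vs|g _|g _ h _|g _ h _|v g _|v g IHg] /invP[/(proj1 (IH _))[le _]|[w [g' [e hg]]]] //;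
    try by split=> //; apply: leqW.
  case: e hg => _ <- /IHg [le lt]; split; last by case; exists v, g.
  case: (pselect (exists v' h, g = FAll v' h)) => [[v' [h gE]]|/lt h].
    by rewrite gE in le *.
  by case: g {IHg le lt} h => // *; apply: leqW.
Qed.

Lemma alternation_bool_comb n f : bool_comb (Sigma_form n) f -> alternation f <= n.
Proof.
elim=> [g /(proj1 (alternation_prenex n g))[]|//|g h _ /= IHg _ IHh|g h _ /= IHg _ IHh] //;
  by rewrite geq_max IHg.
Qed.

(** [q] selects the kind of a block of quantifiers: [true] stands for
    existential and [false] for universal. *)
Definition starts_block (q : bool) (f : form) : bool :=
  match f with FEx _ _ => q | FAll _ _ => ~~ q | _ => false end.

Fixpoint strip (q : bool) (f : form) : form :=
  match f with
  | FEx _ g => if q then strip q g else f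
  | FAll _ g => if q then f else strip q g
  | _ => f
  end.

Fixpoint block_vars (q : bool) (f : form) : seq var :=
  match f with
  | FEx v g => if q then v :: block_vars q g else [::]
  | FAll v g => if q then [::] else v :: block_vars q g
  | _ => [::]
  end.

Lemma alternation_strip q f :
  starts_block q f -> alternation f = (alternation (strip q f)).+1.
Proof.
elim: f => // v g IHg; case: q IHg => // IHg _;
  by case: g IHg => // w h IH; exact: IH isT.
Qed.

Lemma form_num_strip q f : form_num (strip q f) <= form_num f.
Proof.
have P := cpair_ge.
elim: f => // v g IHg; case: q IHg => //= IHg.
- by have := P 5 (cpair (var_num v) (form_num g)); have := P (var_num v) (form_num g); lia.
- by have := P 6 (cpair (var_num v) (form_num g)); have := P (var_num v) (form_num g); lia.
Qed.

Definition sgn (q : bool) (P : Prop) : Prop := if q then P else ~ P.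

(** A block of equal quantifiers amounts to one quantification over
    assignments; for universal blocks this is stated for the negations, so that
    in both cases something is searched for. *)
Lemma sat_strip R q f s :
  sgn q (sat (full_structure R) s f) <->
  exists s', (forall u, u \notin block_vars q f -> s' u = s u) /\
    sgn q (sat (full_structure R) s' (strip q f)).
Proof.
have triv P : P s <-> exists s' : var -> nat, (forall u, u \notin [::] -> s' u = s u) /\ P s'.
  split=> [h|[s' [e]]]; first by exists s.
  by have -> : s' = s by apply/funext => u; apply: e.
elim: f s triv => [u v|i vs|g _|g _ h _|g _ h _|v g IHg|v g IHg] s triv; try exact: triv.
- case: q IHg triv => IHg triv; last exact: triv.
  rewrite /=; split=> [[b _ /IHg[|s' [e hs]]]|[s' [e hs]]].
  + move=> P; split=> [h|[s' [e]]]; first by exists (upd s v b).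
    by have -> : s' = upd s v b by apply/funext => u; apply: e.
  + exists s'; split=> // u; rewrite inE negb_or => /andP[uv hu].
    by rewrite e // /upd (negbTE uv).
  + exists (s' v) => //; apply/IHg.
      move=> P; split=> [h|[s1 [e1]]]; first by exists (upd s v (s' v)).
      by have -> : s1 = upd s v (s' v) by apply/funext => u; apply: e1.
    exists s'; split=> // u hu; rewrite /upd; case: eqP => [->//|/eqP uv].
    by apply: e; rewrite inE negb_or uv.
- case: q IHg triv => IHg triv; first exact: triv.
  rewrite /=; split=> [/existsNP[b /not_implyP[_ /IHg[|s' [e hs]]]]|[s' [e hs]]].
  + move=> P; split=> [h|[s' [e]]]; first by exists (upd s v b).
    by have -> : s' = upd s v b by apply/funext => u; apply: e.
  + exists s'; split=> // u; rewrite inE negb_or => /andP[uv hu].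
    by rewrite e // /upd (negbTE uv).
  + apply/existsNP; exists (s' v); apply/not_implyP; split=> //; apply/IHg.
      move=> P; split=> [h|[s1 [e1]]]; first by exists (upd s v (s' v)).
      by have -> : s1 = upd s v (s' v) by apply/funext => u; apply: e1.
    exists s'; split=> // u hu; rewrite /upd; case: eqP => [->//|/eqP uv].
    by apply: e; rewrite inE negb_or uv.
Qed.

(** The assignment coded by [s]; any assignment agrees with a coded one on
    finitely many variables. *)
Definition dec_asg (s : nat) : var -> nat := fun v => nth 0 (unseq s) (var_num v).

Definition enc_asg (c : nat) (s : var -> nat) : nat :=
  seq_num (mkseq (fun u => s (unvar u)) c.+1).

Lemma enc_asgK c s v : var_num v <= c -> dec_asg (enc_asg c s) v = s v.
Proof. by move=> le; rewrite /dec_asg seq_numK nth_mkseq // var_numK. Qed.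

Lemma sat_enc_asg N c s f :
  form_num f <= c -> sat N (dec_asg (enc_asg c s)) f <-> sat N s f.
Proof.
move=> le; apply: sat_ext => v /free_var_le h.
by rewrite enc_asgK //; lia.
Qed.

Definition in_block (q : bool) (u : nat) (f : form) : bool := unvar u \in block_vars q f.

(** Agreement is tested only on variables with numbers up to [c], which include
    all variables of the formula with number [c]. *)
Definition block_agree (q : bool) (c s s' : nat) : bool :=
  ball c.+1 (fun u => in_block q u (unform c) ||
                      (nth 0 (unseq s') u == nth 0 (unseq s) u)).

Lemma sat_block R q f s :
  sgn q (sat (full_structure R) (dec_asg s) f) <->
  exists s', block_agree q (form_num f) s s' /\
    sgn q (sat (full_structure R) (dec_asg s') (strip q f)).
Proof.
have E g P Q : (P <-> Q) -> sgn g P -> sgn g Q by move=> [? ?]; case: g => /=; tauto.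
rewrite sat_strip; split=> [[s0 [e hs]]|[s' [/ballP e hs]]].
  exists (enc_asg (form_num f) s0); split; last first.
    apply: E hs; rewrite sat_enc_asg //; exact: form_num_strip.
  apply/ballP => u; rewrite ltnS => le; rewrite /in_block form_numK.
  case: (boolP (unvar u \in _)) => //= /e; rewrite /dec_asg unvarK => <-.
  by rewrite seq_numK nth_mkseq.
exists (fun v => if var_num v <= form_num f then dec_asg s' v else dec_asg s v).
split=> [u hu|].
  case: leqP => // le; have := e (var_num u); rewrite ltnS => /(_ le).
  by rewrite /in_block form_numK var_numK (negbTE hu) => /eqP.
apply: E hs; apply: sat_ext => v /free_var_le h.
by rewrite (leq_trans h (form_num_strip q f)).
Qed.

Lemma Rec_alternation A f : Rec A f -> Rec A (fun x => alternation (unform (f x))).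
Proof.
move=> hf; apply: (@Rec_form0 A alternation (fun c r1 r2 =>
  let t := cfst c in let k := cfst (csnd (csnd c)) in
  if t == 2 then r1
  else if (t == 3) || (t == 4) then (if r1 <= r2 then r2 else r1)
  else if t == 5 then (if k == 5 then r2 else r2.+1)
  else if t == 6 then (if k == 6 then r2 else r2.+1) else 0)) => //; last by rec_tac.
have M a b : maxn a b = if a <= b then b else a.
  by case: leqP.
have E5 (g : form) x y : (if g is FEx _ _ then x else y) =
    if cfst (form_num g) == 5 then x else y :> nat by case: g => *; rewrite /= cpairE.
have E6 (g : form) x y : (if g is FAll _ _ then x else y) =
    if cfst (form_num g) == 6 then x else y :> nat by case: g => *; rewrite /= cpairE.
by case=> [u v|i vs|g|g h|g h|v g|v g]; rewrite [form_num _]/= [alternation _]/= !cpairE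
  /= ?cpairE ?E5 ?E6.
Qed.

Lemma Rec_strip A q f : Rec A f -> Rec A (fun x => form_num (strip q (unform (f x)))).
Proof.
move=> hf; apply: (@Rec_form0 A (fun g => form_num (strip q g)) (fun c r1 r2 =>
  let t := cfst c in
  if (t == 5) && q || (t == 6) && ~~ q then r2 else c)) => //; last by rec_tac.
by case=> [u v|i vs|g|g h|g h|v g|v g]; rewrite [form_num _]/= /= ?cpairE //=; case: (q).
Qed.

Lemma Dec_in_block A q f g :
  Rec A f -> Rec A g -> Dec A (fun x => in_block q (f x) (unform (g x))).
Proof.
move=> hf hg; apply: (@Rec_form A (fun u g => in_block q u g) (fun a c r1 r2 =>
  let t := cfst c in
  ((t == 5) && q || (t == 6) && ~~ q) && ((a == cfst (csnd c)) || (r2 != 0)))) => //;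
  last by rec_tac.
by move=> a [u v|i vs|g0|g0 h|g0 h|v g0|v g0]; rewrite [form_num _]/= /= ?cpairE //=
  ?cpairE /in_block /=; case: (q) => //=; rewrite inE unvar_eq eqb0 negbK.
Qed.

Lemma Dec_block_agree A q c s s' :
  Rec A c -> Rec A s -> Rec A s' -> Dec A (fun x => block_agree q (c x) (s x) (s' x)).
Proof.
move=> hc hs hs'; rewrite /block_agree; rec_tac.
by apply: Dec_in_block; rec_tac.
Qed.

(** The bound on the alternations is part of the predicate, so that it satisfies
    recursion equations at every formula. *)
Definition sat_bounded (R : nat -> seq nat -> bool) (k s : nat) (f : form) : bool :=
  `[< alternation f <= k /\ sat (full_structure R) (dec_asg s) f >].

(** The Boolean connectives and the atomic formulas are evaluated by recursion
    on the formula; [W] is to be consulted at the quantifiers. *)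
Lemma Dec_sat_bounded_step A R k (W : bool -> nat -> nat -> bool) f g :
  Dec A (fun z => R (cfst z) (unseq (csnd z))) ->
  (forall q, Dec A (fun z => W q (cfst z) (csnd z))) ->
  (forall q s h, starts_block q h -> alternation h <= k ->
     W q s (form_num h) = `[< sgn q (sat (full_structure R) (dec_asg s) h) >]) ->
  Rec A f -> Rec A g -> Dec A (fun x => sat_bounded R k (f x) (unform (g x))).
Proof.
move=> hR hW W_spec hf hg.
have hWt := hW true; have hWf := hW false.
apply: (@Rec_form A (fun s g => sat_bounded R k s g) (fun s c r1 r2 =>
  let t := cfst c in let r := csnd c in
  let ok := alternation (unform c) <= k in
  if t == 0 then nth 0 (unseq s) (cfst r) == nth 0 (unseq s) (csnd r)
  else if t == 1 then
    R (cfst r) (unseq (seq_num [seq nth 0 (unseq s) v | v <- unseq (csnd r)]))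
  else if t == 2 then ok && (r1 == 0)
  else if t == 3 then (r1 != 0) && (r2 != 0)
  else if t == 4 then ok && ((r1 != 0) || (r2 != 0))
  else if t == 5 then ok && W true s c
  else ok && ~~ W false s c)) => //; last first.
  rec_tac.
  - by apply: (Rec_comp2 (F := fun i a => nat_of_bool (R i (unseq a))) hR); rec_tac.
  - by apply: Rec_alternation; rec_tac.
  - by apply: Rec_alternation; rec_tac.
  - by apply: Rec_alternation; rec_tac.
  - by apply: (Rec_comp2 (F := fun i a => nat_of_bool (W true i a)) hWt); rec_tac.
  - by apply: Rec_alternation; rec_tac.
  - by apply: (Rec_comp2 (F := fun i a => nat_of_bool (W false i a)) hWf); rec_tac.
move=> s h; cbv beta zeta; rewrite form_numK; congr nat_of_bool.
case: h => [u v|i vs|g0|g0 h|g0 h|v g0|v g0].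
- rewrite [form_num _]/= !cpairE /= ?cpairE; apply/asboolP/eqP => [[]//|e]; by split.
- rewrite [form_num _]/= !cpairE /= ?cpairE !seq_numK -map_comp.
  by apply/asboolP/idP => [[]|].
- rewrite [cfst _]cfstK /= eqb0; case: leqP => /= le; last by apply/asboolP => -[]; rewrite leqNgt le.
  rewrite /sat_bounded /= -asbool_neg; apply: asbool_equiv_eq.
  by split=> [[_ h] []//|h]; split=> // h'; apply: h.
- rewrite [cfst _]cfstK /= !eqb0 !negbK /sat_bounded -asbool_and; apply: asbool_equiv_eq.
  by rewrite /= geq_max; split=> [[/andP[? ?] [? ?]]|[[-> ?] [-> ?]]].
- rewrite [cfst _]cfstK /= !eqb0 !negbK; case: leqP => /= le;
    last by apply/asboolP => -[]; rewrite leqNgt le.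
  move: (le); rewrite geq_max => /andP[le1 le2].
  rewrite /sat_bounded -asbool_or; apply: asbool_equiv_eq => /=.
  by rewrite le le1 le2; split=> [[_ []]|[[_ h']|[_ h']]]; auto.
- rewrite [cfst _]cfstK [_ == 5]/= [_ == 2]/= [_ == 3]/= [_ == 4]/= [_ == 1]/= [_ == 0]/=.
  case: (leqP (alternation _)) => /= le; last by apply/asboolP => -[]; rewrite leqNgt le.
  rewrite -[cpair 5 _]/(form_num (FEx v g0)) (W_spec true) //.
  by apply: asbool_equiv_eq; split=> [[]|].
- rewrite [cfst _]cfstK [_ == 5]/= [_ == 2]/= [_ == 3]/= [_ == 4]/= [_ == 1]/= [_ == 0]/=.
  case: (leqP (alternation _)) => /= le; last by apply/asboolP => -[]; rewrite leqNgt le.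
  rewrite -[cpair 6 _]/(form_num (FAll v g0)) (W_spec false) // asbool_neg negbK.
  by apply: asbool_equiv_eq; split=> [[]|].
Qed.

(** A formula with [k + 1] alternations starting with an existential block
    holds if some values of the variables of the block satisfy the remaining
    formula, which has at most [k] alternations; this is one jump. *)
Lemma Dec_sat_bounded R k f g :
  Dec set0 (fun z => R (cfst z) (unseq (csnd z))) ->
  Rec (zero_jump k) f -> Rec (zero_jump k) g ->
  Dec (zero_jump k) (fun x => sat_bounded R k (f x) (unform (g x))).
Proof.
move=> hR; elim: k f g => [|k IH] f g.
  apply: (@Dec_sat_bounded_step _ _ _ (fun _ _ _ => false)) => //.
    by move=> q; exact: Rec_const.
  by move=> q s h /alternation_strip ->.
pose W q s c := `[< exists s', block_agree q c s s' &&
  (sat_bounded R k s' (unform (form_num (strip q (unform c)))) == q) >].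
apply: (@Dec_sat_bounded_step _ _ _ W); first exact: Rec_set0.
  move=> q; rewrite /W; apply: Dec_jump_ce; apply/ce_ex/ce_dec; rec_tac.
    by apply: Dec_block_agree; rec_tac.
  case: q; first apply: (@Dec_ext _ (fun z => sat_bounded R k (csnd z)
       (unform (form_num (strip true (unform (csnd (cfst z)))))))) => [z|].
  - by rewrite eqb_id.
  - by apply: IH; rec_tac; apply: Rec_strip; rec_tac.
  apply: (@Dec_ext _ (fun z => ~~ sat_bounded R k (csnd z)
       (unform (form_num (strip false (unform (csnd (cfst z)))))))) => [z|].
    by rewrite eqbF_neg.
  by apply: Dec_neg; apply: IH; rec_tac; apply: Rec_strip; rec_tac.
move=> q s h /alternation_strip ->; rewrite ltnS => le.
apply: asbool_equiv_eq; rewrite sat_block form_numK form_numK.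
have E s' : (sat_bounded R k s' (strip q h) == q) <->
    sgn q (sat (full_structure R) (dec_asg s') (strip q h)).
  rewrite /sat_bounded; case: asboolP => [[_ h']|h'].
    by case: (q) h' => h'; split=> // /(_ h').
  have {}h' : ~ sat (full_structure R) (dec_asg s') (strip q h).
    by move=> h1; apply: h'.
  by case: (q) h' => h'; split=> // /h'.
by split=> -[s']; [move=> /andP[? /E ?]|move=> [h1 /E h2]]; exists s'; rewrite ?h1.
Qed.

(** * Upper bounds for algebraic and definable closure *)

(** What the evaluation of formulas uses about a language and a structure; the
    relations of [N] are [R 0] and [R 1]. *)
Record models (n : nat) (R : nat -> seq nat -> bool) (L : language) (N : structure) : Prop :=
  Models {
    models_wf : forall f, wf_form L f <-> wfb n f;
    models_univ : univ N = setT;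
    models_sort : in_sort N 0 = setT;
    models_rel : forall i a, i < 2 -> in_rel N i a <-> R i a }.

Lemma pform_num_inj : injective pform_num.
Proof.
move=> [f l r] [f' l' r'] /cpair_inj[/(can_inj form_numK)/= -> /cpair_inj[]].
by do 2! move=> /seq_num_inj/(inj_map var_num_inj)/= ->.
Qed.

Lemma CL_num_inj : injective CL_num.
Proof. by move=> [f a] [f' a'] /cpair_inj[/pform_num_inj/= -> /seq_num_inj/= ->]. Qed.

Lemma inj_image (aT : Type) (g : aT -> nat) (X : set aT) x :
  injective g -> (g @` X) (g x) <-> X x.
Proof. by move=> gI; split=> [[y hy /gI<-]|hx] //; exists x. Qed.

(** The components of a number [z] of the form [CL_num (f, a)]. *)
Definition zform (z : nat) : nat := cfst (cfst z).
Definition zleft (z : nat) : nat := cfst (csnd (cfst z)).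
Definition zright (z : nat) : nat := csnd (csnd (cfst z)).
Definition zargs (z : nat) : nat := csnd z.

Definition zpair (z : nat) : pform * seq nat :=
  (PForm (unform (zform z)) (unvars (zleft z)) (unvars (zright z)), unseq (zargs z)).

Definition zvars (z : nat) : nat := seq_num (unseq (zleft z) ++ unseq (zright z)).

(** The conditions on a pair in ACL or DCL that do not concern the number of
    solutions, and that [z] is a number of a pair at all ([zvalidP]). *)
Definition zvalid (n z : nat) : bool :=
  [&& form_norm (zform z) == zform z, wfb n (unform (zform z)),
      uniq (unseq (zvars z)),
      all (fun u => occurs u (unform (zform z))) (unseq (zvars z)),
      ball (zform z).+1 (fun u => occurs u (unform (zform z)) ==> (u \in unseq (zvars z))),
      bool_combb n (unform (zform z)) &
      size (unseq (zargs z)) == size (unseq (zleft z))].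

Lemma Dec_zvalid A n : Dec A (zvalid n).
Proof.
rewrite /zvalid /zvars /zform /zleft /zright /zargs; rec_tac.
- by apply: Rec_form_norm; rec_tac.
- by apply: Dec_wfb; rec_tac.
- by apply: Dec_occurs; rec_tac.
- by apply: Dec_occurs; rec_tac.
- by apply: Dec_bool_combb; rec_tac.
Qed.

Lemma wfb_free_var n f v : wfb n f -> v \in free_vars f -> v.1 = 0.
Proof.
elim: f => [u w|i vs|g IHg|g IHg h IHh|g IHg h IHh|w g IHg|w g IHg] //=.
- by move=> /andP[/eqP e /eqP e']; rewrite !inE => /orP[]/eqP->.
- move=> /andP[_ /eqP e] hv; have : v.1 \in [seq v.1 | v <- vs] by apply: map_f.
  by rewrite e; move=> /nseqP[].
- by rewrite mem_cat => /andP[/IHg h1 /IHh h2] /orP[].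
- by rewrite mem_cat => /andP[/IHg h1 /IHh h2] /orP[].
- by rewrite mem_filter => /andP[_ /IHg h1] /andP[].
- by rewrite mem_filter => /andP[_ /IHg h1] /andP[].
Qed.

Lemma has_type0 N js a :
  in_sort N 0 = setT -> (forall j, j \in js -> j = 0) ->
  has_type N js a <-> size a = size js.
Proof.
move=> hS; elim: js a => [|j js IH] [|b a] //= h.
rewrite IH => [|k hk]; last by apply: h; rewrite inE hk orbT.
rewrite (h j) ?inE ?eqxx // hS; split=> [[_ ->]|[]] //.
Qed.

Section ClosureBounds.
Variables (n : nat) (R : nat -> seq nat -> bool) (L : language) (N : structure).
Hypothesis hN : models n R L N.

Lemma pform_sorts f : is_pform L f ->
  (forall j, j \in left_type f -> j = 0) /\ (forall j, j \in right_type f -> j = 0).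
Proof.
move=> [/(models_wf hN) wf _ e]; split=> j /mapP[v hv ->];
  by apply: (wfb_free_var wf); rewrite -e mem_cat hv ?orbT.
Qed.

Lemma zvalidP z :
  zvalid n z <->
  [/\ CL_num (zpair z) = z, is_pform L (zpair z).1,
      bool_comb (Sigma_form n) (body (zpair z).1) &
      has_type N (left_type (zpair z).1) (zpair z).2].
Proof.
have zv : [seq unvar u | u <- unseq (zvars z)] =
    left_vars (zpair z).1 ++ right_vars (zpair z).1.
  by rewrite /zvars seq_numK map_cat.
have numE : CL_num (zpair z) = cpair (cpair (form_norm (zform z))
    (cpair (zleft z) (zright z))) (zargs z).
  by rewrite /CL_num /pform_num /= !var_num_unvars unseqK.
have zE : z = cpair (cpair (zform z) (cpair (zleft z) (zright z))) (zargs z).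
  by rewrite !cpairK.
have left0 : is_pform L (zpair z).1 ->
    has_type N (left_type (zpair z).1) (zpair z).2 <->
    size (unseq (zargs z)) = size (unseq (zleft z)).
  move=> /pform_sorts[h0 _]; rewrite (has_type0 _ (models_sort hN) h0).
  by rewrite /left_type size_map /= /unvars size_map.
split.
  case/and5P=> /eqP e1 wf un /allP oc /and3P[/ballP bl /bool_combP bc /eqP sz].
  have pf : is_pform L (zpair z).1.
    split; first exact/(models_wf hN).
      by rewrite -zv map_inj_uniq //; apply: can_inj unvarK.
    rewrite -zv => v; apply/mapP/idP => [[u /oc + ->] //|hv].
    exists (var_num v); rewrite ?var_numK //; have := free_var_le hv.
    rewrite /= -/(form_norm _) e1 -ltnS => /bl /implyP; apply.
    by rewrite /occurs var_numK.
  by split=> //; [rewrite numE e1 -zE | apply/left0].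
case=> e [/(models_wf hN) wf un oc] bc ht.
have pf : is_pform L (zpair z).1 by split=> //; apply/(models_wf hN).
have e1 : form_norm (zform z) = zform z.
  by move: e; rewrite numE => /(congr1 (fun z => cfst (cfst z))); rewrite !cpairE.
apply/and5P; split=> //; first exact/eqP.
- by move: un; rewrite -zv map_inj_uniq //; apply: can_inj unvarK.
- apply/allP => u hu; rewrite /occurs -oc -zv; exact: map_f.
- apply/and3P; split; [|exact/bool_combP|by apply/eqP/left0].
  apply/ballP => u _; apply/implyP; rewrite /occurs -oc -zv.
  by rewrite mem_map //; apply: can_inj unvarK.
Qed.

(** Assignments [s] represent solutions: the left variables must have the
    prescribed values, and the solution is read off at the right variables. *)
Definition zsol (z s : nat) : bool :=
  (seq_num [seq nth 0 (unseq s) v | v <- unseq (zleft z)] == zargs z) &&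
  sat_bounded R n s (unform (zform z)).

Definition zval (z s : nat) : nat :=
  seq_num [seq nth 0 (unseq s) v | v <- unseq (zright z)].

Lemma assign_map vs (g : var -> nat) v : v \in vs -> assign vs [seq g u | u <- vs] v = g v.
Proof. by move=> hv; rewrite /assign (nth_map v) ?nth_index // index_mem. Qed.

Lemma map_assign vs bs :
  uniq vs -> size bs = size vs -> [seq assign vs bs v | v <- vs] = bs.
Proof.
move=> un sz; apply: (@eq_from_nth _ 0); rewrite size_map // => i lt.
by rewrite (nth_map (0, 0)) // /assign index_uniq.
Qed.

(** Lets one quantify over assignments instead of tuples, so that [assign] need
    not be computed on numbers. *)
Lemma solutions_zsol z b :
  zvalid n z ->
  solutions N (zpair z).1 (zpair z).2 b <->
  exists2 s, zsol z s & zval z s = seq_num b.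
Proof.
move=> /zvalidP[e pf bc ht]; have [wf un oc] := pf.
have [left0 right0] := pform_sorts pf.
have szl : size (zpair z).2 = size (left_vars (zpair z).1).
  by move: ht; rewrite (has_type0 _ (models_sort hN) left0) size_map.
have alt := alternation_bool_comb bc.
have satE s : sat N s (body (zpair z).1) <->
    sat (full_structure R) s (body (zpair z).1).
  apply: sat_full; [exact: models_sort hN|exact: models_rel hN|].
  exact/(models_wf hN).
have decE c s : [seq nth 0 (unseq s) v | v <- unseq c] = [seq dec_asg s v | v <- unvars c].
  by rewrite /unvars -map_comp; apply: eq_map => v; rewrite /dec_asg /= unvarK.
have solE s : zsol z s <-> [seq dec_asg s v | v <- left_vars (zpair z).1] = (zpair z).2 /\
    sat N (dec_asg s) (body (zpair z).1).
  rewrite /zsol decE satE; split=> [/andP[/eqP h /asboolP[]]|[h1 h2]].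
    by move=> _ h2; split=> //; rewrite /= -h seq_numK.
  by apply/andP; split; [rewrite h1 unseqK|apply/asboolP].
rewrite /zval; split=> [[tb hb]|[s /solE[h1 h2]]]; last first.
  rewrite decE => /seq_num_inj <-; split.
    by apply/(has_type0 _ (models_sort hN) right0); rewrite !size_map.
  move: h2; rewrite -h1 -map_cat; apply: (proj1 (sat_ext _ _)) => v hv.
  by rewrite assign_map // oc.
set asg := assign _ _ in hb.
have szb : size b = size (right_vars (zpair z).1).
  by move: tb; rewrite (has_type0 _ (models_sort hN) right0) size_map.
have vals := map_assign un (bs := (zpair z).2 ++ b).
rewrite !size_cat szl szb -/asg map_cat in vals.
have := vals erefl => /eqP; rewrite eqseq_cat; last by rewrite [LHS]size_map szl.
move=> /andP[/eqP v1 /eqP v2].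
have encE v : v \in left_vars (zpair z).1 ++ right_vars (zpair z).1 ->
    dec_asg (enc_asg (form_num (body (zpair z).1)) asg) v = asg v.
  by rewrite oc => /free_var_le; apply: enc_asgK.
exists (enc_asg (form_num (body (zpair z).1)) asg).
  apply/solE; split; last by rewrite sat_enc_asg.
  rewrite -[RHS]v1; apply/eq_in_map => v hv; apply: encE.
  by rewrite mem_cat hv.
rewrite decE; congr seq_num; rewrite -[RHS]v2; apply/eq_in_map => v hv; apply: encE.
by rewrite mem_cat hv orbT.
Qed.

Hypothesis hR : Dec set0 (fun z => R (cfst z) (unseq (csnd z))).

Lemma Dec_zsol f g :
  Rec (zero_jump n) f -> Rec (zero_jump n) g ->
  Dec (zero_jump n) (fun x => zsol (f x) (g x)).
Proof.
move=> hf hg; rewrite /zsol /zleft /zargs /zform; rec_tac.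
by apply: Dec_sat_bounded => //; rec_tac.
Qed.

Lemma Rec_zval A f g : Rec A f -> Rec A g -> Rec A (fun x => zval (f x) (g x)).
Proof. by move=> hf hg; rewrite /zval /zright; rec_tac. Qed.

Fixpoint bounded_seqs (k m : nat) : seq (seq nat) :=
  if k is k'.+1 then [seq x :: s | x <- iota 0 m.+1, s <- bounded_seqs k' m]
  else [:: [::]].

Lemma mem_bounded_seqs m s : all (fun x => x <= m) s -> s \in bounded_seqs (size s) m.
Proof.
elim: s => [|x s IH] // /andP[hx /IH hs].
by apply/allpairsP; exists (x, s); split; rewrite ?mem_iota.
Qed.

(** The length being fixed, only finitely many tuples have bounded entries. *)
Lemma finite_seqs_bounded (X : set (seq nat)) k :
  (forall b, X b -> size b = k) ->
  finite_set X <-> exists m, forall b, X b -> all (fun x => x <= m) b.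
Proof.
move=> sz; split=> [/finite_seqP[r ->]|[m h]].
  exists (\max_(x <- flatten r) x) => b /= hb; apply/allP => x hx.
  by apply: leq_bigmax_seq => //; apply/flattenP; exists b.
apply: (@sub_finite_set _ _ [set` bounded_seqs k m]); last exact: finite_seq.
by move=> b /[dup] /sz <- /h; apply: mem_bounded_seqs.
Qed.

Lemma CL_num_image (C : set (pform * seq nat)) (P : nat -> Prop) :
  (forall p, C p -> [/\ is_pform L p.1, bool_comb (Sigma_form n) (body p.1) &
                        has_type N (left_type p.1) p.2]) ->
  (forall z, zvalid n z -> C (zpair z) <-> P z) ->
  forall z, (CL_num @` C) z <-> zvalid n z /\ P z.
Proof.
move=> hC hP z; split=> [[p hp <-]|[hz /(hP _ hz) h]]; last first.
  by exists (zpair z) => //; have /zvalidP[] := hz.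
suff e : zpair (CL_num p) = p.
  have v : zvalid n (CL_num p) by apply/zvalidP; rewrite e; have [] := hC _ hp.
  by split=> //; apply/hP; rewrite ?e.
case: p {hp} => [[f l r] a]; rewrite /zpair /zform /zleft /zright /zargs /CL_num /pform_num /=.
by rewrite !cpairE form_numK !unvarsK seq_numK.
Qed.
Lemma finite_solutions z :
  zvalid n z ->
  finite_set (solutions N (zpair z).1 (zpair z).2) <->
  exists m, forall s, zsol z s -> all (fun x => x <= m) (unseq (zval z s)).
Proof.
move=> hz; have E := solutions_zsol _ hz.
rewrite (@finite_seqs_bounded _ (size (right_type (zpair z).1))); last first.
  have /zvalidP[_ pf _ _] := hz; have [_ right0] := pform_sorts pf.
  by move=> b [/(has_type0 _ (models_sort hN) right0)].
split=> [[m h]|[m h]].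
  by exists m => s hs; apply: h; apply/E; exists s; rewrite ?unseqK.
by exists m => b /E[s hs e]; rewrite -[b]seq_numK -e; apply: h.
Qed.

Lemma singleton_solutions z :
  zvalid n z ->
  (exists b, solutions N (zpair z).1 (zpair z).2 = [set b]) <->
  (exists s, zsol z s) /\
  ~ (exists s s', [&& zsol z s, zsol z s' & zval z s != zval z s']).
Proof.
move=> hz; have E := solutions_zsol _ hz; split=> [[b hb]|[[s hs] uni]].
  have e s : zsol z s -> zval z s = seq_num b.
    move=> hs; have : solutions N (zpair z).1 (zpair z).2 (unseq (zval z s)).
      by apply/E; exists s; rewrite ?unseqK.
    by rewrite hb => /= <-; rewrite unseqK.
  have /E[s hs _] : solutions N (zpair z).1 (zpair z).2 b by rewrite hb.
  split; first by exists s.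
  by move=> [s1 [s2 /and3P[/e-> /e-> /eqP]]].
exists (unseq (zval z s)); apply/funext => b; apply/propext; rewrite E /=; split=> [[s' hs' e]|->].
  rewrite -[b]seq_numK -e; congr unseq; apply/eqP/negPn/negP => h.
  by apply: uni; exists s', s; rewrite hs hs'.
by exists s; rewrite ?unseqK.
Qed.

(** Guess a bound on the entries of the solutions; whether some solution exceeds
    it is a question to the next jump. *)
Lemma ce_finite_solutions :
  ce (zero_jump n.+1)
    (CL_num @` [set p | [/\ is_pform L p.1, bool_comb (Sigma_form n) (body p.1),
       has_type N (left_type p.1) p.2 & finite_set (solutions N p.1 p.2)]]).
Proof.
apply: (@ce_ext _ (fun z => zvalid n z /\ exists m,
    ~~ `[< exists s, zsol z s && ~~ all (fun x => x <= m) (unseq (zval z s)) >])).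
  move=> z; rewrite (@CL_num_image _ (fun z => exists m, ~~ `[< exists s,
      zsol z s && ~~ all (fun x => x <= m) (unseq (zval z s)) >])) //.
    by move=> p [].
  move=> y hy; have /zvalidP[_ ? ? ?] := hy; split=> [[_ _ _]|[m hm]].
    move=> /(finite_solutions hy)[m hm]; exists m; apply/asboolP => -[s /andP[/hm-> //]].
  split=> //; apply/(finite_solutions hy); exists m => s hs.
  by apply: contraNT hm => h; apply/asboolP; exists s; rewrite hs.
apply: ce_and; first exact/ce_dec/Dec_zvalid.
apply/ce_ex/ce_dec/Dec_neg/(@Dec_jump_ce (zero_jump n)).
apply/ce_ex/ce_dec; rec_tac; first by apply: Dec_zsol; rec_tac.
by apply: Rec_zval; rec_tac.
Qed.

(** That a solution exists and that two different ones exist are each one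
    question to the jump. *)
Lemma Dec_singleton_solutions :
  Dec (zero_jump n.+1)
    (fun z => `[< (CL_num @` [set p | [/\ is_pform L p.1,
       bool_comb (Sigma_form n) (body p.1), has_type N (left_type p.1) p.2 &
       exists b, solutions N p.1 p.2 = [set b]]]) z >]).
Proof.
apply: (@Dec_ext _ (fun z => zvalid n z && (`[< exists s, zsol z s >] &&
  ~~ `[< exists s s', [&& zsol z s, zsol z s' & zval z s != zval z s'] >]))).
  move=> z; apply/idP/asboolP; rewrite (@CL_num_image _ (fun z => (exists s, zsol z s) /\
      ~ (exists s s', [&& zsol z s, zsol z s' & zval z s != zval z s']))) //.
  - by move=> /and3P[h /asboolP h1 /asboolP h2].
  - by move=> p [].
  - move=> y hy; have /zvalidP[_ ? ? ?] := hy; split=> [[_ _ _]|].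
      exact: (proj1 (singleton_solutions hy)).
    by move=> /(singleton_solutions hy).
  - by move=> [-> [/asboolP -> h]] /=; apply/asboolP.
  - by move=> p [].
  - move=> y hy; have /zvalidP[_ ? ? ?] := hy; split=> [[_ _ _]|].
      exact: (proj1 (singleton_solutions hy)).
    by move=> /(singleton_solutions hy).
apply: Dec_and; first exact: Dec_zvalid.
apply: Dec_and; [|apply: Dec_neg]; apply: (@Dec_jump_ce (zero_jump n)).
  by apply/ce_ex/ce_dec; apply: Dec_zsol; rec_tac.
apply/ce_ex/ce_ex/ce_dec; rec_tac.
- by apply: Dec_zsol; rec_tac.
- by apply: Dec_zsol; rec_tac.
- by apply: Rec_zval; rec_tac.
- by apply: Rec_zval; rec_tac.
Qed.
End ClosureBounds.

(** * Structures expressing two given sets *)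

Lemma run_phi e x y : phi set0 e x y -> run e x = y.
Proof. by move=> h; apply: xget_unique => // z /phi_det; apply. Qed.

Lemma wf_formP n L f :
  num_sorts L = Some 1 -> num_rels L = Some 2 ->
  (forall i, i < 2 -> rel_type L i = rel_sorts n) ->
  wf_form L f <-> wfb n f.
Proof.
move=> hS hI hT; have sort0 j : initseg (num_sorts L) j <-> j == 0.
  by rewrite hS /initseg /=; case: j.
elim: f => [u v|i vs|g IHg|g IHg h IHh|g IHg h IHh|v g IHg|v g IHg] /=.
- rewrite sort0; split=> [[<- ->]|/andP[/eqP-> /eqP->]] //.
- rewrite hI /initseg /=; split=> [[lt ->]|/andP[lt /eqP->]]; last by rewrite hT.
  by rewrite lt hT ?eqxx.
- exact: IHg.
- by rewrite IHg IHh; split=> [[-> ->]|/andP[]].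
- by rewrite IHg IHh; split=> [[-> ->]|/andP[]].
- by rewrite IHg sort0; split=> [[-> ->]|/andP[]].
- by rewrite IHg sort0; split=> [[-> ->]|/andP[]].
Qed.

Definition rel2 (n : nat) (C : nat -> seq nat -> bool) (i : nat) (a : seq nat) : bool :=
  [&& i <= 1, size a == n.+2 & C i a].

Lemma Dec_rel2 A n C :
  Dec A (fun z => C (cfst z) (unseq (csnd z))) ->
  Dec A (fun z => rel2 n C (cfst z) (unseq (csnd z))).
Proof. by move=> hC; rewrite /rel2; rec_tac. Qed.

Lemma index_Rec f : Rec set0 f -> exists e, forall x y, phi set0 e x y <-> y = f x.
Proof.
move=> [p hp]; exists (prog_num p) => x y; rewrite phiE.
by split=> [h|->] //; apply: eval_det h (hp x).
Qed.

Lemma exists_structure n C :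
  Dec set0 (fun z => C (cfst z) (unseq (csnd z))) ->
  exists c, CompStr c /\ models n (rel2 n C) (Lang c) (Mod c).
Proof.
move=> hC.
have [e he] := index_Rec (Rec_const set0 (seq_num (rel_sorts n))).
have [u hu] := index_Rec (Rec_const set0 1).
have [v hv] : exists v, forall x y, phi set0 v x y <-> y = (csnd x == 0).
  by apply: index_Rec; rec_tac.
have [w hw] : exists w, forall x y, phi set0 w x y <-> y = rel2 n C (csnd x) (unseq (cfst x)).
  apply: index_Rec.
  apply: (Rec_comp2 (F := fun i a => nat_of_bool (rel2 n C i (unseq a)))); rec_tac.
  exact: Dec_rel2.
(* In the code of a language, a finite number of sorts or of relation symbols
   is shifted by one: [2] and [3] stand for one sort and two symbols. *)
pose l := cpair 2 (cpair 3 e); pose s := cpair u (cpair v w).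
have [c hc] : exists c, forall x y, phi set0 c x y <-> y = if x == 0 then l else s.
  by apply: index_Rec; rec_tac.
have r0 : run c 0 = l by apply/run_phi/hc.
have r1 : run c 1 = s by apply/run_phi/hc.
have sortsE : num_sorts (Lang c) = Some 1 by rewrite /Lang r0 /= /l cfstK.
have relsE : num_rels (Lang c) = Some 2 by rewrite /Lang r0 /= /l csndK cfstK.
have typeE i : rel_type (Lang c) i = rel_sorts n.
  rewrite /Lang r0 /= /l !csndK; apply: xget_unique => /=; first exact/he.
  by move=> js /he /seq_num_inj.
have univE : univ (Mod c) = setT.
  by rewrite /Mod r1 /= /s cfstK; apply/funext => a; apply/propext; split=> // _; apply/hu.
have sortE j : in_sort (Mod c) j = [set a | j = 0].
  rewrite /Mod r1 /= /s csndK cfstK; apply/funext => a; apply/propext => /=.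
  rewrite hv csndK; split=> [|-> //].
  by case: eqP.
have relE i a : in_rel (Mod c) i a <-> rel2 n C i a.
  rewrite /Mod r1 /= /s !csndK hw !cpairE seq_numK.
  by case: (rel2 _ _ _ _).
exists c; split; last first.
  split=> //; first by move=> f; apply: wf_formP => // i _; exact: typeE.
  by rewrite sortE; apply/funext => a; apply/propext.
split; [by exists l; apply/hc | by exists s; apply/hc | |].
  rewrite r0; split; last first.
    by move=> i _; exists (seq_num (rel_sorts n)); rewrite /l !csndK; apply/he.
  rewrite -r0 -/(Lang c) => i _ j; rewrite typeE sortsE => /mem_rel_sorts -> //.
rewrite r1; split; rewrite /s ?csndK ?cfstK.
- by move=> x; right; apply/hu.
- by move=> x; case: (csnd x == 0) (hv x) => h; [right|left]; apply/h.
- by move=> x; case: (rel2 _ _ _ _) (hw x) => h; [right|left]; apply/h.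
rewrite -/s -r1 -/(Mod c); split.
- by move=> j b; rewrite sortE univE sortsE => ->.
- by move=> b _; exists 0; rewrite sortE.
- by move=> j k b; rewrite !sortE => -> ->.
- move=> i a /relE /and3P[lt /eqP sz _]; rewrite relsE typeE; split=> //.
  apply/has_type0; rewrite ?sortE.
  + by apply/funext => b; apply/propext.
  + by move=> j /mem_rel_sorts.
  + by rewrite size_rel_sorts.
Qed.

(** Alternating quantifiers are written as existential quantifiers and negations,
    following the definition of [arith_Sigma]. *)
Fixpoint alt_ex (k : nat) (C : nat -> bool) (x : nat) : Prop :=
  if k is k'.+1 then exists y, ~ alt_ex k' C (cpair x y) else C x.

Lemma arith_Sigma_alt_ex k P :
  arith_Sigma k P -> exists2 C, Dec set0 C & forall x, P x <-> alt_ex k C x.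
Proof.
elim: k P => [|k IH] P.
  move=> /computable_setP hP; exists (fun x => `[< P x >]) => // x.
  by split=> /asboolP.
move=> [B /IH[C hC h] ->]; exists C => // x /=.
split=> -[y hy]; exists y; first by move=> /h.
by apply: contrapT => /h.
Qed.

Definition rel_vars (n : nat) : seq var := [seq (0, k) | k <- iota 0 n.+2].

(** The prenex formula with [k] alternating quantifiers in front of the
    relation symbol [i] or, when the last quantifier is universal, of its
    negation; the variables with indices below [n + 2 - k] are left free. *)
Fixpoint alt_form (n i k : nat) (q : bool) : form :=
  if k is k'.+1 then
    if q then FEx (0, n.+2 - k) (alt_form n i k' false)
    else FAll (0, n.+2 - k) (alt_form n i k' true)
  else if q then FRel i (rel_vars n) else FNot (FRel i (rel_vars n)).

(** The relation is evaluated on the values of the variables, packed from the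
    left; the quantified variables come last, in order of quantification. *)
Lemma sat_alt_form N n i (C : nat -> bool) k q s :
  in_sort N 0 = setT ->
  (forall a, size a = n.+2 -> in_rel N i a <-> C (foldl cpair (head 0 a) (behead a))) ->
  k <= n.+1 ->
  sat N s (alt_form n i k q) <->
  sgn q (alt_ex k C (foldl cpair (s (0, 0)) [seq s (0, j) | j <- iota 1 (n.+1 - k)])).
Proof.
move=> hS hR; elim: k q s => [|k IH] q s le.
  have e : in_rel N i [seq s v | v <- rel_vars n] <->
      C (foldl cpair (s (0, 0)) [seq s (0, j) | j <- iota 1 (n.+1 - 0)]).
    by rewrite hR ?size_map ?size_iota // subn0 /rel_vars -map_comp.
  by case: q => /=; rewrite e.
set m := n.+1 - k.+1; have m1 : n.+2 - k.+1 = m.+1 by rewrite /m; lia.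
have m2 : iota 1 (n.+1 - k) = iota 1 m ++ [:: m.+1].
  have -> : n.+1 - k = m + 1 by rewrite /m; lia.
  by rewrite iotaD add1n.
have E q' y : sat N (upd s (0, m.+1) y) (alt_form n i k q') <->
    sgn q' (alt_ex k C (cpair (foldl cpair (s (0, 0)) [seq s (0, j) | j <- iota 1 m]) y)).
  rewrite (IH _ _ (ltnW le)) m2 map_cat foldl_cat /=.
  have -> : upd s (0, m.+1) y (0, m.+1) = y by rewrite /upd eqxx.
  have -> // : [seq upd s (0, m.+1) y (0, j) | j <- iota 1 m] = [seq s (0, j) | j <- iota 1 m].
  by apply/eq_in_map => j; rewrite mem_iota /upd => lt; case: eqP => // -[]; lia.
case: q; rewrite [alt_form _ _ _ _]/= m1 [sat _ _ _]/= hS.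
  by split=> -[y]; [move=> _ /E h|move=> h]; exists y => //; apply/E.
split=> [h [y hy]|h y _]; first by have /E := h y Logic.I.
by apply/E; apply: contrapT => h'; apply: h; exists y.
Qed.

Lemma free_vars_alt_form n i k q :
  k <= n.+1 -> free_vars (alt_form n i k q) =i [seq (0, j) | j <- iota 0 (n.+2 - k)].
Proof.
elim: k q => [|k IH] q le; first by case: q.
have m1 : n.+2 - k = (n.+2 - k.+1).+1 by lia.
move=> v; case: q; rewrite [free_vars _]/= mem_filter (IH _ (ltnW le)) m1
  -[in iota 0 _.+1]addn1 iotaD map_cat mem_cat /= inE add0n;
  case: eqP => [->|]; rewrite ?orbF //=; apply/esym/negP => /mapP[j];
  rewrite mem_iota => /andP[_ lt] []; lia.
Qed.

Lemma wfb_alt_form n i k q : i <= 1 -> wfb n (alt_form n i k q).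
Proof.
move=> i1; have h : wfb n (FRel i (rel_vars n)).
  rewrite /wfb ltnS i1 /rel_vars -map_comp; apply/eqP.
  by apply: map_rel_sorts; rewrite ?size_iota.
by elim: k q => [|k IH] [] //; exact: IH.
Qed.

Lemma quantifier_rank_alt_form n i k q : quantifier_rank (alt_form n i k q) = k.
Proof. by elim: k q => [|k IH] [] //=; rewrite IH. Qed.

Lemma Sigma_alt_form n i k :
  Sigma_form k (alt_form n i k true) /\ Pi_form k (alt_form n i k false).
Proof.
elim: k => [|k [IH1 IH2]]; first by split; constructor.
by split; do 2 constructor.
Qed.

Definition v0 : var := (0, 0).
Definition v1 : var := (0, 1).

Definition form01 (f : form) : pform := PForm f [:: v0] [:: v1].

Section Form01.
Variables (n : nat) (R : nat -> seq nat -> bool) (L : language) (N : structure).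
Hypothesis hN : models n R L N.

Lemma is_pform01 f : wfb n f -> free_vars f =i [:: v0; v1] -> is_pform L (form01 f).
Proof. by move=> wf fv; split=> //; exact/(models_wf hN). Qed.

Lemma left_type01 f a :
  has_type N (left_type (form01 f)) a <-> exists x, a = [:: x].
Proof.
rewrite (has_type0 _ (models_sort hN)) => [|j]; last by rewrite inE => /eqP.
by split=> [|[x ->] //]; case: a => [|x [|y a]] //; exists x.
Qed.

Lemma solutions01 f (E : nat -> nat -> Prop) x :
  (forall s, sat N s f <-> E (s v0) (s v1)) ->
  solutions N (form01 f) [:: x] = [set b | exists2 y, b = [:: y] & E x y].
Proof.
move=> h; apply/funext => b; apply/propext; rewrite /solutions /= (models_sort hN).
case: b => [|y [|z b]]; split=> //=; try by [case|case=> [[_ []]]|case=> [[]]].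
- by move=> [_ /h]; exists y.
- by move=> [_ [<-] ?]; split=> //; apply/h.
Qed.
End Form01.

(** The relations of the structure are the computable matrices of the two
    sets, from which the quantifiers are restored by formulas. *)
Lemma exists_structure2 n P Q :
  arith_Sigma n P -> arith_Sigma n Q ->
  exists c R,
    [/\ CompStr c, models n R (Lang c) (Mod c),
        Dec set0 (fun z => R (cfst z) (unseq (csnd z))),
        forall s, sat (Mod c) s (alt_form n 0 n true) <-> P (cpair (s v0) (s v1)) &
        forall s, sat (Mod c) s (alt_form n 1 n true) <-> Q (cpair (s v0) (s v1))].
Proof.
move=> /arith_Sigma_alt_ex[CP hCP hP] /arith_Sigma_alt_ex[CQ hCQ hQ].
pose C i a := let w := foldl cpair (head 0 a) (behead a) in
  if i == 0 then CP w else CQ w.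
have hC : Dec set0 (fun z => C (cfst z) (unseq (csnd z))).
  have behE c : behead (unseq c) = unseq (ctl c) by rewrite -drop1 -unseq_iter_tl.
  apply: (@Dec_ext _ (fun z => let w := foldl (fun r y => cpair r y)
      (chd (csnd z)) (unseq (ctl (csnd z))) in if cfst z == 0 then CP w else CQ w)).
    by move=> z; rewrite /C chdE nth0 behE.
  by rec_tac.
have [c [hc hN]] := exists_structure n hC.
exists c, (rel2 n C); split=> //; first exact: Dec_rel2.
- move=> s; rewrite hP; rewrite (@sat_alt_form _ _ _ CP) ?(models_sort hN) //.
    by rewrite subSnn /=.
  by move=> a sz; rewrite (models_rel hN) // /rel2 sz eqxx.
- move=> s; rewrite hQ; rewrite (@sat_alt_form _ _ _ CQ) ?(models_sort hN) //.
    by rewrite subSnn /=.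
  by move=> a sz; rewrite (models_rel hN) // /rel2 sz eqxx.
Qed.

Lemma free_vars01 n i : free_vars (alt_form n i n true) =i [:: v0; v1].
Proof.
move=> v; rewrite free_vars_alt_form ?leqnSn //.
by have -> : n.+2 - n = 2 by lia.
Qed.

(** * Closure properties of the arithmetical classes *)

Lemma arith_Sigma0P P : arith_Sigma 0 P <-> Dec set0 (fun x => `[< P x >]).
Proof. exact: computable_setP. Qed.

Lemma arith_Sigma_Dec k (b : nat -> bool) : Dec set0 b -> arith_Sigma k (fun x => b x).
Proof.
case: k => [|k] hb; last exact/arith_SigmaP/ce_dec/Rec_set0.
by apply/arith_Sigma0P; apply: Dec_ext hb => x; rewrite asboolb.
Qed.

Lemma arith_Sigma_ext k (P Q : nat -> Prop) :
  (forall x, P x <-> Q x) -> arith_Sigma k P -> arith_Sigma k Q.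
Proof. by move=> h; have -> : P = Q by apply/funext => x; apply/propext. Qed.

Lemma arith_Sigma_comp k (P : nat -> Prop) f :
  arith_Sigma k P -> Rec set0 f -> arith_Sigma k (fun x => P (f x)).
Proof.
case: k => [/arith_Sigma0P hP|k /arith_SigmaP hP] hf.
  by apply/arith_Sigma0P; apply: (Rec_comp1 (g := fun x => nat_of_bool `[< P x >])).
by apply/arith_SigmaP; apply: ce_comp1 => //; apply: Rec_set0.
Qed.

Lemma arith_Sigma_and k (P Q : nat -> Prop) :
  arith_Sigma k P -> arith_Sigma k Q -> arith_Sigma k (fun x => P x /\ Q x).
Proof.
case: k => [/arith_Sigma0P hP /arith_Sigma0P hQ|k /arith_SigmaP hP /arith_SigmaP hQ].
  apply/arith_Sigma0P; apply: (@Dec_ext _ (fun x => `[< P x >] && `[< Q x >])).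
    by move=> x; rewrite asbool_and.
  exact: Dec_and.
by apply/arith_SigmaP/ce_and.
Qed.

Lemma arith_Sigma_or k (P Q : nat -> Prop) :
  arith_Sigma k P -> arith_Sigma k Q -> arith_Sigma k (fun x => P x \/ Q x).
Proof.
case: k => [/arith_Sigma0P hP /arith_Sigma0P hQ|k /arith_SigmaP hP /arith_SigmaP hQ].
  apply/arith_Sigma0P; apply: (@Dec_ext _ (fun x => `[< P x >] || `[< Q x >])).
    by move=> x; rewrite asbool_or.
  exact: Dec_or.
by apply/arith_SigmaP/ce_or.
Qed.

Lemma arith_Sigma_ball k N (P : nat -> nat -> Prop) :
  Rec set0 N -> arith_Sigma k (fun z => P (cfst z) (csnd z)) ->
  arith_Sigma k (fun x => forall i, i < N x -> P x i).
Proof.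
move=> hN; case: k => [/arith_Sigma0P hP|k /arith_SigmaP hP].
  apply/arith_Sigma0P; apply: (@Dec_ext _ (fun x => ball (N x) (fun i => `[< P x i >]))).
    by move=> x; apply/ballP/asboolP => h i /h /asboolP.
  by apply: Dec_ball.
by apply/arith_SigmaP/ce_ball => //; apply: Rec_set0.
Qed.

Lemma arith_Sigma_bex k N (P : nat -> nat -> Prop) :
  Rec set0 N -> arith_Sigma k (fun z => P (cfst z) (csnd z)) ->
  arith_Sigma k (fun x => exists2 i, i < N x & P x i).
Proof.
move=> hN; case: k => [/arith_Sigma0P hP|k /arith_SigmaP hP].
  apply/arith_Sigma0P; apply: (@Dec_ext _ (fun x => bex (N x) (fun i => `[< P x i >]))).
    by move=> x; apply/bexP/asboolP => -[i lt /asboolP h]; exists i.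
  by apply: Dec_bex.
by apply/arith_SigmaP/ce_bex => //; apply: Rec_set0.
Qed.

(** * Canonical indices of finite sets *)

(** Iterated halving instead of division by a power of two, to be computable at
    sight. *)
Definition bit (a i : nat) : bool := odd (iter i (fun r => r./2) a).

Lemma Dec_bit A f g : Rec A f -> Rec A g -> Dec A (fun x => bit (f x) (g x)).
Proof. by move=> hf hg; rewrite /bit; rec_tac. Qed.

Definition shift_down (s : seq nat) : seq nat := [seq j.-1 | j <- s & 0 < j].

(** Parity and half of a canonical index: bit [0] and the index of the set
    shifted down by one. *)
Lemma sum_pow2 s : uniq s ->
  \sum_(i <- s) 2 ^ i = (0 \in s) + (\sum_(i <- shift_down s) 2 ^ i).*2.
Proof.
rewrite /shift_down; elim: s => [|[|j] s IH] /=; first by rewrite !big_nil.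
  by move=> /andP[h /IH]; rewrite big_cons (negbTE h) => ->.
by move=> /andP[_ /IH]; rewrite !big_cons expnS in_cons /= => ->; lia.
Qed.

Lemma mem_shift_down s i : (i \in shift_down s) = (i.+1 \in s).
Proof.
apply/mapP/idP => [[[|j]]|h]; rewrite ?mem_filter //=; first by move=> h ->.
by exists i.+1; rewrite ?mem_filter.
Qed.

Lemma uniq_shift_down s : uniq s -> uniq (shift_down s).
Proof.
move=> h; rewrite map_inj_in_uniq ?filter_uniq //.
by move=> [|i] [|j]; rewrite !mem_filter //= => _ _ ->.
Qed.

Lemma bit_sum_pow2 s i : uniq s -> bit (\sum_(j <- s) 2 ^ j) i = (i \in s).
Proof.
rewrite /bit; elim: i s => [|i IH] s un; rewrite (sum_pow2 un).
  by rewrite /= oddD odd_double addbF; case: (0 \in s).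
by rewrite iterSr half_bit_double IH ?uniq_shift_down // mem_shift_down.
Qed.

Lemma bit_fset_num (A : {fset nat}) i : bit (fset_num A) i = (i \in A).
Proof. by rewrite /fset_num bit_sum_pow2 ?fset_uniq. Qed.

Lemma fset_num_inj : injective fset_num.
Proof. by move=> A B e; apply/fsetP => i; rewrite -!bit_fset_num e. Qed.

Lemma fset_num1 x : fset_num [fset x]%fset = 2 ^ x.
Proof. by rewrite /fset_num big_seq_fset1. Qed.

Lemma fset_num_surj a : exists A, fset_num A = a.
Proof.
suff [s un <-] : exists2 s, uniq s & \sum_(i <- s) 2 ^ i = a.
  exists [fset x in s]%fset; apply: perm_big.
  by apply: uniq_perm; rewrite ?fset_uniq // => x; rewrite in_fset.
elim/ltn_ind: a => -[|a] IH; first by exists [::]; rewrite ?big_nil.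
have [|s un hs] := IH a.+1./2; first by rewrite -divn2 ltn_Pdiv.
exists (nseq (odd a.+1) 0 ++ [seq j.+1 | j <- s]).
  rewrite cat_uniq map_inj_uniq ?un; last by move=> i j [].
  rewrite andbT; apply/andP; split; first by case: (odd _).
  by apply/hasPn => x /mapP[j _ ->]; apply/nseqP => -[].
rewrite big_cat big_map /= -[RHS]odd_double_half -hs; congr addn.
  by rewrite /=; case: (odd a); rewrite /= ?big_cons ?big_nil.
by elim: (s) => [|j t IHt]; rewrite ?big_nil ?big_cons ?IHt ?expnS //; lia.
Qed.

Lemma cl_num_inj : injective cl_num.
Proof. by move=> [x A] [y B] /cpair_inj[/= -> /fset_num_inj ->]. Qed.

(** As every number is a canonical index, a property of finite sets may be
    treated as a property of numbers. *)
Lemma ce_cl_num A (X : set (nat * {fset nat})) (P : nat -> nat -> Prop) :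
  (forall x B, X (x, B) <-> P x (fset_num B)) ->
  ce A (fun z => P (cfst z) (csnd z)) -> ce A (cl_num @` X).
Proof.
move=> h; apply: ce_ext => z; split=> [hz|[[x B] /h hx <-]]; last by rewrite !cpairE.
have [B hB] := fset_num_surj (csnd z).
by exists (cfst z, B); [apply/h; rewrite hB|rewrite /cl_num hB cpairK].
Qed.

(** * Closures under formulas in two variables *)

Lemma cl1_mono Phi N S B B' : B `<=` B' -> cl1 Phi N B S `<=` cl1 Phi N B' S.
Proof.
move=> h b [/h|[f [a [hf [ha ta] hk hb]]]]; first by left.
by right; exists f, a; split=> //; split=> // x /ha/h.
Qed.

Lemma cl_least Phi N S B T : B `<=` T -> cl1 Phi N T S `<=` T -> cl Phi N B S `<=` T.
Proof.
move=> hB hT b [m _]; elim: m b => [|m IH] b /=; first exact: hB.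
by move=> /(cl1_mono IH)/hT.
Qed.

Lemma cl_ge Phi N S B : B `<=` cl Phi N B S.
Proof. by move=> b hb; exists 0. Qed.

Section Closure01.
Variables (n : nat) (R : nat -> seq nat -> bool) (L : language) (N : structure).
Hypothesis hN : models n R L N.
Variables (g1 g2 : form) (E1 E2 : nat -> nat -> Prop).
Hypothesis sat1 : forall s, sat N s g1 <-> E1 (s v0) (s v1).
Hypothesis sat2 : forall s, sat N s g2 <-> E2 (s v0) (s v1).
Variable S : set (option nat).

Let Phi : set pform := [set f | f = form01 g1 \/ f = form01 g2].

(** Stated on one-entry tuples, as this is the set counted in [cl1]. *)
Definition card_in (E : nat -> nat -> Prop) (x : nat) : Prop :=
  exists2 k, S k & has_card [set b : seq nat | exists2 y, b = [:: y] & E x y] k.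

Definition step01 (x b : nat) : Prop :=
  (card_in E1 x /\ E1 x b) \/ (card_in E2 x /\ E2 x b).

Lemma cl1_01 B b : cl1 Phi N B S b <-> B b \/ exists2 x, B x & step01 x b.
Proof.
split=> [[hb|[f [a [hf [ha ta] [k hk hc] [bs hbs hb]]]]]|[hb|[x hx hs]]]; try by left.
  right; have [x ax] : exists x, a = [:: x].
    by case: hf ta => -> /(left_type01 hN).
  exists x; first by apply: ha; rewrite ax /= inE.
  move: hc hbs; rewrite ax; case: hf => ->.
    rewrite (solutions01 hN x sat1) => hc [y e hy]; left.
    by move: hb; rewrite e inE => /eqP->; split=> //; exists k.
  rewrite (solutions01 hN x sat2) => hc [y e hy]; right.
  by move: hb; rewrite e inE => /eqP->; split=> //; exists k.
have hx' : [set` [:: x]] `<=` B by move=> y; rewrite /= inE => /eqP->.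
right; case: hs => -[[k hk hc] hE]; [exists (form01 g1)|exists (form01 g2)]; exists [:: x].
- split; [by left|by split=> //; apply/(left_type01 hN); exists x| |].
    by exists k; rewrite // (solutions01 hN x sat1).
  by exists [:: b]; rewrite ?inE // (solutions01 hN x sat1); exists b.
- split; [by right|by split=> //; apply/(left_type01 hN); exists x| |].
    by exists k; rewrite // (solutions01 hN x sat2).
  by exists [:: b]; rewrite ?inE // (solutions01 hN x sat2); exists b.
Qed.

Lemma cl_step01 B x b : cl Phi N B S x -> step01 x b -> cl Phi N B S b.
Proof. by move=> [m _ hm] hs; exists m.+1 => //; apply/cl1_01; right; exists x. Qed.

Lemma cl_least01 B T :
  B `<=` T -> (forall x b, T x -> step01 x b -> T b) -> cl Phi N B S `<=` T.
Proof.
by move=> hB hT; apply: cl_least => // b /cl1_01[|[x hx]] //; apply: hT.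
Qed.
End Closure01.

Lemma card_in_finite E x :
  card_in (range Some) E x <-> finite_set [set y | E x y].
Proof.
have -> : [set y | E x y] = (fun b : seq nat => head 0 b) @`
    [set b : seq nat | exists2 y, b = [:: y] & E x y].
  apply/funext => y; apply/propext; split=> [h|[b [z -> h] <-]] //.
  by exists [:: y] => //; exists y.
split=> [[k [m _ <-] h]|h]; first by apply: finite_image; exists m.
have [m hm] : finite_set [set b : seq nat | exists2 y, b = [:: y] & E x y].
  apply: sub_finite_set (finite_image (fun y : nat => [:: y]) h).
  by move=> b [y -> hy]; exists y => //; exists [:: y] => //; exists y.
by exists (Some m).
Qed.

Lemma card_in_singleton E x :
  card_in [set Some 1] E x <-> exists y, forall z, E x z <-> z = y.
Proof.
split=> [[k -> /= h]|[y hy]].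
  have [b hb] : exists b, [set b : seq nat | exists2 y, b = [:: y] & E x y] = [set b].
    move: h => /eq_cardSP[b hb]; rewrite II0 card_eq0 => /eqP e.
    by exists b; rewrite -(setD1K hb) e setU0.
  have [y e hy] : [set b : seq nat | exists2 y, b = [:: y] & E x y] b by rewrite hb.
  exists y => z; split=> [hz|->] //.
  have : [set b : seq nat | exists2 y, b = [:: y] & E x y] [:: z] by exists z.
  by rewrite hb e => -[].
exists (Some 1) => //=.
have -> : [set b : seq nat | exists2 y, b = [:: y] & E x y] = [set [:: y]].
  by apply/funext => b; apply/propext; split=> [[z -> /hy ->]|->] //; exists y; rewrite ?hy.
exact: card_set1.
Qed.

(** * Normal forms of the iterated jumps *)

Lemma zero_jump_ex k :
  exists2 B : nat -> Prop, arith_Sigma k (fun z => ~ B z) &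
    forall x, zero_jump k.+1 x <-> exists u, B (cpair x u).
Proof.
have [[B hB e] _] := Sigma_complete_zero_jump k.
by exists B => // x; rewrite e.
Qed.

Lemma zero_jump_ex_all k :
  exists2 M : nat -> Prop, arith_Sigma k (fun z => ~ M z) &
    forall x, zero_jump k.+2 x <-> exists u, forall v, ~ M (cpair (cpair x u) v).
Proof.
have [B [M hM e] h] := zero_jump_ex k.+1.
have BE z : B z <-> forall v, ~ M (cpair z v).
  have eE := congr1 (fun X : set nat => X z) e; rewrite /= in eE.
  split=> [hz v hv|hz]; first by suff : ~ B z by []; rewrite eE; exists v.
  by apply: contrapT; rewrite eE => -[v]; apply: hz.
by exists M => // x; rewrite h; split=> -[u] hu; exists u; apply/BE.
Qed.

(** * Algebraic closure *)

Definition least_witnesses (M : nat -> nat -> Prop) (w : seq nat) : Prop :=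
  forall i, i < size w ->
    M i (nth 0 w i) /\ forall v, v < nth 0 w i -> ~ M i v.

(** Least witnesses make these lists unique for each length, so there are
    infinitely many of them exactly when every [i] has a witness. *)
Lemma finite_least_witnesses M :
  finite_set [set w | least_witnesses M (unseq w)] <-> exists i, forall v, ~ M i v.
Proof.
have /choice[m hm] : forall i, exists v, (exists v', M i v') ->
    M i v /\ forall v', v' < v -> ~ M i v'.
  move=> i; case: (pselect (exists v, M i v)) => [[v0 hv0]|]; last by exists 0.
  have ex : exists v, `[< M i v >] by exists v0; apply/asboolP.
  exists (ex_minn ex) => _; case: ex_minnP => v /asboolP hv min; split=> // v' lt /asboolP h.
  by have := min _ h; rewrite leqNgt lt.
split=> [fin|[i hi]].
  apply: contrapT => /forallNP h.
  have ex i : exists v, M i v by apply: contrapT => /forallNP; exact: h.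
  pose f k := seq_num (mkseq m k).
  apply: infinite_nat; rewrite -[X in finite_set X](_ : f @^-1` [set w | least_witnesses M (unseq w)] = setT).
    apply: finite_preimage fin => j k _ _ /seq_num_inj /(congr1 size).
    by rewrite !size_mkseq.
  apply/funext => k; apply/propext; split=> // _; rewrite /f /= seq_numK => i.
  by rewrite size_mkseq => lt; rewrite nth_mkseq //; apply: hm.
apply: (@sub_finite_set _ _ [set` [seq seq_num (mkseq m k) | k <- iota 0 i.+1]]);
  last exact: finite_seq.
move=> w hw; have le : size (unseq w) <= i.
  by rewrite leqNgt; apply/negP => /hw[/hi].
suff : w \in [seq seq_num (mkseq m k) | k <- iota 0 i.+1] by [].
apply/mapP; exists (size (unseq w)); first by rewrite mem_iota.
rewrite -{1}[w]unseqK; congr seq_num; apply: (@eq_from_nth _ 0) => [|j lt]; first by rewrite size_mkseq.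
rewrite nth_mkseq //; have [h1 h2] := hw _ lt; have [|h3 h4] := hm j; first by eexists; exact: h1.
by case: (ltngtP (nth 0 (unseq w) j) (m j)) => // [/h4|/h2].
Qed.

Section Acl.
Variables (n : nat) (M : nat -> Prop).
Hypothesis hM : arith_Sigma n (fun z => ~ M z).

Let witnesses (x w : nat) : Prop :=
  least_witnesses (fun i v => M (cpair (cpair x i) v)) (unseq w).

(** Inputs are coded by even and solutions by odd elements, so that a
    solution is never an input of the next step of a closure. *)
Definition acl_rel (X Y : nat) : Prop := [/\ ~~ odd X, odd Y & witnesses X./2 Y./2].

(** [acl_rel] is the intersection of a [Sigma_n] and of a [Pi_n] set: that the
    entries of a list are minimal is a bounded quantification over the
    [Sigma_n] set of non-witnesses, that they are witnesses over its
    complement. *)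
Lemma acl_rel_split :
  exists P Q, [/\ arith_Sigma n P, arith_Sigma n Q &
    forall X Y, acl_rel X Y <-> P (cpair X Y) /\ ~ Q (cpair X Y)].
Proof.
pose wit z i := nth 0 (unseq (csnd z)./2) i.
pose inp z i v := cpair (cpair (cfst z)./2 i) v.
exists (fun z => (~~ odd (cfst z) && odd (csnd z)) /\
  forall i, i < size (unseq (csnd z)./2) -> forall v, v < wit z i -> ~ M (inp z i v)).
exists (fun z => exists2 i, i < size (unseq (csnd z)./2) & ~ M (inp z i (wit z i))).
split.
- apply: arith_Sigma_and; first by apply: arith_Sigma_Dec; rec_tac.
  apply: arith_Sigma_ball; first by rec_tac.
  apply: (@arith_Sigma_ball n (fun z => wit (cfst z) (csnd z))
    (fun z v => ~ M (inp (cfst z) (csnd z) v))); first by rewrite /wit; rec_tac.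
  by apply: (arith_Sigma_comp (P := fun z => ~ M z)) => //; rewrite /inp; rec_tac.
- apply: arith_Sigma_bex; first by rec_tac.
  by apply: (arith_Sigma_comp (P := fun z => ~ M z)) => //; rewrite /inp /wit; rec_tac.
move=> X Y; rewrite /acl_rel /wit /inp !cpairE; split.
  move=> [eX oY h]; split; first by rewrite eX oY; split=> // i /h[].
  by move=> [i /h[h1 _]].
move=> [[/andP[eX oY] h1] h2]; split=> // i lt; split; last exact: h1.
by apply: contrapT => h; apply: h2; exists i.
Qed.

Lemma acl_rel_finite x :
  finite_set [set Y | acl_rel x.*2 Y] <-> exists u, forall v, ~ M (cpair (cpair x u) v).
Proof.
rewrite -(finite_least_witnesses (fun i v => M (cpair (cpair x i) v))).
have e : [set Y | acl_rel x.*2 Y] = (fun w => w.*2.+1) @` [set w | witnesses x w].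
  apply/funext => Y; apply/propext; split=> [[_ oY]|[w hw <-]].
    rewrite doubleK => h; exists Y./2 => //; by rewrite -[RHS]odd_double_half oY.
  by split; rewrite ?odd_double //= ?odd_double // doubleK uphalf_double.
rewrite e; split=> [fin|h]; last exact: finite_image.
have inj : {in (fun w => w.*2.+1) @^-1` [set w.*2.+1 | w in [set w | witnesses x w]] &,
    injective (fun w => w.*2.+1)} by move=> a b _ _ []; apply: double_inj.
by apply: sub_finite_set (finite_preimage inj fin) => w hw; exists w.
Qed.

(** [1] codes the empty list of witnesses. *)
Lemma acl_rel1 x : acl_rel x.*2 1.
Proof. by split; rewrite ?odd_double. Qed.
End Acl.

Lemma bool_comb_alt_form n i : bool_comb (Sigma_form n) (alt_form n i n true).
Proof. by constructor; have [] := Sigma_alt_form n i n. Qed.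

Lemma computable_form_set (L : language) n (f1 f2 : pform) :
  is_pform L f1 -> is_pform L f2 ->
  quantifier_rank (body f1) <= n -> quantifier_rank (body f2) <= n ->
  computable_formulas L n [set f | f = f1 \/ f = f2].
Proof.
move=> p1 p2 q1 q2; split; [by move=> f [->|->]| |by move=> f [->|->]].
apply/computable_setP.
apply: (@Dec_ext _ (fun x => (x == pform_num f1) || (x == pform_num f2))); last by rec_tac.
move=> x; apply/idP/asboolP => [/orP[]/eqP->|[f [->|->] <-]]; rewrite ?eqxx ?orbT //.
- by exists f1; first by left.
- by exists f2; first by right.
Qed.

(** The single formula [g] defines [acl_rel].  Its closure operator adds to a
    set only odd elements, which are no inputs, so that the closure is reached
    after one step; and [1] is a solution for every even input [2 x], so that it
    enters the closure of [2 x] exactly when the solutions are finitely many. *)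
Lemma acl_Sigma_complete n :
  exists a : nat,
    [/\ CompStr a,
        Sigma_complete n.+2 (CL_num @` ACL a n) &
        exists Phi : set pform,
          computable_formulas (Lang a) n Phi /\
          Sigma_complete n.+2 (cl_num @` acl Phi (Mod a))].
Proof.
have [M hM hJ] := zero_jump_ex_all n.
have [P [Q [hP hQ hPQ]]] := acl_rel_split hM.
have [c [R [hc hN hR s0 s1]]] := exists_structure2 hP hQ.
pose g := FAnd (alt_form n 0 n true) (FNot (alt_form n 1 n true)).
have satg s : sat (Mod c) s g <-> acl_rel M (s v0) (s v1).
  by rewrite hPQ /= s0 s1.
have pf : is_pform (Lang c) (form01 g).
  apply: (is_pform01 hN); first by rewrite /= !wfb_alt_form.
  by move=> v; rewrite /= mem_cat !free_vars01 orbb.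
exists c; split=> //.
  apply: Sigma_completeI; first exact: ce_finite_solutions hN hR.
  exists (fun x => CL_num (form01 g, [:: x.*2])).
    by apply/computable_funP; rewrite /CL_num /=; rec_tac.
  move=> x; rewrite hJ -(acl_rel_finite M) -card_in_finite (inj_image _ _ CL_num_inj).
  split=> [[_ [k _ <-] h]|[_ _ _]]; last first.
    by rewrite (solutions01 hN _ satg) => -[k hk]; exists (Some k).
  split=> //.
  - rewrite [body _]/=; apply: bool_comb_and; [|apply: bool_comb_not];
    exact: bool_comb_alt_form.
  - by apply/(left_type01 hN); exists x.*2.
  - by exists k; rewrite (solutions01 hN _ satg).
exists [set f | f = form01 g \/ f = form01 g]; split.
  by apply: computable_form_set => //=; rewrite !quantifier_rank_alt_form maxnn.
have stepE X b : step01 (acl_rel M) (acl_rel M) (range Some) X b <->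
    acl_rel M X b /\ zero_jump n.+2 X./2.
  have E : acl_rel M X b ->
      card_in (range Some) (acl_rel M) X <-> zero_jump n.+2 X./2.
    move=> [eX _ _]; rewrite hJ -(acl_rel_finite M) card_in_finite.
    by rewrite -{1}[X]odd_double_half (negbTE eX).
  by split=> [[[h1 h2]|[h1 h2]]|[h1 h2]]; [| |left]; split=> //; apply/E.
have clE B b : acl_of [set f | f = form01 g \/ f = form01 g] (Mod c) B b <->
    B b \/ exists X, [/\ B X, acl_rel M X b & zero_jump n.+2 X./2].
  split=> [|[|[X [hX h hz]]]]; last 2 first.
  - exact: cl_ge.
  - by apply: (cl_step01 hN satg satg (@cl_ge _ _ _ _ _ hX)); apply/stepE.
  apply: (cl_least01 (T := [set b | B b \/
    exists X, [/\ B X, acl_rel M X b & zero_jump n.+2 X./2]]) hN satg satg).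
    by move=> y; left.
  move=> x y hx /stepE[h1 h2]; right; exists x; split=> //.
  case: hx => // -[X [_ [_ ox _] _]]; by case: h1; rewrite ox.
apply: Sigma_completeI.
  apply: (@ce_cl_num _ _ (fun b a => bit a b \/
    exists X, [/\ bit a X, acl_rel M X b & zero_jump n.+2 X./2])).
    move=> x B; split=> [[_ /clE[h|[X [hX h1 h2]]]]|h].
    - by left; rewrite bit_fset_num.
    - by right; exists X; rewrite bit_fset_num.
    split; first by rewrite (models_univ hN); exact: subsetT.
    apply/clE; case: h => [|[X [hX h1 h2]]]; first by rewrite bit_fset_num; left.
    by right; exists X; rewrite bit_fset_num in hX.
  apply: ce_or; first by apply/ce_dec/Dec_bit; rec_tac.
  have hP0 := Rec_jump (arith_Sigma_dec hP); have hQ0 := Rec_jump (arith_Sigma_dec hQ).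
  apply: (@ce_ext _ (fun z => exists X, (bit (csnd z) X &&
      (`[< P (cpair X (cfst z)) >] && ~~ `[< Q (cpair X (cfst z)) >])) /\
      zero_jump n.+2 X./2)).
    move=> z; split=> -[X].
      move=> [/and3P[hb /asboolP h1 /asboolP h2] h3]; exists X; split=> //.
      by apply/hPQ.
    move=> [hb /hPQ[/asboolP h1 h2] h3]; exists X; rewrite hb h1; split=> //=.
    exact/asboolP.
  apply/ce_ex/ce_and.
    apply: ce_dec; rec_tac; first by apply: Dec_bit; rec_tac.
      by apply: (Rec_comp1 hP0); rec_tac.
    by apply: (Rec_comp1 hQ0); rec_tac.
  by apply: (ce_comp1 (ce_jump _)); rec_tac.
exists (fun x => cl_num (1, [fset x.*2]%fset)).
  apply/computable_funP; apply: (@Rec_ext _ (fun x => cpair 1 (2 ^ x.*2))); last by rec_tac.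
  by move=> x; rewrite /cl_num /= fset_num1.
move=> x; rewrite (inj_image _ _ cl_num_inj).
split=> [h|[_ /clE[|[X [+ _ +]]]]].
- split; first by rewrite (models_univ hN); exact: subsetT.
  apply/clE; right; exists x.*2; split; rewrite /= ?inE ?doubleK //.
  exact: acl_rel1.
- by rewrite /= inE => /eqP e; have := odd_double x; rewrite -e.
- by rewrite /= inE => /eqP ->; rewrite doubleK.
Qed.

(** * Definable closure *)

(** The solutions for [x] are [0] and the successors of the witnesses of [x] in
    [zero_jump n.+1], so that being a singleton expresses that there are none. *)
Lemma DCL_turing_equiv n :
  exists b : nat, CompStr b /\ turing_equiv (CL_num @` DCL b n) (zero_jump n.+1).
Proof.
have [B hB hJ] := zero_jump_ex n.
pose E x y := y = 0 \/ B (cpair x y.-1).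
have hP : arith_Sigma n (fun z => ~ E (cfst z) (csnd z)).
  apply: (@arith_Sigma_ext _ (fun z => csnd z != 0 /\ ~ B (cpair (cfst z) (csnd z).-1))).
    by move=> z; rewrite /E not_orP; split=> -[/eqP].
  apply: arith_Sigma_and; first by apply: arith_Sigma_Dec; rec_tac.
  by apply: (arith_Sigma_comp (P := fun z => ~ B z)) => //; rec_tac.
have [c [R [hc hN hR s0 _]]] := exists_structure2 hP hP.
pose g := FNot (alt_form n 0 n true).
have satg s : sat (Mod c) s g <-> E (s v0) (s v1).
  by rewrite /= s0 !cpairE notK.
have pf : is_pform (Lang c) (form01 g).
  apply: (is_pform01 hN); first by rewrite /= !wfb_alt_form.
  exact: free_vars01.
exists c; split=> //; split; apply/turing_leP.
  exact: Dec_singleton_solutions hN hR.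
apply: (@Dec_ext _ (fun x => ~~ `[< (CL_num @` DCL c n) (CL_num (form01 g, [:: x])) >])).
  move=> x; rewrite -asbool_neg; apply: asbool_equiv_eq.
  rewrite hJ (inj_image _ _ CL_num_inj); split=> [h|[u hu] [_ _ _ [b]]].
    apply: contrapT => /forallNP nB; apply: h; split=> //.
    - by rewrite [body _]/=; apply: bool_comb_not; exact: bool_comb_alt_form.
    - by apply/(left_type01 hN); exists x.
    exists [:: 0]; rewrite (solutions01 hN _ satg).
    apply/funext => b; apply/propext; split=> [[y -> [-> //|/nB //]]|->].
    by exists 0 => //; left.
  rewrite (solutions01 hN _ satg) => hb.
  have e y : E x y -> [:: y] = b.
    move=> hy; have : [set b | exists2 y, b = [:: y] & E x y] [:: y] by exists y.
    by rewrite hb.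
  have := e 0 (or_introl erefl); rewrite -(e u.+1) //; by right.
apply: Dec_neg; apply: Rec_oracle; rewrite /CL_num /=; rec_tac.
Qed.

Section Dcl.
Variable M : nat -> Prop.

(** The inputs are the even numbers [2 <x, u>]. From [2 <x, u>] one may go to
    [2 <x, u + 1>], and to [1] if [M <<x, u>, v>] fails for all [v]: for each
    [v] that satisfies [M] there is one more solution besides [1]. *)
Definition dcl_next (X Y : nat) : Prop :=
  ~~ odd X && (Y == (cpair (cfst X./2) (csnd X./2).+1).*2).

Definition dcl_test (X Y : nat) : Prop :=
  ~~ odd X && odd Y /\ (Y./2 = 0 \/ M (cpair X./2 Y./2.-1)).

Lemma dcl_next_singleton X b :
  (exists y, forall z, dcl_next X z <-> z = y) /\ dcl_next X b <-> dcl_next X b.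
Proof.
split=> [[]//|h]; split=> //.
exists (cpair (cfst X./2) (csnd X./2).+1).*2 => z.
move: h => /andP[eX _]; rewrite /dcl_next eX /=; by split=> [/eqP|->].
Qed.

Lemma dcl_test_singleton X b :
  (exists y, forall z, dcl_test X z <-> z = y) /\ dcl_test X b <->
  [/\ ~~ odd X, b = 1 & forall v, ~ M (cpair X./2 v)].
Proof.
split=> [[[y hy] hb]|[eX -> hM]].
  have eX : ~~ odd X by case: hb => /andP[].
  have h1 : 1 = y by apply/hy; split; [rewrite eX|left].
  split=> // [|v hv]; first by rewrite h1; apply/hy.
  have : v.+1.*2.+1 = y.
    apply/hy; split; first by rewrite eX /= odd_double.
    by right; rewrite /= uphalf_double.
  by rewrite -h1.
have h1 : dcl_test X 1 by split; [rewrite eX|left].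
split=> //; exists 1 => z; split=> [[/andP[_ oz] [h|/hM //]]|-> //].
by rewrite -[z]odd_double_half oz h.
Qed.
End Dcl.

(** The closure of a set [A] is computed explicitly: it consists of [A], of the
    elements [2 w] that are reached from some [X] in [A] by increasing the
    second component of the pair, and of [1] if one of these passes the test. *)
Lemma dcl_Sigma_complete n :
  exists (d : nat) (Theta : set pform),
    [/\ CompStr d,
        computable_formulas (Lang d) n Theta &
        Sigma_complete n.+2 (cl_num @` dcl Theta (Mod d))].
Proof.
have [M hM hJ] := zero_jump_ex_all n.
pose B z := forall v, ~ M (cpair z v).
have hP : arith_Sigma n (fun z => ~ dcl_test M (cfst z) (csnd z)).
  apply: (@arith_Sigma_ext _ (fun z => (odd (cfst z) || ~~ odd (csnd z)) \/
      ((csnd z)./2 != 0 /\ ~ M (cpair (cfst z)./2 (csnd z)./2.-1)))).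
    move=> z; rewrite /dcl_test not_andP not_orP; case: (odd (cfst z)); case: (odd (csnd z)) => /=.
    + by split=> _; left.
    + by split=> _; left.
    + by split=> -[//|[/eqP h1 h2]]; right.
    + by split=> _; left.
  apply: arith_Sigma_or; first by apply: arith_Sigma_Dec; rec_tac.
  apply: arith_Sigma_and; first by apply: arith_Sigma_Dec; rec_tac.
  by apply: (arith_Sigma_comp (P := fun z => ~ M z)) => //; rec_tac.
have hQ : arith_Sigma n (fun z => dcl_next (cfst z) (csnd z)).
  by apply: arith_Sigma_Dec; rec_tac.
have [c [R [hc hN hR s0 s1]]] := exists_structure2 hP hQ.
pose g1 := FNot (alt_form n 0 n true); pose g2 := alt_form n 1 n true.
have sat1 s : sat (Mod c) s g1 <-> dcl_test M (s v0) (s v1).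
  by rewrite /= s0 !cpairE notK.
have sat2 s : sat (Mod c) s g2 <-> dcl_next (s v0) (s v1) by rewrite s1 !cpairE.
have pf1 : is_pform (Lang c) (form01 g1).
  by apply: (is_pform01 hN); [rewrite /= wfb_alt_form|exact: free_vars01].
have pf2 : is_pform (Lang c) (form01 g2).
  by apply: (is_pform01 hN); [rewrite wfb_alt_form|exact: free_vars01].
pose Theta : set pform := [set f | f = form01 g1 \/ f = form01 g2].
exists c, Theta; split=> //.
  by apply: computable_form_set => //=; rewrite quantifier_rank_alt_form.
have stepE X b : step01 (dcl_test M) dcl_next [set Some 1] X b <->
    [/\ ~~ odd X, b = 1 & B X./2] \/ dcl_next X b.
  by rewrite /step01 !card_in_singleton dcl_next_singleton dcl_test_singleton.
pose reach X w := ~~ odd X && (cfst w == cfst X./2) && (csnd X./2 <= csnd w).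
have clE A b : dcl_of Theta (Mod c) A b <->
    A b \/ exists X w, [/\ A X, reach X w & b = w.*2 \/ (b = 1 /\ B w)].
  split=> [|[|[X [w [hX rw hb]]]]]; last 2 first.
  - exact: cl_ge.
  - have [eX /eqP e le] : [/\ ~~ odd X, cfst w == cfst X./2 & csnd X./2 <= csnd w].
      by move: rw => /andP[/andP[]].
    have hw k : dcl_of Theta (Mod c) A (cpair (cfst X./2) (csnd X./2 + k)).*2.
      elim: k => [|k IH].
        have XE : X./2.*2 = X by rewrite -[RHS]odd_double_half (negbTE eX).
        by rewrite addn0 cpairK XE; apply: cl_ge.
      apply: (cl_step01 hN sat1 sat2 IH); apply/stepE; right.
      by rewrite /dcl_next odd_double doubleK !cpairE addnS eqxx.
    have {}hw : dcl_of Theta (Mod c) A w.*2.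
      by have := hw (csnd w - csnd X./2); rewrite subnKC // -e cpairK.
    case: hb => [-> //|[-> hB]].
    apply: (cl_step01 hN sat1 sat2 hw); apply/stepE; left.
    by rewrite odd_double doubleK.
  apply: (cl_least01 (T := [set b | A b \/ exists X w,
    [/\ A X, reach X w & b = w.*2 \/ (b = 1 /\ B w)]]) hN sat1 sat2); first by move=> y; left.
  move=> x y hx /stepE hs; right.
  have ex : ~~ odd x by case: hs => [[]//|/andP[]].
  have [X [hX rX]] : exists X, A X /\ reach X x./2.
    case: hx => [hx|[X [w [hX rw [e|[e _]]]]]].
    - by exists x; split=> //; rewrite /reach ex eqxx leqnn.
    - by exists X; split=> //; rewrite e doubleK.
    - by move: ex; rewrite e.
  case: hs => [[_ -> hB]|/andP[_ /eqP ->]].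
    by exists X, x./2; split=> //; right.
  exists X, (cpair (cfst x./2) (csnd x./2).+1); split=> //; last by left.
  by move: rX; rewrite /reach !cpairE => /andP[-> /leqW].
apply: Sigma_completeI.
  apply: (@ce_cl_num _ _ (fun b a => bit a b \/
    exists X w, [/\ bit a X, reach X w & b = w.*2 \/ (b = 1 /\ B w)])).
    move=> x A; split=> [[_ /clE[h|[X [w [hX h1 h2]]]]]|h].
    - by left; rewrite bit_fset_num.
    - by right; exists X, w; rewrite bit_fset_num.
    split; first by rewrite (models_univ hN); exact: subsetT.
    apply/clE; case: h => [|[X [w [hX h1 h2]]]]; first by rewrite bit_fset_num; left.
    by right; exists X, w; rewrite bit_fset_num in hX.
  have hB : Dec (zero_jump n.+1) (fun z => `[< exists v, ~~ `[< ~ M (cpair z v) >] >]).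
    apply: (@Dec_jump_ce (zero_jump n)); apply/ce_ex/ce_dec/Dec_neg.
    by apply: (Rec_comp1 (arith_Sigma_dec hM)); rec_tac.
  apply: ce_or; first by apply/ce_dec/Dec_bit; rec_tac.
  apply: (@ce_ext _ (fun z => exists X w, bit (csnd z) X && reach X w &&
      ((cfst z == w.*2) || ((cfst z == 1) &&
        ~~ `[< exists v, ~~ `[< ~ M (cpair w v) >] >])))).
    have BE w : ~~ `[< exists v, ~~ `[< ~ M (cpair w v) >] >] <-> B w.
      split=> [/asboolP h v hv|h]; last by apply/asboolP => -[v /asboolP]; apply; apply: h.
      by apply: h; exists v; apply/asboolP => /(_ hv).
    move=> z; split=> -[X [w]].
      move=> /andP[/andP[h1 h2] h3]; exists X, w; split=> //.
      by case/orP: h3 => [/eqP|/andP[/eqP e /BE]]; [left|right].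
    move=> [h1 h2 h3]; exists X, w; rewrite h1 h2 /=.
    by case: h3 => [->|[-> /BE->]]; rewrite eqxx ?orbT.
  apply/ce_ex/ce_ex/ce_dec; rewrite /reach; rec_tac; first by apply: Dec_bit; rec_tac.
  by apply: (Rec_comp1 hB); rec_tac.
exists (fun x => cl_num (1, [fset (cpair x 0).*2]%fset)).
  apply/computable_funP; apply: (@Rec_ext _ (fun x => cpair 1 (2 ^ (cpair x 0).*2)));
    last by rec_tac.
  by move=> x; rewrite /cl_num /= fset_num1.
move=> x; rewrite (inj_image _ _ cl_num_inj) hJ.
split=> [[u hu]|[_ /clE[|[X [w [+ rw [|[_ hB]]]]]]]].
- split; first by rewrite (models_univ hN); exact: subsetT.
  apply/clE; right; exists (cpair x 0).*2, (cpair x u).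
  by rewrite /= inE /reach odd_double doubleK !cpairE !eqxx leq0n; split=> //; right.
- by rewrite /= inE => /eqP e; have := odd_double (cpair x 0); rewrite -e.
- by move=> _ e; have := odd_double w; rewrite -e.
- rewrite /= inE => /eqP e; exists (csnd w).
  move: rw; rewrite e /reach doubleK cfstK => /andP[/andP[_ /eqP <-] _].
  by rewrite cpairK.
Qed.

Theorem theorem5p6 (n : nat) :
  (exists a : nat,
     [/\ CompStr a,
         Sigma_complete n.+2 (CL_num @` ACL a n) &
         exists Phi : set pform,
           computable_formulas (Lang a) n Phi /\
           Sigma_complete n.+2 (cl_num @` acl Phi (Mod a))]) /\
  (exists b : nat,
     CompStr b /\ turing_equiv (CL_num @` DCL b n) (zero_jump n.+1)) /\
  (exists (d : nat) (Theta : set pform),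
     [/\ CompStr d,
         computable_formulas (Lang d) n Theta &
         Sigma_complete n.+2 (cl_num @` dcl Theta (Mod d))]).
Proof.
split; first exact: acl_Sigma_complete.
by split; [exact: DCL_turing_equiv|exact: dcl_Sigma_complete].
Qed.
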